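(* Let $M\subset\mathbb{C}^2$ be a smooth Levi-nondegenerate real hypersurface defined by $\rho=0$, with $d\rho\ne0$ on $M$. Then the set $\mathcal{U}$ of umbilical points on $M$ is given by the equation $\det A_3(\rho)=0$, i.e. $\mathcal{U}=\{p\in M:\det A_3(\rho)(p)=0\}$.
   Context: Coordinates on $\mathbb{C}^2$ are $Z=(z,w)$; subscripts denote partial derivatives. For a smooth real function $\rho$ put $L=-\rho_w\partial_z+\rho_z\partial_w$, $\bar L=-\rho_{\bar w}\partial_{\bar z}+\rho_{\bar z}\partial_{\bar w}$, and $\rho_{Z^2}(L,L)=\rho_{zz}\rho_w^2-2\rho_{zw}\rho_z\rho_w+\rho_{ww}\rho_z^2$. Then $A_3(\rho)$ is the $5\times5$ matrix whose $j$-th column, $j=0,\dots,4$, is $\bar L^j$ applied to the column vector $(\rho_w^3,\ \rho_z\rho_w^2,\ \rho_z^2\rho_w,\ \rho_z^3,\ \rho_{Z^2}(L,L))^t$. Umbilical points: by Chern and Moser, for a Levi-nondegenerate hypersurface $M\subset\mathbb{C}^2$ and $p\in M$ there are (formal) holomorphic coordinates $(z,w)$ vanishing at $p$ in which $M$ is given by $\operatorname{Im}w=\phi(z,\bar z,\operatorname{Re}w)$ (formally, if $M$ is only smooth), with $\phi(z,\bar z,u)=\sum_{k,l}\phi_{kl}(u)z^k\bar z^l$ real-valued, $\phi_{11}=1$ and $\phi_{0k}=\phi_{1s}=\phi_{22}=\phi_{23}=\phi_{33}=0$ for all $k\ge0$, $s\ge2$ (Chern--Moser normal form). The point $p$ is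 called umbilical if $\phi_{24}(0)=0$; this condition does not depend on the choice of such coordinates. *)

(* Defs.v *)
From HB Require Import structures.
From mathcomp Require Import all_boot all_order all_algebra.
From mathcomp Require Import complex.
From mathcomp Require Import all_classical all_reals all_analysis.

Set Implicit Arguments.
Unset Strict Implicit.
Unset Printing Implicit Defensive.

Import Order.TTheory GRing.Theory Num.Theory.
Import numFieldNormedType.Exports.

Local Open Scope classical_set_scope.
Local Open Scope complex_scope.
Local Open Scope ring_scope.

(* C^2 is realized as R^4: a point p has complex coordinates
   z = p_0 + i p_1 and w = p_2 + i p_3. *)
Definition zcoord (R : realType) (p : 'rV[R]_4) : R[i] := p 0 0 +i* p 0 1.

Definition wcoord (R : realType) (p : 'rV[R]_4) : R[i] := p 0 2 +i* p 0 3.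

Fixpoint Ck_on (R : realType) (k : nat) (Omega : set 'rV[R]_4)
    (f : 'rV[R]_4 -> R) : Prop :=
  match k with
  | 0 => forall p, Omega p -> {for p, continuous f}
  | k'.+1 => (forall p, Omega p -> differentiable f p) /\
             (forall i : 'I_4, Ck_on k' Omega ('D_(delta_mx 0 i) f))
  end.

Definition smooth_on (R : realType) (Omega : set 'rV[R]_4)
    (f : 'rV[R]_4 -> R) : Prop := forall k, Ck_on k Omega f.

Definition cplx_fun (R : realType) (f : 'rV[R]_4 -> R) : 'rV[R]_4 -> R[i] :=
  fun p => (f p)%:C.

Definition pderiv (R : realType) (i : 'I_4) (f : 'rV[R]_4 -> R[i]) :
    'rV[R]_4 -> R[i] :=
  fun p => 'D_(delta_mx 0 i) (fun q => complex.Re (f q)) p +i*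
           'D_(delta_mx 0 i) (fun q => complex.Im (f q)) p.

Definition d_z (R : realType) (f : 'rV[R]_4 -> R[i]) : 'rV[R]_4 -> R[i] :=
  fun p => (pderiv 0 f p - 'i%C * pderiv 1 f p) / 2.

Definition d_zbar (R : realType) (f : 'rV[R]_4 -> R[i]) : 'rV[R]_4 -> R[i] :=
  fun p => (pderiv 0 f p + 'i%C * pderiv 1 f p) / 2.

Definition d_w (R : realType) (f : 'rV[R]_4 -> R[i]) : 'rV[R]_4 -> R[i] :=
  fun p => (pderiv 2 f p - 'i%C * pderiv 3 f p) / 2.

Definition d_wbar (R : realType) (f : 'rV[R]_4 -> R[i]) : 'rV[R]_4 -> R[i] :=
  fun p => (pderiv 2 f p + 'i%C * pderiv 3 f p) / 2.

Definition zero_locus (R : realType) (Omega : set 'rV[R]_4)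
    (rho : 'rV[R]_4 -> R) : set 'rV[R]_4 :=
  [set p | Omega p /\ rho p = 0].

(* The vector a d/dz + b d/dw is tangent to the level set of rho through p. *)
Definition hol_tangent (R : realType) (rho : 'rV[R]_4 -> R) (p : 'rV[R]_4)
    (a b : R[i]) : Prop :=
  d_z (cplx_fun rho) p * a + d_w (cplx_fun rho) p * b = 0.

Definition levi_form (R : realType) (rho : 'rV[R]_4 -> R) (p : 'rV[R]_4)
    (a b c d : R[i]) : R[i] :=
  let r := cplx_fun rho in
  d_zbar (d_z r) p * a * c^*%C + d_wbar (d_z r) p * a * d^*%C +
  d_zbar (d_w r) p * b * c^*%C + d_wbar (d_w r) p * b * d^*%C.

Definition levi_nondegenerate (R : realType) (M : set 'rV[R]_4)
    (rho : 'rV[R]_4 -> R) : Prop :=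
  forall p, M p -> forall a b : R[i], hol_tangent rho p a b ->
    (forall c d : R[i], hol_tangent rho p c d -> levi_form rho p a b c d = 0) ->
    a = 0 /\ b = 0.

Definition Lbar (R : realType) (rho : 'rV[R]_4 -> R) (f : 'rV[R]_4 -> R[i]) :
    'rV[R]_4 -> R[i] :=
  let r := cplx_fun rho in
  fun p => - d_wbar r p * d_zbar f p + d_zbar r p * d_wbar f p.

Definition rho_ZZ (R : realType) (rho : 'rV[R]_4 -> R) : 'rV[R]_4 -> R[i] :=
  let r := cplx_fun rho in
  fun p => d_z (d_z r) p * d_w r p ^+ 2
           - 2 * d_w (d_z r) p * d_z r p * d_w r p
           + d_w (d_w r) p * d_z r p ^+ 2.

Definition A3_col (R : realType) (rho : 'rV[R]_4 -> R) :
    seq ('rV[R]_4 -> R[i]) :=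
  let r := cplx_fun rho in
  [:: (fun p => d_w r p ^+ 3);
      (fun p => d_z r p * d_w r p ^+ 2);
      (fun p => d_z r p ^+ 2 * d_w r p);
      (fun p => d_z r p ^+ 3);
      rho_ZZ rho].

Definition A3 (R : realType) (rho : 'rV[R]_4 -> R) (p : 'rV[R]_4) :
    'M[R[i]]_5 :=
  \matrix_(i < 5, j < 5)
    iter j (Lbar rho) (nth (fun=> 0) (A3_col rho) i) p.

(* A formal power series is given by its coefficients; hol_trunc and phi_trunc
   evaluate the Taylor polynomial of total degree at most N. *)
Definition hol_trunc (R : realType) (N : nat) (F : nat -> nat -> R[i])
    (z w : R[i]) : R[i] :=
  \sum_(j < N.+1) \sum_(k < N.+1 | (j + k <= N)%N) F j k * z ^+ j * w ^+ k.

Definition phi_trunc (R : realType) (N : nat)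
    (phi : nat -> nat -> nat -> R[i]) (z : R[i]) (u : R) : R[i] :=
  \sum_(k < N.+1) \sum_(l < N.+1) \sum_(m < N.+1 | (k + l + m <= N)%N)
    phi k l m * z ^+ k * z^*%C ^+ l * u%:C ^+ m.

(* (F, G) is a formal biholomorphism of (C^2, 0). *)
Definition formal_coords (R : realType) (F G : nat -> nat -> R[i]) : Prop :=
  [/\ F 0%N 0%N = 0, G 0%N 0%N = 0 &
      F 1%N 0%N * G 0%N 1%N - F 0%N 1%N * G 1%N 0%N != 0].

(* phi k l m is the coefficient of z^k zbar^l u^m, so that the coefficient
   phi_kl(u) is the formal series in u with coefficients phi k l. *)
Definition chern_moser_normal (R : realType)
    (phi : nat -> nat -> nat -> R[i]) : Prop :=
  (forall k l m, phi l k m = ((phi k l m)^*%C)) /\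
  (forall m, phi 1%N 1%N m = (m == 0%N)%:R) /\
  (forall k m, phi 0%N k m = 0) /\
  (forall s m, (2 <= s)%N -> phi 1%N s m = 0) /\
  (forall m, [/\ phi 2%N 2%N m = 0, phi 2%N 3%N m = 0 & phi 3%N 3%N m = 0]).

(* In the formal coordinates z = F(Z - p), w = G(Z - p), the hypersurface M is
   formally given at p by Im w = phi(z, zbar, Re w): along M, the difference of
   both sides vanishes at p to infinite order. A change of the coefficients of
   degree > N affects this difference only at order N + 1, so truncating all
   the series at degree N is harmless in the N-th condition. *)
Definition formally_given_by (R : realType) (M : set 'rV[R]_4) (p : 'rV[R]_4)
    (F G : nat -> nat -> R[i]) (phi : nat -> nat -> nat -> R[i]) : Prop :=
  forall N : nat, exists C : R, \forall q \near within M (nbhs p),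
    let Z := q - p in
    let z := hol_trunc N F (zcoord Z) (wcoord Z) in
    let w := hol_trunc N G (zcoord Z) (wcoord Z) in
    `|(complex.Im w)%:C - phi_trunc N phi z (complex.Re w)|
      <= (C * `|Z| ^+ N.+1)%:C.

Definition umbilical (R : realType) (M : set 'rV[R]_4) (p : 'rV[R]_4) : Prop :=
  exists (F G : nat -> nat -> R[i]) (phi : nat -> nat -> nat -> R[i]),
    [/\ formal_coords F G, chern_moser_normal phi,
        formally_given_by M p F G phi & phi 2%N 4%N 0%N = 0].

Definition umbilical_points (R : realType) (M : set 'rV[R]_4) :
    set 'rV[R]_4 := [set p | M p /\ umbilical M p].

(* Main.v *)
Require Import Defs.
From mathcomp Require Import all_boot all_order all_algebra.
From mathcomp Require Import complex.
From mathcomp Require Import all_classical all_reals all_analysis.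
From mathcomp Require Import ring lra zify.
From HB Require Import structures.
Set Implicit Arguments.
Unset Strict Implicit.
Unset Printing Implicit Defensive.
Import Order.TTheory GRing.Theory Num.Theory.
Import numFieldNormedType.Exports.
Local Open Scope classical_set_scope.
Local Open Scope ring_scope.

(** At every point [p] of the hypersurface [M], the determinant is compared with
    the one obtained from the equation [r' = Im G - phi (F, Fb, Re G)] that a
    normal form at [p] provides, its series being cut at a high degree.

    Since [r'] vanishes along [M] to high order, it is equal to [h rho] up to a
    flat error ([nfs_divisible]).  Modulo multiples of [rho], replacing [rho] by
    [h rho] multiplies the initial column by [h^3] and the operator by [h], so
    the two matrices at [p] differ by a triangular factor with powers of [h p]
    on its diagonal ([A3ring_rescale]).

    For [r'] itself, the chain rule expresses the initial column through the
    corresponding column in the coordinates [(F, G)] and a matrix with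
    holomorphic entries, which are constants for the operator; its determinant
    is a power of the Jacobian ([A3ring_nf]).  What remains is a Wronskian.
    The ideal generated by [F], [G] and [r'] is stable under the operator, and
    modulo this ideal the entries of the column are the powers [1, Fb, Fb^2,
    Fb^3] up to units, and [phi_24 Fb^4] up to a unit and to higher powers of
    [Fb]; the operator sends [Fb] to a unit.  Hence the Wronskian is triangular
    at [p], and its determinant is a nonzero multiple of [phi_24]
    ([det_nf_eq0]).  So the determinant of the theorem vanishes at [p] if and
    only if [phi_24] does, for any normal form at [p] ([det_A3_eq0_iff]).

    It remains to see that normal forms exist ([normal_form_exists]).  In
    coordinates in which [M] is [Im w = |z|^2] up to terms of weight 3, [z]
    having weight 1 and [w] weight 2 ([chart_exists]), every smooth function is,
    along [M], a polynomial in [z], its conjugate and [u = Re w] up to any given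
    order ([smooth_divisible]), and the weights of this polynomial can be read
    off from its order of vanishing along [M] ([wpol_order]).  The terms of the
    lowest weight are then brought to normal form by solving the linearized
    equation of Chern and Moser ([solv_whom]), one weight after the other
    ([newton_step]).

    Everything is carried out with smooth functions and orders of vanishing;
    formal series only occur through their truncations. *)

(** * Orders of vanishing *)

Section Modulus.
Variable R : realType.
Implicit Types z w : R[i].

(** The norm of [R[i]] takes its values in [R[i]]; estimates are made with its real version. *)
Definition modulus z : R := Normc.normc z.

Lemma modulus_ge0 z : 0 <= modulus z.
Proof. by rewrite /modulus; case: z => a b /=; rewrite sqrtr_ge0. Qed.

Lemma modulusM z w : modulus (z * w) = modulus z * modulus w.
Proof. exact: Normc.normcM. Qed.

Lemma modulusD z w : modulus (z + w) <= modulus z + modulus w.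
Proof. exact: le_normcD. Qed.

Lemma modulusN z : modulus (- z) = modulus z.
Proof. exact: normcN. Qed.

Lemma modulusB z w : modulus (z - w) <= modulus z + modulus w.
Proof. by rewrite -(modulusN w) modulusD. Qed.

Lemma modulus0 : modulus 0 = 0. Proof. exact: Normc.normc0. Qed.

Lemma modulus1 : modulus 1 = 1. Proof. exact: Normc.normc1. Qed.

Lemma modulus_eq0 z : modulus z = 0 -> z = 0.
Proof. exact: Normc.eq0_normc. Qed.

Lemma modulusX z n : modulus (z ^+ n) = modulus z ^+ n.
Proof. by elim: n => [|n IH]; rewrite ?expr0 ?modulus1 // !exprS modulusM IH. Qed.

Lemma modulusJ z : modulus (z^*)%C = modulus z.
Proof. by case: z => a b; rewrite /modulus /= sqrrN. Qed.

Lemma modulusR (x : R) : modulus (x%:C)%C = `|x|.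
Proof. by rewrite /modulus /= expr0n /= addr0 sqrtr_sqr. Qed.

Lemma modulus_Re z : `|complex.Re z| <= modulus z.
Proof.
case: z => a b; rewrite /modulus /= -sqrtr_sqr ler_sqrt ?lerDl ?sqr_ge0 //.
by rewrite addr_ge0 ?sqr_ge0.
Qed.

Lemma modulus_Im z : `|complex.Im z| <= modulus z.
Proof.
case: z => a b; rewrite /modulus /= -sqrtr_sqr ler_sqrt ?lerDr ?sqr_ge0 //.
by rewrite addr_ge0 ?sqr_ge0.
Qed.

Lemma modulus_le_ReIm z : modulus z <= `|complex.Re z| + `|complex.Im z|.
Proof.
case: z => a b; have -> : (a +i* b)%C = (a%:C + 'i * b%:C)%C.
  by simpc.
apply: le_trans (modulusD _ _) _.
rewrite modulusM !modulusR {1}/modulus /=.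
by rewrite expr0n expr1n add0r sqrtr1 !mul0r !mul1r subr0 addr0 !add0r.
Qed.

Lemma mul_conjc_modulus z : z * z^*%C = (modulus z ^+ 2)%:C%C.
Proof.
case: z => a b; rewrite /modulus /= sqr_sqrtr ?addr_ge0 ?sqr_ge0 //.
by apply/eqP; rewrite eq_complex /=; apply/andP; split; apply/eqP; ring.
Qed.

Lemma normcE z : `|z| = ((modulus z)%:C)%C.
Proof. by rewrite normc_def; case: z. Qed.

Lemma le_normcE z (x : R) : (`|z| <= (x%:C)%C) = (modulus z <= x).
Proof. by rewrite normcE lecR. Qed.

End Modulus.

Section BigO.
Variables (R : realType) (T : Type).
Variables (F : set_system T) (FF : Filter F) (g : T -> R).
Hypothesis g01 : \forall q \near F, 0 <= g q <= 1.
Implicit Types f h : T -> R[i].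

(** The filter is that of the neighbourhoods of a point or its trace on the
    hypersurface; the gauge is the distance to the point or the weighted size
    in adapted coordinates. *)
Definition bigO (G : set_system T) (gauge : T -> R) (k : nat) (f : T -> R[i]) :=
  exists C : R, \forall q \near G, modulus (f q) <= C * gauge q ^+ k.

Lemma bigO_ge0 k f : bigO F g k f ->
  exists2 C : R, 0 <= C & \forall q \near F, modulus (f q) <= C * g q ^+ k.
Proof.
move=> [C HC]; exists `|C| => //; near=> q.
have Hq : modulus (f q) <= C * g q ^+ k by near: q.
have /andP[g0 _] : 0 <= g q <= 1 by near: q.
by apply: le_trans Hq _; rewrite ler_wpM2r ?exprn_ge0 ?ler_norm.
Unshelve. all: by end_near. Qed.

Lemma bigO_near k f h : (\forall q \near F, f q = h q) -> bigO F g k f -> bigO F g k h.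
Proof.
move=> E [C HC]; exists C; near=> q.
have <- : f q = h q by near: q.
by near: q.
Unshelve. all: by end_near. Qed.

Lemma bigO_eq k f h : f =1 h -> bigO F g k f -> bigO F g k h.
Proof. by move=> E; apply: bigO_near; near=> q. Unshelve. all: by end_near. Qed.

Lemma bigOD k f h : bigO F g k f -> bigO F g k h -> bigO F g k (fun q => f q + h q).
Proof.
move=> [C HC] [D HD]; exists (C + D); near=> q.
apply: le_trans (modulusD _ _) _; rewrite mulrDl lerD //; by near: q.
Unshelve. all: by end_near. Qed.

Lemma bigON k f : bigO F g k f -> bigO F g k (fun q => - f q).
Proof. by move=> [C HC]; exists C; near=> q; rewrite modulusN; near: q.
Unshelve. all: by end_near. Qed.

Lemma bigOB k f h : bigO F g k f -> bigO F g k h -> bigO F g k (fun q => f q - h q).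
Proof. by move=> A B; apply: bigOD => //; apply: bigON. Qed.

Lemma bigO_conj k f : bigO F g k f -> bigO F g k (fun q => (f q)^*%C).
Proof. by move=> [C HC]; exists C; near=> q; rewrite modulusJ; near: q.
Unshelve. all: by end_near. Qed.

Lemma bigOM k l f h : bigO F g k f -> bigO F g l h ->
  bigO F g (k + l) (fun q => f q * h q).
Proof.
move=> [C HC] [D HD]; exists (C * D); near=> q.
rewrite modulusM exprD mulrACA ler_pM ?modulus_ge0 //; by near: q.
Unshelve. all: by end_near. Qed.

Lemma bigO0 k : bigO F g k (fun=> 0).
Proof. by exists 0; near=> q; rewrite modulus0 mul0r.
Unshelve. all: by end_near. Qed.

Lemma bigO_cst c : bigO F g 0 (fun=> c).
Proof. by exists (modulus c); near=> q; rewrite expr0 mulr1.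
Unshelve. all: by end_near. Qed.

Lemma bigO_le k l f : (l <= k)%N -> bigO F g k f -> bigO F g l f.
Proof.
move=> lk /bigO_ge0[C C0 HC]; exists C; near=> q.
have /andP[g0 g1] : 0 <= g q <= 1 by near: q.
have Hq : modulus (f q) <= C * g q ^+ k by near: q.
by apply: le_trans Hq _; rewrite ler_wpM2l // ler_wiXn2l.
Unshelve. all: by end_near. Qed.

Lemma bigOZ k c f : bigO F g k f -> bigO F g k (fun q => c * f q).
Proof. by move=> H; rewrite -[k]add0n; apply: bigOM => //; apply: bigO_cst. Qed.

Lemma bigOX k n f : bigO F g k f -> bigO F g (k * n) (fun q => f q ^+ n).
Proof.
move=> H; elim: n => [|n IH].
  rewrite muln0; apply: bigO_eq (bigO_cst 1) => q; by rewrite expr0.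
by rewrite mulnS; apply: bigO_eq (bigOM H IH) => q; rewrite exprS.
Qed.

Lemma bigO_sum (I : Type) (r : seq I) (P : pred I) k (f : I -> T -> R[i]) :
  (forall i, P i -> bigO F g k (f i)) -> bigO F g k (fun q => \sum_(i <- r | P i) f i q).
Proof.
move=> H; elim: r => [|i r IH].
  by apply: bigO_eq (bigO0 k) => q; rewrite big_nil.
case: (boolP (P i)) => Pi.
  by apply: bigO_eq (bigOD (H _ Pi) IH) => q; rewrite big_cons Pi.
by apply: bigO_eq IH => q; rewrite big_cons (negbTE Pi).
Qed.

End BigO.

(** * Smooth functions on an open set *)

Lemma near_eq_differentiable (R : realType) (V W : normedModType R)
    (f g : V -> W) (p : V) :
  (\forall q \near p, f q = g q) -> differentiable f p -> differentiable g p.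
Proof.
move=> fg /diff_locallyP[dfc dfo].
have fgp : f p = g p by apply: nbhs_singleton fg.
have H : g \o shift p = cst (g p) + 'd f p +o_ 0 id.
  apply/eqaddoP => e e0; near=> h.
  have E : f (h + p) = g (h + p).
    by near: h; have := fg; rewrite (near_shift 0 p) /= subr0; apply.
  have : `|(f \o shift p) h - (cst (f p) + 'd f p) h| <= e * `|h|.
    by near: h; have /eqaddoP/(_ _ e0) := dfo; apply.
  by rewrite /= E fgp.
by apply/diff_locallyP; rewrite (diff_unique dfc H).
Unshelve. all: by end_near. Qed.

Section Smooth.
Variables (R : realType) (Omega : set 'rV[R]_4).
Hypothesis openO : open Omega.
Implicit Types f g : 'rV[R]_4 -> R.

Lemma near_Omega (p : 'rV[R]_4) : Omega p -> \forall q \near p, Omega q.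
Proof. by move=> Op; apply: open_nbhs_nbhs. Qed.

Lemma Ck_on_eq k f g : (forall q, Omega q -> f q = g q) ->
  Ck_on k Omega f -> Ck_on k Omega g.
Proof.
elim: k f g => [|k IH] f g E /=.
  move=> H p Op.
  have fg : \forall q \near p, f q = g q.
    by near=> q; apply: E; near: q; apply: near_Omega.
  suff : g @ p --> f p by rewrite (E _ Op).
  exact: (cvg_trans (near_eq_cvg fg) (H p Op)).
case=> Df DDf; split.
  move=> p Op.
  have fg : \forall q \near p, f q = g q.
    by near=> q; apply: E; near: q; apply: near_Omega.
  by apply: near_eq_differentiable fg _; apply: Df.
move=> i; apply: IH (DDf i) => q Oq; apply: near_eq_derive.
by near=> x; apply: E; near: x; apply: near_Omega.
Unshelve. all: by end_near. Qed.

Lemma smooth_on_eq f g : (forall q, Omega q -> f q = g q) ->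
  smooth_on Omega f -> smooth_on Omega g.
Proof. by move=> E H k; apply: Ck_on_eq E (H k). Qed.

Lemma smooth_diff f p : smooth_on Omega f -> Omega p -> differentiable f p.
Proof. by move=> /(_ 1%N) [H _]; apply: H. Qed.

Lemma smooth_derive f i : smooth_on Omega f -> smooth_on Omega ('D_(delta_mx 0 i) f).
Proof. by move=> H k; have [_] := H k.+1; apply. Qed.

Lemma smooth_derivable f p v : smooth_on Omega f -> Omega p -> derivable f p v.
Proof. by move=> H Op; apply: diff_derivable; apply: smooth_diff. Qed.

Lemma smooth_continuous f p : smooth_on Omega f -> Omega p -> {for p, continuous f}.
Proof. by move=> H; have := H 0%N; apply. Qed.

Lemma Ck_onD k f g : Ck_on k Omega f -> Ck_on k Omega g ->
  Ck_on k Omega (fun q => f q + g q).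
Proof.
elim: k f g => [|k IH] f g /=.
  by move=> Hf Hg p Op; apply: continuousD; [apply: Hf|apply: Hg].
move=> [Df DDf] [Dg DDg]; split; first by move=> p Op; apply: differentiableD; auto.
move=> i; apply: (Ck_on_eq _ (IH _ _ (DDf i) (DDg i))) => q Oq.
by rewrite deriveD //; apply: diff_derivable; auto.
Qed.

Lemma smooth_onD f g : smooth_on Omega f -> smooth_on Omega g ->
  smooth_on Omega (fun q => f q + g q).
Proof. by move=> Hf Hg k; apply: Ck_onD. Qed.

Lemma smooth_on_cst c : smooth_on Omega (fun=> c).
Proof.
move=> k; elim: k c => [|k IH] c /=; first by move=> p _; apply: cst_continuous.
split; first by move=> p _; apply: differentiable_cst.
by move=> i; apply: (Ck_on_eq _ (IH 0)) => q Oq; rewrite derive_cst.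
Qed.

Lemma smooth_onM f g : smooth_on Omega f -> smooth_on Omega g ->
  smooth_on Omega (fun q => f q * g q).
Proof.
move=> Hf Hg k; elim: k f g Hf Hg => [|k IH] f g Hf Hg /=.
  by move=> p Op; apply: continuousM; apply: smooth_continuous.
split; first by move=> p Op; apply: differentiableM; apply: smooth_diff.
move=> i.
have H : Ck_on k Omega (fun q => f q * 'D_(delta_mx 0 i) g q + g q * 'D_(delta_mx 0 i) f q).
  by apply: Ck_onD; apply: IH => //; apply: smooth_derive.
apply: (Ck_on_eq _ H) => q Oq.
by rewrite deriveM //; apply: smooth_derivable.
Qed.

Lemma smooth_onN f : smooth_on Omega f -> smooth_on Omega (fun q => - f q).
Proof.
move=> Hf; apply: (smooth_on_eq _ (smooth_onM (smooth_on_cst (-1)) Hf)) => q _.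
by rewrite mulN1r.
Qed.

Lemma smooth_onB f g : smooth_on Omega f -> smooth_on Omega g ->
  smooth_on Omega (fun q => f q - g q).
Proof. by move=> Hf Hg; apply: smooth_onD => //; apply: smooth_onN. Qed.

Lemma derive_coord (p q : 'rV[R]_4) i j :
  'D_(delta_mx 0 i) (fun x : 'rV[R]_4 => (x - p) 0 j) q = (i == j)%:R.
Proof.
have -> : (fun x : 'rV[R]_4 => (x - p) 0 j) =
          (fun x : 'rV[R]_4 => x 0 j : R) + cst (- p 0 j).
  by apply/funext => x; rewrite !mxE.
rewrite deriveD; last 2 first.
- by apply: diff_derivable; apply: differentiable_coord.
- exact: derivable_cst.
rewrite derive_cst addr0 deriveE; last exact: differentiable_coord.
have L : linear (fun x : 'rV[R]_4 => x 0 j : R^o) by move=> a x y; rewrite !mxE.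
pose lm := GRing.isLinear.Build _ _ _ _ (fun x : 'rV[R]_4 => x 0 j : R^o) L.
pose LF : {linear 'rV[R]_4 -> R^o} := HB.pack (fun x : 'rV[R]_4 => x 0 j : R^o) lm.
rewrite (@diff_lin _ _ _ LF q) /=; first by rewrite mxE eqxx /= eq_sym.
by move=> x; apply: differentiable_continuous; apply: differentiable_coord.
Qed.

Lemma smooth_on_coord p j : smooth_on Omega (fun q => (q - p) 0 j).
Proof.
have D (q : 'rV[R]_4) : differentiable (fun x : 'rV[R]_4 => (x - p) 0 j) q.
  have -> : (fun x : 'rV[R]_4 => (x - p) 0 j) =
          (fun x : 'rV[R]_4 => x 0 j : R) + cst (- p 0 j).
    by apply/funext => x; rewrite !mxE.
  by apply: differentiableD; [apply: differentiable_coord|apply: differentiable_cst].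
case=> [|k] /=; first by move=> q _; apply: differentiable_continuous.
split=> // i.
apply: (Ck_on_eq _ (smooth_on_cst (i == j)%:R k)) => q _.
by rewrite derive_coord.
Qed.

End Smooth.

(** * Taylor expansion and symmetry of second derivatives *)

Section Taylor.
Variables (R : realType) (Omega : set 'rV[R]_4).
Hypothesis openO : open Omega.
Implicit Types f g : 'rV[R]_4 -> R.

Notation partial i f := ('D_(delta_mx 0 i) f).

Lemma ball_Omega (p : 'rV[R]_4) : Omega p ->
  exists2 r : R, 0 < r & forall x, `|x| < r -> Omega (p + x).
Proof.
move=> /(near_Omega openO) /nbhs_normP[r /= r0 H]; exists r => // x xr.
by apply: H; rewrite /= opprD addNKr normrN.
Qed.

Lemma is_derive_line f (a x : 'rV[R]_4) (t : R) :
  smooth_on Omega f -> Omega (a + t *: x) ->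
  is_derive t 1 (fun s : R => f (a + s *: x))
    (\sum_(i < 4) x 0 i * partial i f (a + t *: x)).
Proof.
move=> sf Oq.
have df : differentiable f (a + t *: x) by apply: smooth_diff sf Oq.
have E : (fun h : R => h^-1 *: (f (a + (h *: (1 : R) + t) *: x) - f (a + t *: x)))
       = (fun h : R => h^-1 *: (f (h *: x + (a + t *: x)) - f (a + t *: x))).
  apply/funext => h; congr (_ *: (f _ - _)).
  by rewrite -[h *: 1]/(h * 1) mulr1 scalerDl addrCA.
have [D1 D2] : derivable f (a + t *: x) x /\
    'D_x f (a + t *: x) = \sum_(i < 4) x 0 i * partial i f (a + t *: x).
  split; first exact: diff_derivable.
  rewrite deriveE //.
  have L y : 'd f (a + t *: x) y = \sum_(i < 4) y 0 i * 'd f (a + t *: x) (delta_mx 0 i).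
    rewrite {1}(row_sum_delta y) linear_sum; apply: eq_bigr => i _.
    by rewrite linearZ.
  rewrite L; apply: eq_bigr => i _.
  by rewrite deriveE.
split; first by rewrite /derivable /= E.
by rewrite -D2 /derive /= E.
Qed.

Lemma is_derive_monomial (d : nat) (c t : R) :
  is_derive t 1 (fun s : R => s ^+ d * c) (d%:R * t ^+ d.-1 * c).
Proof.
have -> : (fun s : R => s ^+ d * c) = c \*: ((id : R -> R) ^+ d).
  by apply/funext => s; rewrite mulrC /= exprfctE.
apply: is_derive_eq.
by rewrite /GRing.scale /= mulr1 mulrC mulr_natl.
Qed.

(** The recursion through first derivatives replaces multi-indices, and gives the
    factor [1/d!] as a product. *)
Fixpoint taylor_term (p : 'rV[R]_4) (d : nat) f (x : 'rV[R]_4) : R :=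
  if d is e.+1 then
    (\sum_(i < 4) x 0 i * taylor_term p e (partial i f) x) / d%:R
  else f p.

Lemma taylor_term_scale p d f t x :
  taylor_term p d f (t *: x) = t ^+ d * taylor_term p d f x.
Proof.
elim: d f => [|d IH] f /=; first by rewrite expr0 mul1r.
rewrite mulrA; congr (_ / _); rewrite mulr_sumr; apply: eq_bigr => i _.
by rewrite IH mxE exprS; ring.
Qed.

Lemma coord_le_norm (x : 'rV[R]_4) i : `|x 0 i| <= `|x|.
Proof.
have -> : `|x| = mx_norm x by [].
rewrite mx_normrE; exact: (le_bigmax_cond _ (fun ij : 'I_1 * 'I_4 => `|x ij.1 ij.2|) (j := (0, i))).
Qed.

(** Along the segment from [p] the derivative of the remainder is the remainder
    of order [n - 1] of the first derivatives, so the mean value theorem allows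
    an induction on [n] for all functions at once. *)
Lemma taylor p n f : Omega p -> smooth_on Omega f ->
  exists C r : R, [/\ 0 <= C, 0 < r & forall x, `|x| < r ->
    Omega (p + x) /\
    `|f (p + x) - \sum_(d < n) taylor_term p d f x| <= C * `|x| ^+ n].
Proof.
move=> Op; elim: n f => [|n IH] f sf.
  have [r r0 Hr] := ball_Omega Op.
  have /cvgrPdist_lt/(_ _ ltr01)/nbhs_normP[s /= s0 Hs] := smooth_continuous sf Op.
  exists (`|f p| + 1), (Num.min r s); split => //.
    by rewrite lt_min r0 s0.
  move=> x; rewrite lt_min => /andP[xr xs]; split; first exact: Hr.
  rewrite big_ord0 subr0 expr0 mulr1.
  have /ltW H : `|f p - f (p + x)| < 1.
    by apply: Hs; rewrite /= opprD addNKr normrN.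
  rewrite (_ : f (p + x) = f p - (f p - f (p + x))); last by rewrite subKr.
  by apply: le_trans (ler_normB _ _) _; rewrite lerD2l.
have /choice[C /choice[r Cr]] := fun i => IH _ (smooth_derive i sf).
pose r0 := \big[Order.min/1]_(i < 4) r i.
have r00 : 0 < r0.
  by rewrite lt_bigmin // => i _; have [] := Cr i.
have r0r i : r0 <= r i by exact: bigmin_le_cond.
exists (\sum_i C i), r0; split => //.
  by apply: sumr_ge0 => i _; have [] := Cr i.
move=> x xr.
have Oline (t : R) : 0 <= t <= 1 -> `|t *: x| < r0.
  move=> /andP[t0 t1]; apply: le_lt_trans xr.
  by rewrite normrZ ger0_norm // ler_piMl.
have Ol (t : R) : 0 <= t <= 1 -> Omega (p + t *: x).
  move=> t01; have [_ _ /(_ (t *: x))] := Cr 0.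
  by case=> //; apply: lt_le_trans (Oline _ t01) (r0r _).
split; first by rewrite -[x]scale1r; apply: Ol; rewrite ler01 lexx.
pose g (t : R) := f (p + t *: x) - \sum_(d < n.+1) t ^+ d * taylor_term p d f x.
pose dg (t : R) := \sum_(i < 4) x 0 i * (partial i f (p + t *: x) -
   \sum_(d < n) taylor_term p d (partial i f) (t *: x)).
have Hg (t : R) : 0 <= t <= 1 -> is_derive t 1 g (dg t).
  move=> t01; rewrite /g /dg.
  have -> : \sum_(i < 4) x 0 i * (partial i f (p + t *: x) -
     \sum_(d < n) taylor_term p d (partial i f) (t *: x)) =
     (\sum_(i < 4) x 0 i * partial i f (p + t *: x)) -
      \sum_(d < n.+1) (d%:R * t ^+ d.-1) * taylor_term p d f x.
    rewrite [X in _ = _ - X]big_ord_recl mul0r mul0r add0r.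
    under eq_bigr do rewrite mulrBr.
    rewrite sumrB; congr (_ - _).
    under eq_bigr do rewrite mulr_sumr.
    rewrite exchange_big /=; apply: eq_bigr => d _.
    rewrite (_ : bump 0 d = d.+1) /= ?add0n; last by [].
    under eq_bigr do rewrite taylor_term_scale mulrCA.
    rewrite -mulr_sumr mulrAC [_%:R * (_ / _)]mulrCA mulfV ?pnatr_eq0 // mulr1.
    by rewrite mulrC.
  apply: is_deriveB; first exact: is_derive_line (Ol _ t01).
  have -> : (fun t : R => \sum_(d < n.+1) t ^+ d * taylor_term p d f x) =
     \sum_(d < n.+1) (fun t : R => t ^+ d * taylor_term p d f x).
    by apply/funext => s; rewrite fct_sumE.
  apply: is_derive_sum => d.
  exact: is_derive_monomial.
have [||c /[!in_itv]/= /andP[c0 c1] Hc] := @MVT _ g dg 0 1 ltr01.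
- move=> t; rewrite in_itv /= => /andP[t0 t1]; apply: Hg; by rewrite !ltW.
- apply: derivable_within_continuous => t; rewrite in_itv /= => t01.
  by have [] := Hg _ t01.
have g0 : g 0 = 0.
  rewrite /g scale0r addr0 big_ord_recl /= expr0 mul1r big1 ?addr0 ?subrr //.
  by move=> d _; rewrite expr0n /= mul0r.
have g1 : g 1 = f (p + x) - \sum_(d < n.+1) taylor_term p d f x.
  rewrite /g scale1r; congr (_ - _); apply: eq_bigr => d _.
  by rewrite expr1n mul1r.
rewrite -g1 -[g 1]subr0 -[X in _ - X]g0 Hc subr0 mulr1 /dg.
apply: le_trans (ler_norm_sum _ _ _) _; rewrite mulr_suml.
apply: ler_sum => i _; have c01 : 0 <= c <= 1 by rewrite !ltW.
rewrite normrM exprS mulrCA; apply: ler_pM => //; first exact: coord_le_norm.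
have [Ci _ /(_ (c *: x))] := Cr i; case.
  by apply: lt_le_trans (Oline _ c01) (r0r _).
move=> _ /le_trans; apply; rewrite ler_wpM2l // lerXn2r ?nnegrE //.
by rewrite normrZ ger0_norm ?(ltW c0) // ler_piMl // ltW.
Qed.

Lemma taylor_term1 p f x :
  taylor_term p 1 f x = \sum_(i < 4) x 0 i * partial i f p.
Proof. by rewrite /= divr1. Qed.

Lemma taylor_term1D p f x y :
  taylor_term p 1 f (x + y) = taylor_term p 1 f x + taylor_term p 1 f y.
Proof.
rewrite !taylor_term1 -big_split /=; apply: eq_bigr => i _.
by rewrite mxE mulrDl.
Qed.

Lemma taylor_term1_delta p f i : taylor_term p 1 f (delta_mx 0 i) = partial i f p.
Proof.
rewrite taylor_term1 (bigD1 i) //= mxE !eqxx mul1r big1 ?addr0 // => k ki.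
by rewrite mxE (negbTE ki) andbF mul0r.
Qed.

(** The mean value theorem applied to the difference of [f] along two parallel
    segments brings in one partial derivative; the first order expansion of
    that derivative brings in the other. *)
Lemma second_difference p f i j : Omega p -> smooth_on Omega f ->
  let u : 'rV[R]_4 := delta_mx 0 i in let v : 'rV[R]_4 := delta_mx 0 j in
  exists C r : R, 0 < r /\ forall t, 0 < t < r ->
   `|f (p + (t *: u + t *: v)) - f (p + t *: u) - f (p + t *: v) + f p
      - t ^+ 2 * partial j (partial i f) p| <= C * t ^+ 3.
Proof.
move=> Op sf u v.
have [D [s [D0 s0 HS]]] := taylor 2 Op (smooth_derive i sf).
pose nu := `|u| + `|v|.
have nu0 : 0 <= nu by rewrite addr_ge0.
have nu1 : 0 < nu + 1 by rewrite ltr_wpDl.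
exists (D * nu ^+ 2 *+ 2), (s / (nu + 1)); split; first by rewrite divr_gt0.
move=> t /andP[t0]; rewrite ltr_pdivlMr // => ts.
have small (a b : R) : 0 <= a <= t -> 0 <= b <= t -> `|a *: u + b *: v| <= t * nu.
  move=> /andP[a0 a1] /andP[b0 b1]; rewrite mulrDr.
  apply: le_trans (ler_normD _ _) _; rewrite !normrZ !ger0_norm //.
  by rewrite lerD // ler_wpM2r.
have small' (a b : R) : 0 <= a <= t -> 0 <= b <= t -> `|a *: u + b *: v| < s.
  move=> a1 b1; apply: le_lt_trans (small _ _ a1 b1) _.
  by apply: le_lt_trans ts; rewrite ler_wpM2l ?lerDl // ltW.
pose h (c : R) := f (p + t *: v + c *: u) - f (p + c *: u).
pose dh (c : R) := partial i f (p + (c *: u + t *: v)) - partial i f (p + c *: u).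
have tt : 0 <= t <= t by rewrite (ltW t0) lexx.
have t00 : 0 <= (0 : R) <= t by rewrite (ltW t0) lexx.
have Oh1 (c : R) : 0 <= c <= t -> Omega (p + (c *: u + t *: v)).
  by move=> c1; have [] := HS _ (small' _ _ c1 tt).
have Oh2 (c : R) : 0 <= c <= t -> Omega (p + c *: u).
  move=> c1; have [] := HS _ (small' _ _ c1 t00).
  by rewrite scale0r addr0.
have part1 (q : 'rV[R]_4) : \sum_(k < 4) u 0 k * partial k f q = partial i f q.
  rewrite (bigD1 i) //= mxE !eqxx mul1r big1 ?addr0 // => k ki.
  by rewrite mxE (negbTE ki) andbF mul0r.
have Hh (c : R) : 0 <= c <= t -> is_derive c 1 h (dh c).
  move=> c1; rewrite /h /dh; apply: is_deriveB.
    rewrite -part1 [c *: u + _]addrC addrA.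
    apply: is_derive_line => //.
    by rewrite -addrA [t *: v + _]addrC; apply: Oh1.
  by rewrite -part1; apply: is_derive_line => //; apply: Oh2.
have [||c /[!in_itv]/= /andP[c0 c1] Hc] := @MVT _ h dh 0 t t0.
- by move=> c; rewrite in_itv /= => /andP[c0 c1]; apply: Hh; rewrite !ltW.
- apply: derivable_within_continuous => c; rewrite in_itv /= => c01.
  by have [] := Hh _ c01.
have -> : f (p + (t *: u + t *: v)) - f (p + t *: u) - f (p + t *: v) + f p = t * dh c.
  have -> : t * dh c = h t - h 0 by rewrite Hc subr0 mulrC.
  rewrite /h !scale0r !addr0.
  by rewrite [t *: u + _]addrC addrA; ring.
have c01 : 0 <= c <= t by rewrite !ltW.
have [_ A1] := HS _ (small' _ _ c01 tt).
have [_ A2] := HS _ (small' _ _ c01 t00).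
have {}A1 := le_trans A1 (ler_wpM2l D0 (lerXn2r 2 (normr_ge0 _) (mulr_ge0 (ltW t0) nu0) (small _ _ c01 tt))).
have {}A2 := le_trans A2 (ler_wpM2l D0 (lerXn2r 2 (normr_ge0 _) (mulr_ge0 (ltW t0) nu0) (small _ _ c01 t00))).
move: A1 A2; rewrite scale0r addr0 !big_ord_recl !big_ord0 !addr0.
rewrite -[taylor_term p (lift _ _) _ _]/(taylor_term p 1 _ _).
rewrite -[taylor_term p (lift _ _) _ (c *: u)]/(taylor_term p 1 _ _).
rewrite taylor_term1D [taylor_term p 1 _ (t *: v)]taylor_term_scale expr1.
rewrite taylor_term1_delta /dh.
set F1 := partial i f (p + (c *: u + t *: v)); set F2 := partial i f (p + c *: u).
set F0 := taylor_term p ord0 _ _; set L := taylor_term p 1 _ _.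
set M := partial j _ p; set K := D * (t * nu) ^+ 2 => A1 A2.
rewrite -[taylor_term p ord0 _ _]/F0 in A2.
have -> : t * (F1 - F2) - t ^+ 2 * M =
  t * ((F1 - (F0 + (L + t * M))) - (F2 - (F0 + L))) by ring.
rewrite normrM (ger0_norm (ltW t0)).
have -> : D * nu ^+ 2 *+ 2 * t ^+ 3 = t * (K + K) by rewrite /K; ring.
rewrite ler_pM2l //; apply: le_trans (ler_normB _ _) _.
exact: lerD.
Qed.

(** The second difference is symmetric in the two directions. *)
Lemma mixed_partials p f i j : Omega p -> smooth_on Omega f ->
  partial j (partial i f) p = partial i (partial j f) p.
Proof.
move=> Op sf.
have [C [r [r0 HC]]] := second_difference i j Op sf.
have [D [s [s0 HD]]] := second_difference j i Op sf.
set a := partial j (partial i f) p in HC *; set b := partial i (partial j f) p in HD *.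
apply/eqP; rewrite -subr_eq0 -normr_eq0; apply/eqP.
apply/le_anti; rewrite normr_ge0 andbT; apply/ler_addgt0Pl => e e0; rewrite addr0.
pose K := `|C| + `|D| + 1.
have K0 : 0 < K by rewrite ltr_wpDl ?addr_ge0.
pose t := Num.min (Num.min r s) (e / K) / 2.
have m0 : 0 < Num.min (Num.min r s) (e / K) by rewrite !lt_min r0 s0 divr_gt0.
have t0 : 0 < t by rewrite divr_gt0.
have tm : t < Num.min (Num.min r s) (e / K).
  by rewrite /t ltr_pdivrMr // mulr_natr mulr2n ltrDl.
move: tm; rewrite !lt_min => /andP[/andP[tr ts] te].
have := HC t; have := HD t; rewrite t0 tr ts => /(_ isT) + /(_ isT).
rewrite [t *: delta_mx 0 j + _]addrC.
set X := f (p + (_ + _)); set Y := f (p + _); set Z := f (p + _) => HA HB.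
have : `|t ^+ 2 * (a - b)| <= (C + D) * t ^+ 3.
  rewrite mulrDl; apply: le_trans (lerD HB HA).
  rewrite -[X in _ <= X + _]normrN; apply: le_trans (ler_normD _ _).
  by rewrite le_eqVlt; apply/orP; left; apply/eqP; congr (`|_|); ring.
rewrite normrM ger0_norm ?sqr_ge0 // [t ^+ 3]exprS mulrA mulrC ler_pM2r ?exprn_gt0 //.
move=> /le_trans; apply; apply: (@le_trans _ _ (K * t)).
  have CK : C + D <= K by rewrite /K -[C + D]addr0 !lerD ?ler_norm ?ler01.
  by apply: ler_wpM2r => //; apply: ltW.
by rewrite mulrC -ler_pdivlMr // ltW.
Qed.

End Taylor.

(** * Derivatives of flat functions *)

Section Flat.
Variables (R : realType) (Omega : set 'rV[R]_4).
Hypothesis openO : open Omega.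
Implicit Types f g : 'rV[R]_4 -> R.

Notation partial i f := ('D_(delta_mx 0 i) f).

Lemma near_normP (p : 'rV[R]_4) (P : 'rV[R]_4 -> Prop) :
  (\forall q \near p, P q) <-> exists2 r : R, 0 < r & forall x, `|x| < r -> P (p + x).
Proof.
split=> [/nbhs_normP[r /= r0 H]|[r r0 H]].
  by exists r => // x xr; apply: H; rewrite /= opprD addNKr normrN.
apply/nbhs_normP; exists r => //= q /= qr.
by rewrite -(subrKC p q); apply: H; rewrite distrC.
Qed.

Lemma mvt_partial f (a : 'rV[R]_4) i (s : R) : 0 < s -> smooth_on Omega f ->
  (forall c, 0 <= c <= s -> Omega (a + c *: delta_mx 0 i)) ->
  exists2 c, 0 < c < s & f (a + s *: delta_mx 0 i) - f a =
    s * partial i f (a + c *: delta_mx 0 i).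
Proof.
move=> s0 sf HO; pose u : 'rV[R]_4 := delta_mx 0 i.
have Hh (c : R) : 0 <= c <= s ->
    is_derive c 1 (fun t : R => f (a + t *: u)) (partial i f (a + c *: u)).
  move=> c1; have := is_derive_line sf (HO _ c1).
  rewrite (bigD1 i) //= mxE !eqxx mul1r big1 ?addr0 // => k ki.
  by rewrite mxE (negbTE ki) andbF mul0r.
have [||c /[!in_itv]/= c01 Hc] :=
    @MVT _ (fun t : R => f (a + t *: u)) (fun t : R => partial i f (a + t *: u)) 0 s s0.
- by move=> c; rewrite in_itv /= => /andP[c0 c1]; apply: Hh; rewrite !ltW.
- apply: derivable_within_continuous => c; rewrite in_itv /= => c01.
  by have [] := Hh _ c01.
by exists c => //; move: Hc; rewrite scale0r addr0 subr0 mulrC.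
Qed.

(** Landau's interpolation between a function and its second derivative: a step
    of length [|x|^n] balances the two terms.  Half of the order of vanishing is
    lost, which is harmless when the order is arbitrary. *)
Lemma flat_partial p e n i : Omega p -> smooth_on Omega e ->
  (exists C : R, \forall q \near p, `|e q| <= C * `|q - p| ^+ n.*2) ->
  exists C : R, \forall q \near p, `|partial i e q| <= C * `|q - p| ^+ n.
Proof.
move=> Op se [C0 HC0].
have [C [C00 {}HC0]] : exists C : R, 0 <= C /\ \forall q \near p, `|e q| <= C * `|q - p| ^+ n.*2.
  exists `|C0|; split => //; near=> q.
  have H : `|e q| <= C0 * `|q - p| ^+ n.*2 by near: q.
  by apply: le_trans H _; rewrite ler_wpM2r ?exprn_ge0 ?ler_norm.
have [r0 r00 HC] := (near_normP p _).1 HC0.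
have [B [r1 [B0 r10 HB]]] := taylor openO 0 Op (smooth_derive i (smooth_derive i se)).
case: n {C0} HC0 HC => [|n] _ HC.
  have [B' [r2 [B'0 r20 HB']]] := taylor openO 0 Op (smooth_derive i se).
  exists B'; apply/near_normP; exists r2 => // x xr.
  by have [_] := HB' _ xr; rewrite big_ord0 subr0 [p + x - p]addrC addKr.
pose u : 'rV[R]_4 := delta_mx 0 i.
pose nu := 1 + `|u|.
have nu1 : 1 <= nu by rewrite lerDl.
have nu0 : 0 < nu by apply: lt_le_trans nu1.
pose r := Num.min (Num.min r0 r1) 1 / nu.
have r_gt0 : 0 < r by rewrite divr_gt0 // !lt_min r00 r10 ltr01.
have rle : r <= 1.
  by rewrite /r ler_pdivrMr // mul1r; apply: le_trans nu1; rewrite ge_min lexx orbT.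
have step x (s : R) : 0 < s -> `|x| + s * `|u| < Num.min (Num.min r0 r1) 1 ->
    s * `|partial i e (p + x)| <=
      C * (`|x| + s * `|u|) ^+ n.+1.*2 + C * `|x| ^+ n.+1.*2 + s * (s * B).
  move=> s0; rewrite !lt_min => /andP[/andP[xs0 xs1] xs2].
  have xc (c : R) : 0 <= c <= s -> `|x + c *: u| <= `|x| + s * `|u|.
    move=> /andP[c0 c1]; apply: le_trans (ler_normD _ _) _.
    by rewrite lerD2l normrZ ger0_norm // ler_wpM2r.
  have Oc (c : R) : 0 <= c <= s -> Omega (p + x + c *: u).
    move=> c1; rewrite -addrA; have [] := HB (x + c *: u) => //.
    by apply: le_lt_trans (xc _ c1) _.
  have ss : 0 <= s <= s by rewrite lexx ltW.
  have s00 : 0 <= (0 : R) <= s by rewrite lexx ltW.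
  have [c /andP[c0 c1] Ec] := mvt_partial s0 se Oc.
  have [||c' /andP[c'0 c'1] Ec'] := mvt_partial (f := partial i e) (a := p + x) (i := i) (s := c) c0.
  - exact: smooth_derive.
  - by move=> t /andP[t0 t1]; apply: Oc; rewrite t0 (le_trans t1) // ltW.
  have -> : s * `|partial i e (p + x)| = `|s * partial i e (p + x)|.
    by rewrite normrM (ger0_norm (ltW s0)).
  have -> : s * partial i e (p + x) = e (p + x + s *: u) - e (p + x) -
      s * (partial i e (p + x + c *: u) - partial i e (p + x)).
    by rewrite Ec; ring.
  apply: le_trans (ler_normB _ _) _; apply: lerD.
    apply: le_trans (ler_normB _ _) _; apply: lerD.
      rewrite -addrA; have := HC _ (le_lt_trans (xc _ ss) xs0).
      rewrite [p + _]addrC addrK => /le_trans; apply; rewrite ler_wpM2l //.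
      by rewrite lerXn2r ?nnegrE ?addr_ge0 ?mulr_ge0 ?(ltW s0) //; apply: xc.
    have xr0 : `|x| < r0 by apply: le_lt_trans xs0; rewrite lerDl mulr_ge0 // ltW.
    by have := HC _ xr0; rewrite [p + _]addrC addrK.
  rewrite normrM (ger0_norm (ltW s0)) Ec' normrM (ger0_norm (ltW c0)).
  rewrite ler_pM2l //; apply: ler_pM => //; rewrite ?(ltW c0) ?(ltW c1) //.
  have c's : 0 <= c' <= s by rewrite (ltW c'0) ltW // (lt_trans c'1).
  rewrite -addrA; have [_] := HB _ (le_lt_trans (xc _ c's) xs1).
  by rewrite big_ord0 subr0 expr0 mulr1.
exists (C * nu ^+ n.+1.*2 + C + B); apply/near_normP.
exists r => // x xr; rewrite [p + x - p]addrC addKr.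
have xn0 : 0 <= `|x| by [].
have x1 : `|x| <= 1 by apply: le_trans (ltW xr) rle.
have rm : r * nu = Num.min (Num.min r0 r1) 1 by rewrite /r divfK // gt_eqF.
have [x0|xN0] := eqVneq `|x| 0.
  rewrite x0 expr0n /= mulr0; apply/ler_addgt0Pl => d d0; rewrite addr0.
  pose K := C * `|u| ^+ n.+1.*2 + B + 1.
  have K0 : 0 < K by rewrite ltr_wpDl // addr_ge0 // mulr_ge0 // exprn_ge0.
  pose s := Num.min r (d / K) / 2.
  have m0 : 0 < Num.min r (d / K) by rewrite lt_min r_gt0 divr_gt0.
  have s0 : 0 < s by rewrite divr_gt0.
  have : s < Num.min r (d / K) by rewrite /s ltr_pdivrMr // mulr_natr mulr2n ltrDl.
  rewrite lt_min => /andP[sr sd].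
  have sm : `|x| + s * `|u| < Num.min (Num.min r0 r1) 1.
    rewrite x0 add0r -rm; apply: (@le_lt_trans _ _ (s * nu)); last by rewrite ltr_pM2r.
    by rewrite ler_pM2l // lerDr.
  have := step x s s0 sm; rewrite x0 add0r expr0n /= mulr0 addr0 => H.
   rewrite -(ler_pM2l s0); apply: le_trans H _.
  apply: (@le_trans _ _ (s * (s * K))); last first.
    by rewrite ler_pM2l // -ler_pdivlMr // ltW.
  have -> : C * (s * `|u|) ^+ n.+1.*2 = s * (s * (C * `|u| ^+ n.+1.*2)) * s ^+ n.*2.
    by rewrite doubleS exprMn !exprS; ring.
  have s1 : s ^+ n.*2 <= 1.
    by rewrite exprn_ile1 // ?ltW // (lt_le_trans sr).
  apply: (@le_trans _ _ (s * (s * (C * `|u| ^+ n.+1.*2)) + s * (s * B))).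
    rewrite lerD2r ler_piMr //. have s00 := ltW s0.
    by apply: mulr_ge0 => //; apply: mulr_ge0 => //; apply: mulr_ge0 => //; apply: exprn_ge0.
  rewrite -!mulrDr ler_pM2l // ler_pM2l // /K lerDl; exact: ler01.
have xp : 0 < `|x| by rewrite lt_def xN0 xn0.
pose s := `|x| ^+ n.+1.
have s0 : 0 < s by rewrite exprn_gt0.
have sx : s <= `|x| by rewrite /s exprS ler_piMr // exprn_ile1.
have xs : `|x| + s * `|u| <= `|x| * nu.
  by rewrite mulrDr mulr1 lerD2l ler_wpM2r.
have sm : `|x| + s * `|u| < Num.min (Num.min r0 r1) 1.
  by rewrite -rm; apply: le_lt_trans xs _; rewrite ltr_pM2r.
have H := step x s s0 sm.
rewrite -/s -(ler_pM2l s0); apply: le_trans H _.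
have ss : s * s = `|x| ^+ n.+1.*2 by rewrite /s -exprD addnn.
have -> : s * ((C * nu ^+ n.+1.*2 + C + B) * s) =
   C * (`|x| * nu) ^+ n.+1.*2 + C * `|x| ^+ n.+1.*2 + s * (s * B).
  by rewrite exprMn -ss; ring.
rewrite lerD2r lerD2r ler_wpM2l // lerXn2r ?nnegrE //.
- by rewrite addr_ge0 // mulr_ge0 // ltW.
- by rewrite mulr_ge0 // ltW.
Unshelve. all: by end_near. Qed.

End Flat.

(** * The ring of smooth complex functions *)

Section ComplexSmooth.
Variables (R : realType) (Omega : set 'rV[R]_4).
Hypothesis openO : open Omega.
Implicit Types f g : 'rV[R]_4 -> R[i].

Definition csmooth f :=
  smooth_on Omega (fun q => complex.Re (f q)) /\
  smooth_on Omega (fun q => complex.Im (f q)).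

Lemma csmooth_eq f g : (forall q, Omega q -> f q = g q) -> csmooth f -> csmooth g.
Proof.
move=> E [H1 H2]; split.
  by apply: (smooth_on_eq openO _ H1) => q Oq; rewrite E.
by apply: (smooth_on_eq openO _ H2) => q Oq; rewrite E.
Qed.

Lemma csmooth_cst c : csmooth (fun=> c).
Proof. by split; apply: smooth_on_cst. Qed.

Lemma ReD (x y : R[i]) : complex.Re (x + y) = complex.Re x + complex.Re y.
Proof. by case: x y => [a b] [c d]. Qed.
Lemma ImD (x y : R[i]) : complex.Im (x + y) = complex.Im x + complex.Im y.
Proof. by case: x y => [a b] [c d]. Qed.
Lemma ReM (x y : R[i]) : complex.Re (x * y) =
  complex.Re x * complex.Re y - complex.Im x * complex.Im y.
Proof. by case: x y => [a b] [c d]. Qed.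
Lemma ImM (x y : R[i]) : complex.Im (x * y) =
  complex.Re x * complex.Im y + complex.Im x * complex.Re y.
Proof. by case: x y => [a b] [c d]. Qed.
Lemma ReJ (x : R[i]) : complex.Re (x^*)%C = complex.Re x.
Proof. by case: x. Qed.
Lemma ImJ (x : R[i]) : complex.Im (x^*)%C = - complex.Im x.
Proof. by case: x. Qed.
Lemma eqC (x y : R[i]) : complex.Re x = complex.Re y ->
  complex.Im x = complex.Im y -> x = y.
Proof. by case: x y => [a b] [c d] /= -> ->. Qed.

Lemma csmoothD f g : csmooth f -> csmooth g -> csmooth (fun q => f q + g q).
Proof.
move=> [f1 f2] [g1 g2]; split.
  by apply: (smooth_on_eq openO _ (smooth_onD openO f1 g1)) => q _; rewrite ReD.
by apply: (smooth_on_eq openO _ (smooth_onD openO f2 g2)) => q _; rewrite ImD.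
Qed.

Lemma csmoothM f g : csmooth f -> csmooth g -> csmooth (fun q => f q * g q).
Proof.
move=> [f1 f2] [g1 g2]; split.
  have H := smooth_onB openO (smooth_onM openO f1 g1) (smooth_onM openO f2 g2).
  by apply: (smooth_on_eq openO _ H) => q _; rewrite ReM.
have H := smooth_onD openO (smooth_onM openO f1 g2) (smooth_onM openO f2 g1).
by apply: (smooth_on_eq openO _ H) => q _; rewrite ImM.
Qed.

Lemma csmoothN f : csmooth f -> csmooth (fun q => - f q).
Proof.
move=> H; apply: csmooth_eq (csmoothM (csmooth_cst (-1)) H) => q _.
by rewrite mulN1r.
Qed.

Lemma csmooth_conj f : csmooth f -> csmooth (fun q => (f q)^*%C).
Proof.
move=> [f1 f2]; split.
  by apply: (smooth_on_eq openO _ f1) => q _; rewrite ReJ.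
by apply: (smooth_on_eq openO _ (smooth_onN openO f2)) => q _; rewrite ImJ.
Qed.

Lemma csmooth_real (f : 'rV[R]_4 -> R) : smooth_on Omega f -> csmooth (cplx_fun f).
Proof. by move=> H; split => //; apply: smooth_on_cst. Qed.

Lemma csmooth_pderiv i f : csmooth f -> csmooth (pderiv i f).
Proof. by move=> [f1 f2]; split; apply: smooth_derive. Qed.

Lemma pderiv_eq i f g q : Omega q -> (forall x, Omega x -> f x = g x) ->
  pderiv i f q = pderiv i g q.
Proof.
move=> Oq E; rewrite /pderiv; congr (_ +i* _)%C; apply: near_eq_derive;
  by near=> x; rewrite E //; near: x; apply: near_Omega.
Unshelve. all: by end_near. Qed.

Lemma pderivD i f g q : csmooth f -> csmooth g -> Omega q ->
  pderiv i (fun x => f x + g x) q = pderiv i f q + pderiv i g q.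
Proof.
move=> [f1 f2] [g1 g2] Oq; rewrite /pderiv.
have D h : smooth_on Omega h -> derivable h q (delta_mx 0 i).
  by move=> H; apply: smooth_derivable Oq.
apply: eqC; rewrite ?ReD ?ImD /=.
  rewrite -deriveD; [|exact: D|exact: D].
  by congr ('D_ _ _ _); apply/funext => x; rewrite ReD.
rewrite -deriveD; [|exact: D|exact: D].
by congr ('D_ _ _ _); apply/funext => x; rewrite ImD.
Qed.

Lemma pderivM i f g q : csmooth f -> csmooth g -> Omega q ->
  pderiv i (fun x => f x * g x) q = pderiv i f q * g q + f q * pderiv i g q.
Proof.
move=> [f1 f2] [g1 g2] Oq; rewrite /pderiv.
have D h : smooth_on Omega h -> derivable h q (delta_mx 0 i).
  by move=> H; apply: smooth_derivable Oq.
have DM h k : smooth_on Omega h -> smooth_on Omega k ->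
    'D_(delta_mx 0 i) (fun x => h x * k x) q =
    h q * 'D_(delta_mx 0 i) k q + k q * 'D_(delta_mx 0 i) h q.
  by move=> Hh Hk; rewrite deriveM; [|exact: D|exact: D].
have sM := smooth_onM openO.
apply: eqC; rewrite ?ReD ?ImD ?ReM ?ImM /=.
  have -> : (fun x => complex.Re (f x * g x)) =
     (fun x => complex.Re (f x) * complex.Re (g x)) -
     (fun x => complex.Im (f x) * complex.Im (g x)).
    by apply/funext => x; rewrite ReM.
  rewrite deriveB; [|by apply/D/sM|by apply/D/sM].
  by rewrite !DM //; ring.
have -> : (fun x => complex.Im (f x * g x)) =
     (fun x => complex.Re (f x) * complex.Im (g x)) +
     (fun x => complex.Im (f x) * complex.Re (g x)).
  by apply/funext => x; rewrite ImM.
rewrite deriveD; [|by apply/D/sM|by apply/D/sM].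
by rewrite !DM //; ring.
Qed.

Lemma pderiv_cst i (c : R[i]) (q : 'rV[R]_4) : pderiv i (fun=> c) q = 0.
Proof. by rewrite /pderiv !derive_cst. Qed.

(** The ring of smooth complex functions on [Omega].  Its elements are made
    canonical by asking them to vanish outside [Omega], where nothing is known
    about the functions at hand.  The last field makes the type depend on the
    openness of [Omega], on which its ring structure depends. *)
Record smooth_fun := SmoothFun {
  smval :> 'rV[R]_4 -> R[i];
  smvalP : csmooth smval;
  smval0 : forall q, ~ Omega q -> smval q = 0;
  _ : openO = openO }.

Implicit Types a b c : smooth_fun.

Lemma smP a b : (forall q, Omega q -> a q = b q) -> a = b.
Proof.
move=> E; have {}E : smval a = smval b.
  apply/funext => q; have [Oq|Nq] := pselect (Omega q); first exact: E.
  by rewrite !smval0.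
case: a b E => [a a1 a2 a3] [b b1 b2 b3] /= E; rewrite E in a1 a2 *.
by congr SmoothFun; apply: Prop_irrelevance.
Qed.

Definition restrict f : 'rV[R]_4 -> R[i] := fun q => if pselect (Omega q) then f q else 0.

Lemma restrictE f q : Omega q -> restrict f q = f q.
Proof. by rewrite /restrict; case: pselect. Qed.

Lemma restrict_smooth f : csmooth f -> csmooth (restrict f).
Proof. by apply: csmooth_eq => q Oq; rewrite restrictE. Qed.

Lemma restrict0 f q : ~ Omega q -> restrict f q = 0.
Proof. by rewrite /restrict; case: pselect. Qed.

Definition mksm f (sf : csmooth f) : smooth_fun :=
  SmoothFun (restrict_smooth sf) (@restrict0 f) erefl.

Lemma mksmE f (sf : csmooth f) q : Omega q -> mksm sf q = f q.
Proof. exact: restrictE. Qed.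

Definition sm_cst (c : R[i]) : smooth_fun := mksm (csmooth_cst c).
Definition sm_add a b := mksm (csmoothD (smvalP a) (smvalP b)).
Definition sm_mul a b := mksm (csmoothM (smvalP a) (smvalP b)).
Definition sm_opp a := mksm (csmoothN (smvalP a)).

HB.instance Definition _ := gen_eqMixin smooth_fun.
HB.instance Definition _ := gen_choiceMixin smooth_fun.

Lemma sm_addA : associative sm_add.
Proof. by move=> a b c; apply: smP => q Oq; rewrite !mksmE // addrA. Qed.
Lemma sm_addC : commutative sm_add.
Proof. by move=> a b; apply: smP => q Oq; rewrite !mksmE // addrC. Qed.
Lemma sm_add0 : left_id (sm_cst 0) sm_add.
Proof. by move=> a; apply: smP => q Oq; rewrite !mksmE // add0r. Qed.
Lemma sm_addN : left_inverse (sm_cst 0) sm_opp sm_add.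
Proof. by move=> a; apply: smP => q Oq; rewrite !mksmE // addNr. Qed.
HB.instance Definition _ := GRing.isZmodule.Build smooth_fun sm_addA sm_addC sm_add0 sm_addN.

Lemma sm_mulA : associative sm_mul.
Proof. by move=> a b c; apply: smP => q Oq; rewrite !mksmE // mulrA. Qed.
Lemma sm_mulC : commutative sm_mul.
Proof. by move=> a b; apply: smP => q Oq; rewrite !mksmE // mulrC. Qed.
Lemma sm_mul1 : left_id (sm_cst 1) sm_mul.
Proof. by move=> a; apply: smP => q Oq; rewrite !mksmE // mul1r. Qed.
Lemma sm_mulD : left_distributive sm_mul sm_add.
Proof. by move=> a b c; apply: smP => q Oq; rewrite !mksmE // mulrDl. Qed.
HB.instance Definition _ := GRing.Zmodule_isComPzRing.Build smooth_fun
  sm_mulA sm_mulC sm_mul1 sm_mulD.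

Lemma sm_cstE (c : R[i]) q : Omega q -> sm_cst c q = c.
Proof. exact: mksmE. Qed.
Lemma smD a b q : Omega q -> (a + b) q = a q + b q.
Proof. exact: mksmE. Qed.
Lemma smM a b q : Omega q -> (a * b) q = a q * b q.
Proof. exact: mksmE. Qed.
Lemma smN a q : Omega q -> (- a) q = - a q.
Proof. exact: mksmE. Qed.
Lemma sm1 q : Omega q -> (1 : smooth_fun) q = 1.
Proof. exact: mksmE. Qed.
Lemma sm0 q : (0 : smooth_fun) q = 0.
Proof. by rewrite /= /restrict; case: pselect. Qed.

Lemma smX a n q : Omega q -> (a ^+ n) q = a q ^+ n.
Proof.
by move=> Oq; elim: n => [|n IH]; rewrite ?expr0 ?sm1 // !exprS smM // IH.
Qed.

Lemma sm_sum I (r : seq I) (P : pred I) (F : I -> smooth_fun) q : Omega q ->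
  (\sum_(i <- r | P i) F i) q = \sum_(i <- r | P i) F i q.
Proof.
move=> Oq; elim: r => [|i r IH]; first by rewrite !big_nil sm0.
by rewrite !big_cons; case: ifP => _; rewrite ?smD // IH.
Qed.

Lemma sm_natmul a n q : Omega q -> (a *+ n) q = a q *+ n.
Proof.
by move=> Oq; elim: n => [|n IH]; rewrite ?mulr0n ?sm0 // !mulrS smD // IH.
Qed.

Lemma sm_cstD x y : sm_cst (x + y) = sm_cst x + sm_cst y.
Proof. by apply: smP => q Oq; rewrite smD // !mksmE. Qed.
Lemma sm_cstM x y : sm_cst (x * y) = sm_cst x * sm_cst y.
Proof. by apply: smP => q Oq; rewrite smM // !mksmE. Qed.
Lemma sm_cstN x : sm_cst (- x) = - sm_cst x.
Proof. by apply: smP => q Oq; rewrite smN // !mksmE. Qed.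

Definition sm_pd i a := mksm (csmooth_pderiv i (smvalP a)).

(** [(d_i + s d_j)/2] with [s = -i] or [s = i] covers the four Wirtinger
    derivatives. *)
Definition sm_wirt (i j : 'I_4) (s : R[i]) a : smooth_fun :=
  (sm_pd i a + sm_cst s * sm_pd j a) * sm_cst (2^-1).

Definition dz := sm_wirt 0 1 (- 'i%C).
Definition dzb := sm_wirt 0 1 'i%C.
Definition dw := sm_wirt 2 3 (- 'i%C).
Definition dwb := sm_wirt 2 3 'i%C.

Lemma sm_pdD i a b : sm_pd i (a + b) = sm_pd i a + sm_pd i b.
Proof.
apply: smP => q Oq; rewrite smD // !mksmE // -pderivD //; try exact: smvalP.
by apply: pderiv_eq => // x Ox; rewrite smD.
Qed.

Lemma sm_pdM i a b : sm_pd i (a * b) = sm_pd i a * b + a * sm_pd i b.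
Proof.
apply: smP => q Oq; rewrite smD // !smM // !mksmE // -pderivM //; try exact: smvalP.
by apply: pderiv_eq => // x Ox; rewrite smM.
Qed.

Lemma sm_pd_cst i x : sm_pd i (sm_cst x) = 0.
Proof.
apply: smP => q Oq; rewrite sm0 mksmE // -(pderiv_cst i x q).
by apply: pderiv_eq => // y Oy; rewrite mksmE.
Qed.

Lemma sm_wirtD i j s a b : sm_wirt i j s (a + b) = sm_wirt i j s a + sm_wirt i j s b.
Proof. by rewrite /sm_wirt !sm_pdD; ring. Qed.

Lemma sm_wirtM i j s a b : sm_wirt i j s (a * b) = sm_wirt i j s a * b + a * sm_wirt i j s b.
Proof. by rewrite /sm_wirt !sm_pdM; ring. Qed.

Lemma sm_wirt_cst i j s x : sm_wirt i j s (sm_cst x) = 0.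
Proof. by rewrite /sm_wirt !sm_pd_cst; ring. Qed.

Lemma dzE a q : Omega q -> dz a q = d_z a q.
Proof. by move=> Oq; rewrite /d_z smM // smD // smM // !mksmE // mulNr. Qed.
Lemma dzbE a q : Omega q -> dzb a q = d_zbar a q.
Proof. by move=> Oq; rewrite /d_zbar smM // smD // smM // !mksmE. Qed.
Lemma dwE a q : Omega q -> dw a q = d_w a q.
Proof. by move=> Oq; rewrite /d_w smM // smD // smM // !mksmE // mulNr. Qed.
Lemma dwbE a q : Omega q -> dwb a q = d_wbar a q.
Proof. by move=> Oq; rewrite /d_wbar smM // smD // smM // !mksmE. Qed.

Lemma csmooth_coord p j : csmooth (fun q => ((q - p) 0 j)%:C%C).
Proof. by split; [apply: smooth_on_coord|apply: smooth_on_cst]. Qed.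

Definition sm_coord p j := mksm (csmooth_coord p j).

Lemma sm_pd_coord p i j : sm_pd i (sm_coord p j) = (i == j)%:R.
Proof.
apply: smP => q Oq; rewrite sm_natmul // sm1 // mksmE //.
rewrite (@pderiv_eq i _ (fun q => ((q - p) 0 j)%:C%C)) //; last first.
  by move=> x Ox; rewrite mksmE.
rewrite /pderiv /= derive_coord derive_cst; case: eqP => //.
Qed.

Definition zeta p := sm_coord p 0 + sm_cst 'i%C * sm_coord p 1.
Definition zetab p := sm_coord p 0 - sm_cst 'i%C * sm_coord p 1.
Definition omega p := sm_coord p 2 + sm_cst 'i%C * sm_coord p 3.
Definition omegab p := sm_coord p 2 - sm_cst 'i%C * sm_coord p 3.

Lemma zetaE p q : Omega q -> zeta p q = zcoord (q - p).
Proof.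
move=> Oq; rewrite smD // smM // !mksmE // /zcoord; apply: eqC; rewrite /= ?mul0r ?mul1r;
  by rewrite ?subr0 ?addr0 ?add0r ?mulr0 ?subr0 ?addr0.
Qed.

End ComplexSmooth.

(** * Change of defining function *)

Section Derivations.
Variable S : comPzRingType.
Implicit Types a b x y : S.

Definition derivation (D : S -> S) :=
  (forall a b, D (a + b) = D a + D b) /\ (forall a b, D (a * b) = D a * b + a * D b).

Variable D : S -> S.
Hypothesis derD : derivation D.

Lemma derivD a b : D (a + b) = D a + D b. Proof. exact: derD.1. Qed.
Lemma derivM a b : D (a * b) = D a * b + a * D b. Proof. exact: derD.2. Qed.
Lemma deriv0 : D 0 = 0.
Proof. by apply: (@addrI _ (D 0)); rewrite -derivD !addr0. Qed.
Lemma deriv1 : D 1 = 0.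
Proof. by apply: (@addrI _ (D 1)); rewrite addr0 -{3}(mulr1 1) derivM mulr1 mul1r. Qed.
Lemma derivN a : D (- a) = - D a.
Proof. by apply: (@addrI _ (D a)); rewrite -derivD !subrr deriv0. Qed.
Lemma derivB a b : D (a - b) = D a - D b.
Proof. by rewrite derivD derivN. Qed.
Lemma deriv_sum I (r : seq I) (P : pred I) (F : I -> S) :
  D (\sum_(i <- r | P i) F i) = \sum_(i <- r | P i) D (F i).
Proof. by apply: (big_morph D derivD deriv0). Qed.
Lemma derivMn a n : D (a *+ n) = D a *+ n.
Proof. by elim: n => [|n IH]; rewrite ?mulr0n ?deriv0 // !mulrS derivD IH. Qed.
Lemma derivX a n : D (a ^+ n) = a ^+ n.-1 *+ n * D a.
Proof.
elim: n => [|n IH]; first by rewrite deriv1 mul0r.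
rewrite exprS derivM IH; case: n {IH} => [|n] /=; first by rewrite expr0; ring.
by rewrite [a ^+ n.+1]exprS; ring.
Qed.

Variables (N : nat) (phi : nat -> nat -> nat -> S) (X Y U : S).

(** The partial derivative of order [(i, j, h)] of the truncated series, at
    [(X, Y, U)]: the falling factorials vanish when a monomial is differentiated
    too often, so that the truncated exponents do not matter. *)
Definition poly_der (i j h : nat) : S :=
  \sum_(k < N.+1) \sum_(l < N.+1) \sum_(m < N.+1 | (k + l + m <= N)%N)
    phi k l m *+ (k ^_ i * l ^_ j * m ^_ h) * X ^+ (k - i) * Y ^+ (l - j) * U ^+ (m - h).

Lemma poly_derD i j h : (forall k l m, D (phi k l m) = 0) ->
  D (poly_der i j h) = poly_der i.+1 j h * D X + poly_der i j.+1 h * D Y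
    + poly_der i j h.+1 * D U.
Proof.
move=> Dphi; rewrite /poly_der !mulr_suml deriv_sum -!big_split /=.
apply: eq_bigr => k _; rewrite !mulr_suml deriv_sum -!big_split /=.
apply: eq_bigr => l _; rewrite !mulr_suml deriv_sum -!big_split /=.
apply: eq_bigr => m _.
rewrite !derivM !derivX derivMn Dphi mul0rn !ffactnSr !subnS.
ring.
Qed.

End Derivations.

Section Ideals.
Variable S : comPzRingType.

Definition ideal (I : S -> Prop) :=
  [/\ I 0, (forall a b, I a -> I b -> I (a + b)) & (forall a b, I b -> I (a * b))].

Variable I : S -> Prop.
Hypothesis idI : ideal I.

Lemma ideal0 : I 0. Proof. by case: idI. Qed.
Lemma idealD a b : I a -> I b -> I (a + b). Proof. by case: idI => _ H _; apply: H. Qed.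
Lemma idealMl a b : I b -> I (a * b). Proof. by case: idI => _ _; apply. Qed.
Lemma idealMr a b : I a -> I (a * b). Proof. by rewrite mulrC; apply: idealMl. Qed.
Lemma idealN a : I a -> I (- a). Proof. by rewrite -mulN1r; apply: idealMl. Qed.
Lemma idealB a b : I a -> I b -> I (a - b).
Proof. by move=> Ia Ib; apply: idealD => //; apply: idealN. Qed.
Lemma ideal_sum T (r : seq T) (P : pred T) (F : T -> S) :
  (forall i, P i -> I (F i)) -> I (\sum_(i <- r | P i) F i).
Proof. by move=> H; elim/big_rec: _ => [|i x Pi Ix]; [exact: ideal0|apply: idealD; auto]. Qed.
Lemma idealX a n : (0 < n)%N -> I a -> I (a ^+ n).
Proof. by case: n => // n _ Ia; rewrite exprS; apply: idealMr. Qed.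

Definition eqmod a b := I (a - b).

Lemma eqmod_refl a : eqmod a a. Proof. by rewrite /eqmod subrr; apply: ideal0. Qed.
Lemma eqmod_trans b a c : eqmod a b -> eqmod b c -> eqmod a c.
Proof. by move=> A B; have := idealD A B; rewrite addrA subrK. Qed.
Lemma eqmodD a a' b b' : eqmod a a' -> eqmod b b' -> eqmod (a + b) (a' + b').
Proof. by move=> A B; have := idealD A B; rewrite /eqmod opprD addrACA. Qed.
Lemma eqmodN a a' : eqmod a a' -> eqmod (- a) (- a').
Proof. by move=> A; have := idealN A; rewrite /eqmod opprB opprK addrC. Qed.
Lemma eqmodB a a' b b' : eqmod a a' -> eqmod b b' -> eqmod (a - b) (a' - b').
Proof. by move=> A B; apply: eqmodD => //; apply: eqmodN. Qed.
Lemma eqmodM a a' b b' : eqmod a a' -> eqmod b b' -> eqmod (a * b) (a' * b').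
Proof.
move=> A B; have -> : a * b = a' * b' + ((a - a') * b + a' * (b - b')) by ring.
rewrite /eqmod addrAC subrr add0r; apply: idealD; first exact: idealMr.
exact: idealMl.
Qed.
Lemma eqmodX a a' n : eqmod a a' -> eqmod (a ^+ n) (a' ^+ n).
Proof.
move=> A; elim: n => [|n IH]; first by rewrite !expr0; apply: eqmod_refl.
by rewrite !exprS; apply: eqmodM.
Qed.
Lemma eqmod0 a : I a -> eqmod a 0. Proof. by rewrite /eqmod subr0. Qed.
Lemma eqmod_in a b : eqmod a b -> I b -> I a.
Proof. by move=> A B; have := idealD A B; rewrite subrK. Qed.

End Ideals.

Section Wronskian.
Variable S : comPzRingType.
Variables dz dzb dw dwb : S -> S.
Hypotheses (dzP : derivation dz) (dzbP : derivation dzb)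
  (dwP : derivation dw) (dwbP : derivation dwb).

Definition Lb (r f : S) : S := - dwb r * dzb f + dzb r * dwb f.

Definition ZZ (r : S) : S :=
  dz (dz r) * dw r ^+ 2 - 2%:R * dw (dz r) * dz r * dw r + dw (dw r) * dz r ^+ 2.

Definition A3col (r : S) : seq S :=
  [:: dw r ^+ 3; dz r * dw r ^+ 2; dz r ^+ 2 * dw r; dz r ^+ 3; ZZ r].

Definition wronskian (D : S -> S) (v : seq S) : 'M[S]_5 :=
  \matrix_(i < 5, j < 5) iter j D v`_i.

Definition A3ring (r : S) : 'M[S]_5 := wronskian (Lb r) (A3col r).

Lemma Lb_derivation r : derivation (Lb r).
Proof.
split=> a b; rewrite /Lb.
  by rewrite (derivD dzbP) (derivD dwbP); ring.
by rewrite (derivM dzbP) (derivM dwbP); ring.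
Qed.

Lemma Lb_self r : Lb r r = 0.
Proof. by rewrite /Lb; ring. Qed.

(** Iterating [h L] on [h^3 f] gives a combination of the [L^k f] whose
    coefficients do not depend on [f]. *)
Lemma iter_scaled D h n : derivation D -> exists c : nat -> S,
  [/\ forall k, (n < k)%N -> c k = 0, c n = h ^+ (n + 3) &
      forall f, iter n (fun x => h * D x) (h ^+ 3 * f) = \sum_(k < n.+1) c k * iter k D f].
Proof.
move=> DP; elim: n => [|n [c [c0 cn cE]]].
  exists (fun k => if k == 0%N then h ^+ 3 else 0); split => //.
    by move=> [].
  by move=> f; rewrite big_ord_recl big_ord0 addr0.
exists (fun k => h * (D (c k) + (if k is k'.+1 then c k' else 0))); split.
- by case=> // k nk; rewrite !c0 ?(deriv0 DP) ?addr0 ?mulr0 // ltnW.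
- by rewrite c0 // (deriv0 DP) add0r cn addSn exprS.
move=> f; rewrite iterS cE (deriv_sum DP) mulr_sumr.
under eq_bigr do rewrite (derivM DP) -iterS mulrDr.
rewrite big_split /=.
under [RHS]eq_bigr do rewrite mulrDr mulrDl.
rewrite [RHS]big_split /=; congr (_ + _).
  rewrite [RHS]big_ord_recr /= c0 // (deriv0 DP) mulr0 mul0r addr0.
  by apply: eq_bigr => k _; rewrite mulrA.
rewrite [RHS]big_ord_recl /= mulr0 mul0r add0r.
by apply: eq_bigr => k _; rewrite mulrA.
Qed.

(** [E n] stands for the functions that are flat to an order growing with [n];
    each differentiation costs one level. *)
Variable E : nat -> S -> Prop.
Hypothesis idE : forall n, ideal (E n).
Hypothesis E_der : forall n a, E n.+1 a ->
  [/\ E n (dz a), E n (dzb a), E n (dw a) & E n (dwb a)].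

Definition flat_mod (r : S) n a := exists c, E n (a - c * r).

Lemma flat_modP r n : ideal (flat_mod r n).
Proof.
split; first by exists 0; rewrite mul0r subr0; apply: (ideal0 (idE n)).
  move=> a b [c Ec] [d Ed]; exists (c + d).
  have -> : a + b - (c + d) * r = (a - c * r) + (b - d * r) by ring.
  exact: (idealD (idE n)).
move=> a b [c Ec]; exists (a * c); rewrite -mulrA -mulrBr.
exact: (idealMl (idE n)).
Qed.

Lemma flat_mod_flat r n a : E n a -> flat_mod r n a.
Proof. by move=> Ea; exists 0; rewrite mul0r subr0. Qed.

Lemma flat_mod_self r n : flat_mod r n r.
Proof. by exists 1; rewrite mul1r subrr; apply: (ideal0 (idE n)). Qed.

(** A single derivative of [h r] is [h] times the derivative of [r] modulo
    [r]. *)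
Lemma flat_mod_der (d : S -> S) r r' h n : derivation d ->
  (forall n a, E n.+1 a -> E n (d a)) -> E n.+1 (r' - h * r) ->
  eqmod (flat_mod r n) (d r') (h * d r).
Proof.
move=> dP dE Ee; rewrite -(subrK (h * r) r'); set e := r' - h * r in Ee *.
rewrite (derivD dP) (derivM dP) /eqmod.
have -> : d e + (d h * r + h * d r) - h * d r = d e + d h * r by ring.
apply: (idealD (flat_modP r n)); first by apply: flat_mod_flat; apply: dE.
by apply: (idealMl (flat_modP r n)); apply: flat_mod_self.
Qed.

(** Changing the defining function: modulo its multiples, replacing [r] by
    [h r] multiplies the initial column by [h^3] and the operator by [h].  Six
    levels of flatness suffice for the four iterations on second derivatives. *)
Lemma A3ring_rescale r r' h : (forall n, (n <= 6)%N -> E n (r' - h * r)) ->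
  exists C : 'M[S]_5,
    [/\ forall i j : 'I_5, (j < i)%N -> C i j = 0,
        forall j : 'I_5, C j j = h ^+ (j + 3) &
        forall i j, flat_mod r 0 (A3ring r' i j - (A3ring r *m C) i j)].
Proof.
move=> Ee; pose I := flat_mod r; have idI := flat_modP r.
set e := r' - h * r in Ee.
have rE : r' = h * r + e by rewrite /e addrC subrK.
have Ir n : I n r by exact: flat_mod_self.
have /choice[c Hc] := fun n => iter_scaled h n (Lb_derivation r).
exists (\matrix_(i, j) c j i); split.
- by move=> i j ij; rewrite mxE; have [c0 _ _] := Hc j; apply: c0.
- by move=> j; rewrite mxE; have [_ -> ] := Hc j.
have [zE wE] : (forall n a, E n.+1 a -> E n (dz a)) /\ (forall n a, E n.+1 a -> E n (dw a)).
  by split=> n a /E_der[].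
have [zbE wbE] : (forall n a, E n.+1 a -> E n (dzb a)) /\ (forall n a, E n.+1 a -> E n (dwb a)).
  by split=> n a /E_der[].
(* first and second derivatives of r' modulo I *)
have D1 (d : S -> S) : derivation d -> (forall n a, E n.+1 a -> E n (d a)) ->
    forall n, (n < 6)%N -> eqmod (I n) (d r') (h * d r).
  by move=> dP dE n n6; apply: flat_mod_der => //; apply: Ee.
have D2 (d d' : S -> S) : derivation d -> (forall n a, E n.+1 a -> E n (d a)) ->
    derivation d' -> (forall n a, E n.+1 a -> E n (d' a)) ->
    forall n, (n < 5)%N -> eqmod (I n) (d (d' r')) (h * d (d' r) + d' h * d r + d h * d' r).
  move=> dP dE d'P d'E n n5; rewrite rE (derivD d'P) (derivM d'P) /eqmod.
  rewrite !(derivD dP) !(derivM dP).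
  set b := (X in I n X); have -> : b = d (d' h) * r + d (d' e) by rewrite /b; ring.
  apply: (idealD (idI n)); first by apply: (idealMl (idI n)); apply: Ir.
  by apply: flat_mod_flat; apply: dE; apply: d'E; apply: Ee.
have col n (i : 'I_5) : (n < 5)%N -> eqmod (I n) (A3col r')`_i (h ^+ 3 * (A3col r)`_i).
  move=> n5; have n6 : (n < 6)%N by apply: ltnW.
  have Ez := D1 _ dzP zE n n6; have Ew := D1 _ dwP wE n n6.
  have Ezz := D2 _ _ dzP zE dzP zE n n5; have Ewz := D2 _ _ dwP wE dzP zE n n5.
  have Eww := D2 _ _ dwP wE dwP wE n n5.
  have mM := fun a a' b b' => @eqmodM _ _ (idI n) a a' b b'.
  have mX := fun a a' k => @eqmodX _ _ (idI n) a a' k.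
  case: i => [[|[|[|[|[|//]]]]] ?] /=.
  - have -> : h ^+ 3 * dw r ^+ 3 = (h * dw r) ^+ 3 by ring.
    exact: mX.
  - have -> : h ^+ 3 * (dz r * dw r ^+ 2) = (h * dz r) * (h * dw r) ^+ 2 by ring.
    by apply: (mM) => //; apply: (mX).
  - have -> : h ^+ 3 * (dz r ^+ 2 * dw r) = (h * dz r) ^+ 2 * (h * dw r) by ring.
    by apply: (mM) => //; apply: (mX).
  - have -> : h ^+ 3 * dz r ^+ 3 = (h * dz r) ^+ 3 by ring.
    exact: mX.
  rewrite /ZZ.
  have -> : h ^+ 3 * (dz (dz r) * dw r ^+ 2 - 2%:R * dw (dz r) * dz r * dw r +
      dw (dw r) * dz r ^+ 2) =
    (h * dz (dz r) + dz h * dz r + dz h * dz r) * (h * dw r) ^+ 2 -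
     2%:R * (h * dw (dz r) + dz h * dw r + dw h * dz r) * (h * dz r) * (h * dw r) +
     (h * dw (dw r) + dw h * dw r + dw h * dw r) * (h * dz r) ^+ 2 by ring.
  apply: (eqmodD (idI n)); last by apply: (mM) => //; apply: (mX).
  apply: (eqmodB (idI n)); first by apply: (mM) => //; apply: (mX).
  do 2 (apply: (mM) => //); apply: (mM) => //; exact: (eqmod_refl (idI n)).
have LbE n f : (n < 6)%N -> eqmod (I n) (Lb r' f) (h * Lb r f).
  move=> n6; have -> : h * Lb r f = - (h * dwb r) * dzb f + (h * dzb r) * dwb f.
    by rewrite /Lb; ring.
  apply: (eqmodD (idI n)); apply: (eqmodM (idI n)); try exact: (eqmod_refl (idI n)).
    by apply: (eqmodN (idI n)); apply: D1.
  exact: D1.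
have LbI n a : (n < 6)%N -> I n.+1 a -> I n (Lb r' a).
  move=> n6 [k Ek]; rewrite -(subrK (k * r) a); set b := a - k * r in Ek *.
  have DP := Lb_derivation r'; rewrite (derivD DP) (derivM DP).
  have [_ A _ B] := E_der Ek.
  apply: (idealD (idI n)).
    by apply: flat_mod_flat; apply: (idealD (idE n)); apply: (idealMl (idE n)).
  apply: (idealD (idI n)); first by apply: (idealMl (idI n)); apply: Ir.
  apply: (idealMl (idI n)); have := LbE n r n6.
  by rewrite /eqmod Lb_self mulr0 subr0.
have it k n (i : 'I_5) : (k + n < 5)%N -> eqmod (I n) (iter k (Lb r') (A3col r')`_i)
     (iter k (fun x => h * Lb r x) (h ^+ 3 * (A3col r)`_i)).
  elim: k n => [|k IH] n kn; first exact: col.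
  rewrite !iterS.
  set x := iter k _ _; set y := iter k _ _.
  have n6 : (n < 6)%N by apply: leq_trans (_ : k.+1 + n < 6)%N; rewrite ?ltnS ?leq_addl // ltnW.
  apply: (eqmod_trans (idI n) (b := Lb r' y)); last exact: LbE.
  rewrite /eqmod -(derivB (Lb_derivation r')).
  by apply: LbI => //; apply: IH; rewrite addnS -addSn.
have jlt (j : 'I_5) : (j + 0 < 5)%N by rewrite addn0.
move=> i j; have := it j 0%N i (jlt j); rewrite /eqmod mxE mxE.
have [c0 _ ->] := Hc j.
suff -> : \sum_(k < j.+1) c j k * iter k (Lb r) (A3col r)`_i =
   \sum_j0 A3ring r i j0 * (\matrix_(i0, j1) c j1 i0) j0 j by [].
rewrite [RHS](eq_bigr (fun k : 'I_5 => c j k * iter k (Lb r) (A3col r)`_i)); last first.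
  by move=> k _; rewrite !mxE mulrC.
rewrite (big_ord_widen 5 (fun k => c j k * iter k (Lb r) (A3col r)`_i)) //.
rewrite big_mkcond /=; apply: eq_bigr => k _.
by case: ltnP => // jk; rewrite c0 ?mul0r.
Qed.

End Wronskian.

(** * The determinant of a hypersurface in normal form *)

Section NormalFormRing.
Variable S : comPzRingType.
Variables dz dzb dw dwb : S -> S.
Hypotheses (dzP : derivation dz) (dzbP : derivation dzb)
  (dwP : derivation dw) (dwbP : derivation dwb).
Variables (F G Fb Gb half c : S) (N : nat) (phi : nat -> nat -> nat -> S).

Definition scalar (a : S) := [/\ dz a = 0, dzb a = 0, dw a = 0 & dwb a = 0].
Definition holomorphic (a : S) := dzb a = 0 /\ dwb a = 0.

Hypotheses (half_scalar : scalar half) (c_scalar : scalar c)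
  (phi_scalar : forall k l m, scalar (phi k l m)).
Hypotheses (F_hol : holomorphic F) (G_hol : holomorphic G)
  (Fz_hol : holomorphic (dz F)) (Fw_hol : holomorphic (dw F))
  (Gz_hol : holomorphic (dz G)) (Gw_hol : holomorphic (dw G))
  (Fzz_hol : holomorphic (dz (dz F))) (Fzw_hol : holomorphic (dw (dz F)))
  (Fww_hol : holomorphic (dw (dw F))) (Gzz_hol : holomorphic (dz (dz G)))
  (Gzw_hol : holomorphic (dw (dz G))) (Gww_hol : holomorphic (dw (dw G))).
Hypotheses (Fb_ahol : dz Fb = 0 /\ dw Fb = 0) (Gb_ahol : dz Gb = 0 /\ dw Gb = 0).
Hypotheses (Fzw : dz (dw F) = dw (dz F)) (Gzw : dz (dw G) = dw (dz G)).

(** [half] and [c] stand for [1/2] and [1/(2i)]: then [realG] is the real part of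
    [G], and [nf] is the equation of the normal form pulled back by [(F, G)]. *)
Definition realG := (G + Gb) * half.
Definition phi_der i j h := poly_der N phi F Fb realG i j h.
Definition nf : S := (G - Gb) * c - phi_der 0 0 0.

Definition nf_z := - phi_der 1 0 0.
Definition nf_w := c - half * phi_der 0 0 1.
Definition nf_wb := - c - half * phi_der 0 0 1.
Definition nf_ZZ := - phi_der 2 0 0 * nf_w ^+ 2 + 2%:R * (half * phi_der 1 0 1) * nf_z * nf_w
   - half ^+ 2 * phi_der 0 0 2 * nf_z ^+ 2.
(** The column of the matrix, computed in the coordinates [(F, G)]. *)
Definition nf_col : seq S :=
  [:: nf_w ^+ 3; nf_z * nf_w ^+ 2; nf_z ^+ 2 * nf_w; nf_z ^+ 3; nf_ZZ].
Definition jac := dz F * dw G - dw F * dz G.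
Definition jacb := dzb Fb * dwb Gb - dwb Fb * dzb Gb.

Lemma dzU : dz realG = half * dz G.
Proof.
case: half_scalar => hz _ _ _.
by rewrite /realG (derivM dzP) (derivD dzP) hz Gb_ahol.1; ring.
Qed.
Lemma dwU : dw realG = half * dw G.
Proof.
case: half_scalar => _ _ hw _.
by rewrite /realG (derivM dwP) (derivD dwP) hw Gb_ahol.2; ring.
Qed.
Lemma dzbU : dzb realG = half * dzb Gb.
Proof.
case: half_scalar => _ hz _ _.
by rewrite /realG (derivM dzbP) (derivD dzbP) hz G_hol.1; ring.
Qed.
Lemma dwbU : dwb realG = half * dwb Gb.
Proof.
case: half_scalar => _ _ _ hw.
by rewrite /realG (derivM dwbP) (derivD dwbP) hw G_hol.2; ring.
Qed.

Lemma dzPE i j h : dz (phi_der i j h) = phi_der i.+1 j h * dz F + phi_der i j h.+1 * (half * dz G).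
Proof.
rewrite /phi_der (poly_derD dzP) ?Fb_ahol.1 ?dzU; first by ring.
by move=> k l m; case: (phi_scalar k l m).
Qed.
Lemma dwPE i j h : dw (phi_der i j h) = phi_der i.+1 j h * dw F + phi_der i j h.+1 * (half * dw G).
Proof.
rewrite /phi_der (poly_derD dwP) ?Fb_ahol.2 ?dwU; first by ring.
by move=> k l m; case: (phi_scalar k l m).
Qed.
Lemma dzbPE i j h : dzb (phi_der i j h) = phi_der i j.+1 h * dzb Fb + phi_der i j h.+1 * (half * dzb Gb).
Proof.
rewrite /phi_der (poly_derD dzbP) ?F_hol.1 ?dzbU; first by ring.
by move=> k l m; case: (phi_scalar k l m).
Qed.
Lemma dwbPE i j h : dwb (phi_der i j h) = phi_der i j.+1 h * dwb Fb + phi_der i j h.+1 * (half * dwb Gb).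
Proof.
rewrite /phi_der (poly_derD dwbP) ?F_hol.2 ?dwbU; first by ring.
by move=> k l m; case: (phi_scalar k l m).
Qed.

Lemma dz_nf : dz nf = nf_z * dz F + nf_w * dz G.
Proof.
case: c_scalar => h _ _ _; rewrite /nf (derivB dzP) (derivM dzP) (derivB dzP) h.
by rewrite dzPE Gb_ahol.1 /nf_z /nf_w; ring.
Qed.
Lemma dw_nf : dw nf = nf_z * dw F + nf_w * dw G.
Proof.
case: c_scalar => _ _ h _; rewrite /nf (derivB dwP) (derivM dwP) (derivB dwP) h.
by rewrite dwPE Gb_ahol.2 /nf_z /nf_w; ring.
Qed.
Lemma dzb_nf : dzb nf = - phi_der 0 1 0 * dzb Fb + nf_wb * dzb Gb.
Proof.
case: c_scalar => _ h _ _; rewrite /nf (derivB dzbP) (derivM dzbP) (derivB dzbP) h.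
by rewrite dzbPE G_hol.1 /nf_wb; ring.
Qed.
Lemma dwb_nf : dwb nf = - phi_der 0 1 0 * dwb Fb + nf_wb * dwb Gb.
Proof.
case: c_scalar => _ _ _ h; rewrite /nf (derivB dwbP) (derivM dwbP) (derivB dwbP) h.
by rewrite dwbPE G_hol.2 /nf_wb; ring.
Qed.

Notation D := (Lb dzb dwb nf).

Lemma D_hol a : holomorphic a -> D a = 0.
Proof. by case=> h1 h2; rewrite /Lb h1 h2 !mulr0 addr0. Qed.

Lemma D_Fb : D Fb = - nf_wb * jacb.
Proof. by rewrite /Lb dzb_nf dwb_nf /jacb; ring. Qed.

(** The matrix of the action of the holomorphic Jacobian on cubic forms in
    [(rho_z, rho_w)], completed by the transformation of the second derivative
    along the tangent vector. *)
Definition sym3 (x y s t : S) (e0 e1 e2 e3 e4 : S) : 'M[S]_5 :=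
  \matrix_(i, j) (nth [::]
   [:: [:: t ^+ 3; t ^+ 2 * s *+ 3; t * s ^+ 2 *+ 3; s ^+ 3; 0];
       [:: y * t ^+ 2; x * t ^+ 2 + y * t * s *+ 2; x * t * s *+ 2 + y * s ^+ 2; x * s ^+ 2; 0];
       [:: y ^+ 2 * t; x * y * t *+ 2 + y ^+ 2 * s; x ^+ 2 * t + x * y * s *+ 2; x ^+ 2 * s; 0];
       [:: y ^+ 3; y ^+ 2 * x *+ 3; y * x ^+ 2 *+ 3; x ^+ 3; 0];
       [:: e0; e1; e2; e3; e4]] i)`_j.

(** The symmetric cube of a two by two matrix is inverted, up to a power of the
    determinant, by that of the adjugate. *)
Lemma det_sym3 x y s t e0 e1 e2 e3 e4 :
  \det (sym3 x y s t e0 e1 e2 e3 e4) * \det (sym3 t (- y) (- s) x 0 0 0 0 1) =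
  (x * t - y * s) ^+ 12 * e4.
Proof.
rewrite -det_mulmx det_trig; last first.
  apply/is_trig_mxP => -[[|[|[|[|[|//]]]]] ?] [[|[|[|[|[|//]]]]] ?] //= _;
  by rewrite !mxE !big_ord_recl big_ord0 !mxE /=; ring.
rewrite !big_ord_recl big_ord0 !mxE !big_ord_recl !big_ord0 !mxE /=; ring.
Qed.

(** The last row collects the second derivatives of the change of coordinates:
    they contribute first derivatives of the equation, again cubically. *)
Definition nf_jac : 'M[S]_5 :=
  let x := dz F in let y := dz G in let s := dw F in let t := dw G in
  let a := dz (dz F) in let b := dw (dz F) in let d := dw (dw F) in
  let a' := dz (dz G) in let b' := dw (dz G) in let d' := dw (dw G) in
  sym3 x y s t
   (a' * t ^+ 2 - b' * y * t *+ 2 + d' * y ^+ 2)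
   (a' * t * s *+ 2 - b' * (y * s + x * t) *+ 2 + d' * x * y *+ 2
     + (a * t ^+ 2 - b * y * t *+ 2 + d * y ^+ 2))
   (a' * s ^+ 2 - b' * x * s *+ 2 + d' * x ^+ 2 +
    (a * t * s *+ 2 - b * (y * s + x * t) *+ 2 + d * x * y *+ 2))
   (a * s ^+ 2 - b * x * s *+ 2 + d * x ^+ 2)
   (jac ^+ 2).

Lemma A3col_nf (i : 'I_5) :
  (A3col dz dw nf)`_i = \sum_(k < 5) nf_jac i k * nf_col`_k.
Proof.
rewrite !big_ord_recl big_ord0.
have Ezz : dz (dz nf) = - (phi_der 2 0 0 * dz F + phi_der 1 0 1 * (half * dz G)) * dz F + nf_z * dz (dz F)
   - half * (phi_der 1 0 1 * dz F + phi_der 0 0 2 * (half * dz G)) * dz G + nf_w * dz (dz G).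
  rewrite dz_nf (derivD dzP) !(derivM dzP) /nf_z /nf_w (derivN dzP) (derivB dzP).
  rewrite (derivM dzP) !dzPE; case: c_scalar => -> _ _ _; case: half_scalar => -> _ _ _.
  by ring.
have Ewz : dw (dz nf) = - (phi_der 2 0 0 * dw F + phi_der 1 0 1 * (half * dw G)) * dz F + nf_z * dw (dz F)
   - half * (phi_der 1 0 1 * dw F + phi_der 0 0 2 * (half * dw G)) * dz G + nf_w * dw (dz G).
  rewrite dz_nf (derivD dwP) !(derivM dwP) /nf_z /nf_w (derivN dwP) (derivB dwP).
  rewrite (derivM dwP) !dwPE; case: c_scalar => _ _ -> _; case: half_scalar => _ _ -> _.
  by ring.
have Eww : dw (dw nf) = - (phi_der 2 0 0 * dw F + phi_der 1 0 1 * (half * dw G)) * dw F + nf_z * dw (dw F)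
   - half * (phi_der 1 0 1 * dw F + phi_der 0 0 2 * (half * dw G)) * dw G + nf_w * dw (dw G).
  rewrite dw_nf (derivD dwP) !(derivM dwP) /nf_z /nf_w (derivN dwP) (derivB dwP).
  rewrite (derivM dwP) !dwPE; case: c_scalar => _ _ -> _; case: half_scalar => _ _ -> _.
  by ring.
case: i => [[|[|[|[|[|//]]]]] ?]; rewrite !mxE /=.
- by rewrite dw_nf; ring.
- by rewrite dz_nf dw_nf; ring.
- by rewrite dz_nf dw_nf; ring.
- by rewrite dz_nf; ring.
rewrite /ZZ Ezz Ewz Eww dz_nf dw_nf /nf_ZZ /jac; ring.
Qed.

Lemma nf_jac_hol i k : D (nf_jac i k) = 0.
Proof.
have DP := Lb_derivation dzbP dwbP nf.
have [hx hy] := (D_hol Fz_hol, D_hol Gz_hol).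
have [hs ht] := (D_hol Fw_hol, D_hol Gw_hol).
have [[ha hb] hd] := (D_hol Fzz_hol, D_hol Fzw_hol, D_hol Fww_hol).
have [[ha' hb'] hd'] := (D_hol Gzz_hol, D_hol Gzw_hol, D_hol Gww_hol).
case: i => [[|[|[|[|[|//]]]]] ?]; case: k => [[|[|[|[|[|//]]]]] ?]; rewrite !mxE /= ?(deriv0 DP) // /jac;
rewrite ?(derivD DP, derivN DP, derivMn DP, derivM DP, derivX DP) ?(hx,hy,hs,ht,ha,hb,hd,ha',hb',hd');
rewrite ?(mulr0, mul0r, mul0rn, addr0, oppr0) //.
Qed.

(** The entries of [nf_jac] are holomorphic, hence constants for the operator [D]. *)
Lemma A3ring_nf : A3ring dz dzb dw dwb nf = nf_jac *m wronskian D nf_col.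
Proof.
have DP := Lb_derivation dzbP dwbP nf.
apply/matrixP => i j; rewrite !mxE A3col_nf.
under [RHS]eq_bigr do rewrite [X in _ * X]mxE.
elim: (nat_of_ord j) => [|n IH]; first by [].
rewrite iterS IH (deriv_sum DP); apply: eq_bigr => k _.
by rewrite (derivM DP) nf_jac_hol mul0r add0r -iterS.
Qed.

(** * Reduction to the antiholomorphic variable *)

Definition nf_ideal (a : S) := exists x y z, a = x * F + y * G + z * nf.

Lemma nf_idealP : ideal nf_ideal.
Proof.
split; first by exists 0, 0, 0; ring.
  by move=> a b [x [y [z ->]]] [x' [y' [z' ->]]]; exists (x + x'), (y + y'), (z + z'); ring.
by move=> a b [x [y [z ->]]]; exists (a * x), (a * y), (a * z); ring.
Qed.

(** The operator [D] kills [F] and [G], which are holomorphic, and [nf] itself. *)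
Lemma nf_ideal_D a : nf_ideal a -> nf_ideal (D a).
Proof.
move=> [x [y [z ->]]]; exists (D x), (D y), (D z).
have DP := Lb_derivation dzbP dwbP nf.
rewrite !(derivD DP) !(derivM DP) (D_hol F_hol) (D_hol G_hol) Lb_self.
ring.
Qed.

Hypotheses (half2 : half *+ 2 = 1) (c' : S) (cK : c * c' = 1) (N6 : (6 <= N)%N).
Hypotheses (phi0 : forall k m, phi 0 k m = 0) (phi10 : forall m, phi 1 0 m = 0)
 (phi11 : forall m, phi 1 1 m = (m == 0%N)%:R)
 (phi1s : forall s m, (2 <= s)%N -> phi 1 s m = 0)
 (phi2 : forall s m, (s <= 3)%N -> phi 2 s m = 0).

Let idI := nf_idealP.

Lemma F_in : nf_ideal F. Proof. by exists 1, 0, 0; ring. Qed.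
Lemma G_in : nf_ideal G. Proof. by exists 0, 1, 0; ring. Qed.
Lemma nf_in : nf_ideal nf. Proof. by exists 0, 0, 1; ring. Qed.

Lemma P_reduce i j h : nf_ideal (phi_der i j h -
  \sum_(k < N.+1 | k == i :> nat) \sum_(l < N.+1) \sum_(m < N.+1 | (k + l + m <= N)%N)
    phi k l m *+ (k ^_ i * l ^_ j * m ^_ h) * F ^+ (k - i) * Fb ^+ (l - j) * realG ^+ (m - h)).
Proof.
rewrite /phi_der /poly_der (bigID (fun k : 'I_N.+1 => k == i :> nat)) /= addrC addrK.
apply: (ideal_sum idI) => k ki; apply: (ideal_sum idI) => l _; apply: (ideal_sum idI) => m _.
have [k_lt|k_ge] := ltnP k i.
  by rewrite ffact_small // !mul0n mulr0n !mul0r; apply: (ideal0 idI).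
apply: (idealMr idI); apply: (idealMr idI); apply: (idealMl idI).
by apply: (idealX idI) F_in; rewrite subn_gt0 ltn_neqAle eq_sym ki.
Qed.

Lemma P0_in j h : nf_ideal (phi_der 0 j h).
Proof.
apply: (eqmod_in idI (P_reduce 0 j h)).
apply: (ideal_sum idI) => k /eqP ->; apply: (ideal_sum idI) => l _; apply: (ideal_sum idI) => m _.
by rewrite phi0 mul0rn !mul0r; apply: (ideal0 idI).
Qed.

Lemma Gb_in : nf_ideal Gb.
Proof.
have E : c' * (nf + phi_der 0 0 0) = (G - Gb) * (c * c') by rewrite /nf; ring.
have -> : Gb = G - c' * (nf + phi_der 0 0 0) by rewrite E cK; ring.
apply: (idealB idI); first exact: G_in.
by apply: (idealMl idI); apply: (idealD idI) (P0_in _ _); apply: nf_in.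
Qed.

Lemma U_in : nf_ideal realG.
Proof. by apply: (idealMr idI); apply: (idealD idI) Gb_in; apply: G_in. Qed.

Lemma P1_reduce h : nf_ideal (phi_der 1 0 h - (if h == 0%N then Fb else 0)).
Proof.
have N1 : (1 < N.+1)%N by rewrite ltnS (leq_trans _ N6).
apply: (eqmod_trans idI (P_reduce 1 0 h)).
rewrite (big_pred1 (Ordinal N1)) // (bigD1 (Ordinal N1)) //=.
rewrite [X in _ + X]big1 ?addr0; last first.
  case=> [[|[|l]] l1] //= _; apply: big1 => m _.
    by rewrite phi10 mul0rn !mul0r.
  by rewrite phi1s // mul0rn !mul0r.
rewrite (bigD1 ord0) //=; last by rewrite (leq_trans _ N6).
rewrite [X in _ + X]big1 ?addr0; last first.
  case=> [[|m] m1] /=; first by rewrite andbF.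
  move=> _; have -> : phi 1 1 m.+1 = 0 by rewrite phi11.
  by rewrite mul0rn !mul0r.
have -> : phi 1 1 0 = 1 by rewrite phi11.
rewrite subnn expr0 sub0n expr0 subn0 expr1 !mulr1.
case: h => [|h] /=.
  rewrite mulr1n mul1r; exact: (eqmod_refl idI).
rewrite muln0 mulr0n mul0r; exact: (eqmod_refl idI).
Qed.

(** The coefficients [phi_2l] vanish for [l <= 3] in a normal form. *)
Lemma P2_reduce : exists u, nf_ideal (phi_der 2 0 0 - (phi 2 4 0 *+ 2 * Fb ^+ 4 + u * Fb ^+ 5)).
Proof.
have N2 : (2 < N.+1)%N by rewrite ltnS (leq_trans _ N6).
have N4 : (4 < N.+1)%N by rewrite ltnS (leq_trans _ N6).
exists (\sum_(l < N.+1 | (4 < l)%N && (2 + l + 0 <= N)%N) phi 2 l 0 *+ 2 * Fb ^+ (l - 5)).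
apply: (eqmod_trans idI (P_reduce 2 0 0)).
rewrite (big_pred1 (Ordinal N2)) //=.
apply: (eqmod_trans idI (b := \sum_(l < N.+1 | (2 + l + 0 <= N)%N) phi 2 l 0 *+ 2 * Fb ^+ l)).
  rewrite [X in eqmod _ _ X]big_mkcond /=.
  apply: (big_ind2 (fun a b => eqmod nf_ideal a b)).
  - exact: (eqmod_refl idI).
  - by move=> a a' b b'; apply: (eqmodD idI).
  move=> l _; case: ifP => lN.
    rewrite (bigD1 ord0) //= !subn0 subnn !expr0 !mulr1 !ffactn0 !muln1.
    rewrite /eqmod addrAC subrr add0r; apply: (ideal_sum idI) => m /andP[_ m0].
    apply: (idealMl idI); apply: (idealX idI) U_in.
    by rewrite subn0 lt0n -(inj_eq val_inj) in m0 *.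
  rewrite big1; first exact: (eqmod_refl idI).
  by move=> m mN; move: lN; rewrite addn0 (leq_trans _ mN) // leq_addr.
rewrite /eqmod (bigD1 (Ordinal N4)) //=.
rewrite (bigID (fun l : 'I_N.+1 => (4 < l)%N)) /= mulr_suml.
rewrite [X in _ + (_ + X) - _]big1 ?addr0; last first.
  move=> l /andP[/andP[_ l4]]; rewrite -leqNgt => l4'.
  have l3 : (l <= 3)%N.
    by move: l4; rewrite -(inj_eq val_inj) /=; lia.
  by rewrite phi2 // mul0rn mul0r.
set A := (X in _ + X - _); set B := (X in _ - (_ + X)).
suff -> : A = B by rewrite subrr; apply: (ideal0 idI).
apply: eq_big => l; first by rewrite -(inj_eq val_inj) /=; lia.
by move=> /andP[_ l4]; rewrite -mulrA -exprD subnK.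
Qed.

(** Modulo [nf_ideal] only the powers of [Fb] remain, and [Fb] vanishes at the point. *)
Definition mod_Fb n (a : S) := exists x u, nf_ideal x /\ a = x + u * Fb ^+ n.

Lemma mod_FbP n : ideal (mod_Fb n).
Proof.
split; first by exists 0, 0; split; [exact: (ideal0 idI)|ring].
  move=> a b [x [u [Ix ->]]] [y [v [Iy ->]]]; exists (x + y), (u + v).
  by split; [exact: (idealD idI)|ring].
move=> a b [x [u [Ix ->]]]; exists (a * x), (a * u).
by split; [exact: (idealMl idI)|ring].
Qed.

Lemma mod_Fb_sub n a : nf_ideal a -> mod_Fb n a.
Proof. by move=> Ia; exists a, 0; split => //; ring. Qed.

Lemma mod_Fb_pow n m a : (n <= m)%N -> mod_Fb n (a * Fb ^+ m).
Proof.
move=> nm; exists 0, (a * Fb ^+ (m - n)); split; first exact: (ideal0 idI).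
by rewrite add0r -mulrA -exprD subnK.
Qed.

Lemma mod_Fb_D n a : mod_Fb n.+1 a -> mod_Fb n (D a).
Proof.
have DP := Lb_derivation dzbP dwbP nf.
move=> [x [u [Ix ->]]].
exists (D x), (D u * Fb + u *+ n.+1 * D Fb).
split; first exact: nf_ideal_D.
by rewrite (derivD DP) (derivM DP) (derivX DP) /= exprS; ring.
Qed.

(** Each application of [D] lowers the power of [Fb] by one. *)
Lemma iter_D_lead (a k : S) (i j : nat) : (j <= i)%N -> mod_Fb i.+1 (a - k * Fb ^+ i) ->
  mod_Fb (i - j).+1 (iter j D a - (k *+ (i ^_ j) * D Fb ^+ j) * Fb ^+ (i - j)).
Proof.
have DP := Lb_derivation dzbP dwbP nf.
elim: j => [|j IH] ji Ka.
  by rewrite subn0 ffactn0 mulr1n expr0 mulr1.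
have {IH} := mod_Fb_D (IH (ltnW ji) Ka).
set k' := k *+ _ * _; rewrite (derivB DP) (derivM DP) (derivX DP) -iterS.
have ij : (i - j)%N = (i - j.+1).+1 by lia.
move=> H; set x := iter _ _ _ in H *.
have -> : x - k *+ (i ^_ j.+1) * D Fb ^+ j.+1 * Fb ^+ (i - j.+1) =
  (x - (D k' * Fb ^+ (i - j) + k' * (Fb ^+ (i - j).-1 *+ (i - j) * D Fb)))
   + D k' * Fb ^+ (i - j).
  rewrite ffactnSr ij /= exprS /k' mulrnA; ring.
apply: (idealD (mod_FbP _)); first by rewrite -ij.
by apply: mod_Fb_pow; rewrite ij.
Qed.

Lemma nf_wb_mod : nf_ideal (nf_wb + c).
Proof.
have -> : nf_wb + c = - half * phi_der 0 0 1 by rewrite /nf_wb; ring.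
by apply: (idealMl idI); apply: P0_in.
Qed.

Definition lead (i : nat) : S :=
  [:: c ^+ 3; - c ^+ 2; c; - 1; - (c ^+ 2 * phi 2 4 0 *+ 2)]`_i.

Lemma nf_col_lead (i : 'I_5) : mod_Fb i.+1 (nf_col`_i - lead i * Fb ^+ i).
Proof.
have Ew : eqmod nf_ideal nf_w c.
  have -> : nf_w = c - half * phi_der 0 0 1 by [].
  rewrite -[X in eqmod _ _ X]subr0; apply: (eqmodB idI); first exact: (eqmod_refl idI).
  by apply: (eqmod0); apply: (idealMl idI); apply: P0_in.
have Ez : eqmod nf_ideal nf_z (- Fb).
  by apply: (eqmodN idI); apply: (P1_reduce 0).
have mM := fun a a' b b' => @eqmodM _ _ idI a a' b b'.
have mX := fun a a' k => @eqmodX _ _ idI a a' k.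
case: i => [[|[|[|[|[|//]]]]] ?] /=; rewrite /lead /=.
- apply: mod_Fb_sub; rewrite expr0 mulr1; exact: (mX).
- apply: mod_Fb_sub; have -> : - c ^+ 2 * Fb ^+ 1 = (- Fb) * c ^+ 2 by ring.
  by apply: (mM) => //; apply: (mX).
- apply: mod_Fb_sub; have -> : c * Fb ^+ 2 = (- Fb) ^+ 2 * c by ring.
  by apply: (mM) => //; apply: (mX).
- apply: mod_Fb_sub; have -> : - 1 * Fb ^+ 3 = (- Fb) ^+ 3 by ring.
  exact: (mX).
have [u Hu] := P2_reduce.
set v := phi 2 4 0 *+ 2 * Fb ^+ 4 + u * Fb ^+ 5 in Hu.
have E : eqmod nf_ideal nf_ZZ (- v * c ^+ 2 + 2%:R * (half * 0) * (- Fb) * c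
    - half ^+ 2 * phi_der 0 0 2 * nf_z ^+ 2).
  apply: (eqmodB idI); last exact: (eqmod_refl idI).
  apply: (eqmodD idI).
    by apply: (mM); [apply: (eqmodN idI)|apply: (mX)].
  apply: (mM) => //; apply: (mM) => //; apply: (mM); first exact: (eqmod_refl idI).
  apply: (mM); first exact: (eqmod_refl idI).
  exact: (P1_reduce 1).
have -> : nf_ZZ - - (c ^+ 2 * phi 2 4 0 *+ 2) * Fb ^+ 4 =
   (nf_ZZ - (- v * c ^+ 2 + 2%:R * (half * 0) * - Fb * c - half ^+ 2 * phi_der 0 0 2 * nf_z ^+ 2))
   + (- half ^+ 2 * nf_z ^+ 2 * phi_der 0 0 2 + (- c ^+ 2 * u) * Fb ^+ 5).
  by rewrite /v; ring.
apply: (idealD (mod_FbP _)); first exact: mod_Fb_sub.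
apply: (idealD (mod_FbP _)); last exact: mod_Fb_pow.
by apply: mod_Fb_sub; apply: (idealMl idI); apply: P0_in.
Qed.

Variables (L : numFieldType) (ev : {rmorphism S -> L}).
Hypotheses (evF : ev F = 0) (evG : ev G = 0) (evFb : ev Fb = 0) (evnf : ev nf = 0).
Hypotheses (evjac : ev jac != 0) (evjacb : ev jacb != 0).

Lemma ev_ideal a : nf_ideal a -> ev a = 0.
Proof.
by move=> [x [y [z ->]]]; rewrite !rmorphD !rmorphM evF evG evnf !mulr0 !addr0.
Qed.

Lemma ev_mod_Fb n a : (0 < n)%N -> mod_Fb n a -> ev a = 0.
Proof.
case: n => // n _ [x [u [Ix ->]]].
by rewrite rmorphD rmorphM rmorphXn evFb expr0n /= mulr0 ev_ideal // addr0.
Qed.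

Lemma ev_c : ev c != 0.
Proof.
apply/eqP => c0; have := congr1 ev cK; rewrite rmorphM rmorph1 c0 mul0r => /eqP.
by rewrite eq_sym oner_eq0.
Qed.

Lemma ev_D_Fb : ev (D Fb) != 0.
Proof.
rewrite D_Fb mulNr rmorphN oppr_eq0 rmorphM mulf_neq0 //.
have := ev_ideal nf_wb_mod; rewrite rmorphD => /eqP; rewrite addr_eq0 => /eqP ->.
by rewrite oppr_eq0 ev_c.
Qed.

(** At the point, the equation of the normal form has the differential [c dG]. *)
Lemma nf_regular : ev (dz nf) = 0 -> ev (dw nf) = 0 -> False.
Proof.
have evz : ev nf_z = 0.
  have := ev_ideal (P1_reduce 0); rewrite eqxx rmorphB evFb subr0 => P0.
  by rewrite /nf_z rmorphN P0 oppr0.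
have evw : ev nf_w = ev c.
  by rewrite /nf_w rmorphB rmorphM (ev_ideal (P0_in 0 1)) mulr0 subr0.
rewrite dz_nf dw_nf !rmorphD !rmorphM evz evw !mul0r !add0r.
move=> /eqP; rewrite mulf_eq0 (negbTE ev_c) /= => /eqP Gz0.
move=> /eqP; rewrite mulf_eq0 (negbTE ev_c) /= => /eqP Gw0.
by move: evjac; rewrite /jac rmorphB !rmorphM Gz0 Gw0 !mulr0 subrr eqxx.
Qed.

(** At the origin the reduced matrix is triangular: the entries of the column
    are successive powers of the antiholomorphic variable, the last one being
    the fourth power with the coefficient of the normal form. *)
Lemma det_nf_eq0 :
  (\det (map_mx ev (A3ring dz dzb dw dwb nf)) = 0 <-> ev (phi 2 4 0) = 0) /\
  (ev (dz nf) = 0 -> ev (dw nf) = 0 -> False).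
Proof.
split; last exact: nf_regular.
rewrite A3ring_nf map_mxM det_mulmx.
have jac0 : \det (map_mx ev nf_jac) != 0.
  rewrite det_map_mx; apply/eqP => d0.
  have := congr1 ev (det_sym3 (dz F) (dz G) (dw F) (dw G)
     _ _ _ _ (jac ^+ 2)).
  move=> /(_ _ _ _ _) E; have {}E := E (nf_jac ord_max 0) (nf_jac ord_max 1) (nf_jac ord_max 2) (nf_jac ord_max 3).
  move: E; rewrite [sym3 _ _ _ _ _ _ _ _ _](_ : _ = nf_jac); last first.
    by apply/matrixP => -[[|[|[|[|[|//]]]]] ?] [[|[|[|[|[|//]]]]] ?]; rewrite !mxE.
  have -> : dz F * dw G - dz G * dw F = jac by rewrite /jac; ring.
  rewrite -exprD [in LHS]rmorphM d0 mul0r rmorphXn /= => /esym/eqP.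
  by rewrite expf_eq0 /= (negbTE evjac).
have tri : is_trig_mx (map_mx ev (wronskian D nf_col))^T.
  apply/is_trig_mxP => j i ij; rewrite !mxE.
  have := iter_D_lead (ltnW ij) (nf_col_lead i).
  move=> /(ev_mod_Fb (ltn0Sn _)); rewrite rmorphB rmorphM rmorphXn evFb.
  by rewrite expr0n subn_eq0 leqNgt ij /= mulr0 subr0.
rewrite -[\det (map_mx ev (wronskian _ _))]det_tr (det_trig tri).
have diag (i : 'I_5) : (map_mx ev (wronskian D nf_col))^T i i =
    ev (lead i) *+ i`! * ev (D Fb) ^+ i.
  rewrite !mxE; have := iter_D_lead (leqnn i) (nf_col_lead i).
  move=> /(ev_mod_Fb (ltn0Sn _))/eqP; rewrite rmorphB subr_eq0 => /eqP ->.
  by rewrite subnn expr0 mulr1 ffactnn rmorphM rmorphMn rmorphXn.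
rewrite (eq_bigr _ (fun i _ => diag i)).
rewrite !big_ord_recr big_ord0 /= mul1r /lead /=.
set d := ev (D Fb); have d0 : d != 0 := ev_D_Fb.
have c0 := ev_c.
rewrite !rmorphN rmorphMn !rmorphM rmorph1.
split=> [/eqP|->]; last by rewrite mulr0 !mul0rn oppr0 mul0rn !mul0r !mulr0.
rewrite !(mulf_eq0, mulrn_eq0, oppr_eq0, expf_eq0) /= (negbTE jac0) (negbTE d0) (negbTE c0) /=.
by rewrite ?oner_eq0 /= ?orbF => /eqP.
Qed.

End NormalFormRing.

(** * Weighted polynomials *)

Section WeightedPolynomials.
Variables (R : realType) (z w : 'rV[R]_4 -> R[i]).
Implicit Types f g : 'rV[R]_4 -> R[i].

Definition ucoord (q : 'rV[R]_4) : R := complex.Re (w q).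
Definition vcoord (q : 'rV[R]_4) : R := complex.Im (w q).

(** [weighted k f]: [f] is a polynomial in [z], its conjugate, [Re w] and
    [Im w] all of whose terms have weight at least [k], where [z] has weight 1
    and [w] has weight 2. *)
Inductive weighted : nat -> ('rV[R]_4 -> R[i]) -> Prop :=
| weighted_cst c : weighted 0 (fun=> c)
| weighted_z : weighted 1 z
| weighted_zb : weighted 1 (fun q => (z q)^*%C)
| weighted_u : weighted 2 (fun q => (ucoord q)%:C%C)
| weighted_v : weighted 2 (fun q => (vcoord q)%:C%C)
| weightedD k f g : weighted k f -> weighted k g -> weighted k (fun q => f q + g q)
| weightedM k l f g : weighted k f -> weighted l g -> weighted (k + l) (fun q => f q * g q)
| weighted_le k l f : (l <= k)%N -> weighted k f -> weighted l f.

Lemma weighted_eq k f g : f =1 g -> weighted k f -> weighted k g.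
Proof. by move=> /funext ->. Qed.

Lemma weightedZ k c f : weighted k f -> weighted k (fun q => c * f q).
Proof. by move=> H; rewrite -[k]add0n; apply: weightedM H; apply: weighted_cst. Qed.

Lemma weighted0 k : weighted k (fun=> 0).
Proof.
elim: k => [|k IH]; first exact: weighted_cst.
have := weightedM weighted_z IH.
by rewrite add1n; apply: weighted_eq => q; rewrite mulr0.
Qed.

Lemma weighted_sum I (r : seq I) (P : pred I) k (f : I -> 'rV[R]_4 -> R[i]) :
  (forall i, P i -> weighted k (f i)) -> weighted k (fun q => \sum_(i <- r | P i) f i q).
Proof.
move=> H; elim: r => [|i r IH].
  by apply: weighted_eq (weighted0 k) => q; rewrite big_nil.
case: (boolP (P i)) => Pi.
  by apply: weighted_eq (weightedD (H _ Pi) IH) => q; rewrite big_cons Pi.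
by apply: weighted_eq IH => q; rewrite big_cons (negbTE Pi).
Qed.

Lemma weighted_conj k f : weighted k f -> weighted k (fun q => (f q)^*%C).
Proof.
elim => {k f}.
- by move=> c; apply: weighted_cst.
- exact: weighted_zb.
- by apply: weighted_eq weighted_z => q; rewrite conjcK.
- by apply: weighted_eq weighted_u => q; rewrite /= oppr0.
- by apply: weighted_eq weighted_v => q; rewrite /= oppr0.
- move=> k f g _ Hf _ Hg; apply: weighted_eq (weightedD Hf Hg) => q.
  by rewrite rmorphD.
- move=> k l f g _ Hf _ Hg; apply: weighted_eq (weightedM Hf Hg) => q.
  by rewrite rmorphM.
- by move=> k l f lk _; apply: weighted_le.
Qed.

End WeightedPolynomials.

Section Homogeneous.
Variable R : realType.
Implicit Types psi chi s : R[i] -> R -> R[i].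

(** Weighted homogeneous polynomials in [z], its conjugate and [u], and the
    polynomials all of whose terms have weight at least [k]. *)
Inductive whom : nat -> (R[i] -> R -> R[i]) -> Prop :=
| whom0 k : whom k (fun _ _ => 0)
| whom_mono c a b m : whom (a + b + 2 * m) (fun z u => c * z ^+ a * z^*%C ^+ b * u%:C%C ^+ m)
| whomD k psi chi : whom k psi -> whom k chi -> whom k (fun z u => psi z u + chi z u).

Inductive wpol (k : nat) : (R[i] -> R -> R[i]) -> Prop :=
| wpol_hom j psi : (k <= j)%N -> whom j psi -> wpol k psi
| wpolD s t : wpol k s -> wpol k t -> wpol k (fun z u => s z u + t z u).

Lemma whomM j k psi chi : whom j psi -> whom k chi ->
  whom (j + k) (fun z u => psi z u * chi z u).
Proof.
move=> Hp Hc; elim: Hp => {j psi} [j|c a b m|j p1 p2 _ H1 _ H2].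
- rewrite (_ : (fun z u => _) = (fun _ _ => 0)); first exact: whom0.
  by apply/funext => z; apply/funext => u; rewrite mul0r.
- elim: Hc => {k chi} [k|c' a' b' m'|k p1 p2 _ H1 _ H2].
  + rewrite (_ : (fun z u => _) = (fun _ _ => 0)); first exact: whom0.
    by apply/funext => z; apply/funext => u; rewrite mulr0.
  + rewrite (_ : (fun z u => _) = (fun z u =>
       (c * c') * z ^+ (a + a') * z^*%C ^+ (b + b') * u%:C%C ^+ (m + m'))).
      have := whom_mono (c * c') (a + a') (b + b') (m + m').
      by congr whom; lia.
    by apply/funext => z; apply/funext => u; rewrite !exprD; ring.
  rewrite (_ : (fun z u => _) = (fun z u =>
     c * z ^+ a * z^*%C ^+ b * u%:C%C ^+ m * p1 z u + c * z ^+ a * z^*%C ^+ b * u%:C%C ^+ m * p2 z u)).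
    exact: whomD.
  by apply/funext => z; apply/funext => u; rewrite mulrDr.
rewrite (_ : (fun z u => _) = (fun z u => p1 z u * chi z u + p2 z u * chi z u)).
  exact: whomD.
by apply/funext => z; apply/funext => u; rewrite mulrDl.
Qed.

Lemma wpol_le k l s : (l <= k)%N -> wpol k s -> wpol l s.
Proof.
move=> lk; elim=> {s} [j psi kj H|s t _ Hs _ Ht]; last exact: wpolD.
by apply: wpol_hom H; apply: leq_trans kj.
Qed.

Lemma wpolM k l s t : wpol k s -> wpol l t -> wpol (k + l) (fun z u => s z u * t z u).
Proof.
move=> Hs Ht; elim: Hs => {s} [j psi kj H|s s' _ Hs _ Hs'].
  elim: Ht => {t} [j' psi' lj H'|t t' _ Ht _ Ht'].
    by apply: wpol_hom (whomM H H'); apply: leq_add.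
  rewrite (_ : (fun z u => _) = (fun z u => psi z u * t z u + psi z u * t' z u)).
    exact: wpolD.
  by apply/funext => z; apply/funext => u; rewrite mulrDr.
rewrite (_ : (fun z u => _) = (fun z u => s z u * t z u + s' z u * t z u)).
  exact: wpolD.
by apply/funext => z; apply/funext => u; rewrite mulrDl.
Qed.

Lemma wpol0 k : wpol k (fun _ _ => 0).
Proof. exact: wpol_hom (leqnn k) (whom0 k). Qed.

Lemma wpol_cst c : wpol 0 (fun _ _ => c).
Proof.
apply: (wpol_hom (j := 0)) => //.
have := whom_mono c 0 0 0; rewrite (_ : (fun z u => _) = (fun _ _ => c)) //.
by apply/funext => z; apply/funext => u; rewrite !expr0 !mulr1.
Qed.

Lemma wpolZ k c s : wpol k s -> wpol k (fun z u => c * s z u).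
Proof. by move=> H; rewrite -[k]add0n; apply: wpolM H; apply: wpol_cst. Qed.

Lemma wpol_z : wpol 1 (fun z _ => z).
Proof.
apply: (wpol_hom (j := 1)) => //.
have := whom_mono 1 1 0 0; rewrite (_ : (fun z u => _) = (fun z _ => z)) //.
by apply/funext => z; apply/funext => u; rewrite !expr0 !mulr1 mul1r.
Qed.
Lemma wpol_zb : wpol 1 (fun z _ => z^*%C).
Proof.
apply: (wpol_hom (j := 1)) => //.
have := whom_mono 1 0 1 0; rewrite (_ : (fun z u => _) = (fun z _ => z^*%C)) //.
by apply/funext => z; apply/funext => u; rewrite !expr0 !mulr1 mul1r.
Qed.
Lemma wpol_u : wpol 2 (fun _ u => u%:C%C).
Proof.
apply: (wpol_hom (j := 2)) => //.
have := whom_mono 1 0 0 1; rewrite (_ : (fun z u => _) = (fun _ u => u%:C%C)) //.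
by apply/funext => z; apply/funext => u; rewrite !expr0 !mulr1 mul1r.
Qed.

Lemma wpol_peel k s : wpol k s ->
  exists psi s', [/\ whom k psi, wpol k.+1 s' & forall z u, s z u = psi z u + s' z u].
Proof.
elim=> {s} [j psi kj H|s t _ [p [s' [Hp Hs Es]]] _ [p' [t' [Hp' Ht Et]]]].
  have [jk|jk] := eqVneq j k.
    exists psi, (fun _ _ => 0); split; [by rewrite -jk|exact: wpol0|].
    by move=> z u; rewrite addr0.
  exists (fun _ _ => 0), psi; split; first exact: whom0.
    by apply: wpol_hom H; rewrite ltn_neqAle eq_sym jk.
  by move=> z u; rewrite add0r.
exists (fun z u => p z u + p' z u), (fun z u => s' z u + t' z u); split.
- exact: whomD.
- exact: wpolD.
- by move=> z u; rewrite Es Et addrACA.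
Qed.

Lemma whom_scale k psi (t : R) z u : whom k psi ->
  psi (t%:C%C * z) (t ^+ 2 * u) = t%:C%C ^+ k * psi z u.
Proof.
elim=> {k psi} [k|c a b m|k p1 p2 _ -> _ ->]; last by rewrite mulrDr.
  by rewrite mulr0.
have -> : (t%:C%C * z)^*%C = t%:C%C * z^*%C by rewrite rmorphM /= oppr0.
have -> : (t ^+ 2 * u)%:C%C = t%:C%C ^+ 2 * u%:C%C by rewrite rmorphM rmorphXn.
by rewrite !exprMn mul2n -addnn !exprD; ring.
Qed.

End Homogeneous.

Section TaylorWeighted.
Variables (R : realType) (Omega : set 'rV[R]_4) (p : 'rV[R]_4).
Hypothesis openO : open Omega.

Lemma taylor_bigO K (f : 'rV[R]_4 -> R) : Omega p -> smooth_on Omega f ->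
  bigO (nbhs p) (fun q => `|q - p|) K (fun q => (f q)%:C%C - \sum_(d < K) (taylor_term p d f (q - p))%:C%C).
Proof.
move=> Op sf; have [C [r [C0 r0 H]]] := taylor openO K Op sf.
exists C; apply/near_normP; exists r => // x xr.
have [_] := H _ xr.
by rewrite [p + x - p]addrC addKr -rmorph_sum -rmorphB modulusR.
Qed.

Variables z w : 'rV[R]_4 -> R[i].
Hypothesis Hc : forall j, weighted z w 1 (fun q => ((q - p) 0 j)%:C%C).

Lemma taylor_weighted d (f : 'rV[R]_4 -> R) :
  weighted z w d (fun q => (taylor_term p d f (q - p))%:C%C).
Proof.
elim: d f => [|d IH] f; first exact: (weighted_cst z w (f p)%:C%C).
have H : weighted z w d.+1 (fun q => (d.+1%:R^-1)%:C%C *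
   \sum_(i < 4) ((q - p) 0 i)%:C%C * (taylor_term p d ('D_(delta_mx 0 i) f) (q - p))%:C%C).
  by apply: weightedZ; apply: weighted_sum => i _; rewrite -add1n; apply: weightedM (Hc i) (IH _).
apply: weighted_eq H => q /=.
rewrite [RHS]rmorphM /= mulrC rmorph_sum /=; congr (_ * _).
by apply: eq_bigr => i _; rewrite rmorphM.
Qed.

Lemma weighted_Re k f : weighted z w k f -> weighted z w k (fun q => (complex.Re (f q))%:C%C).
Proof.
move=> H; apply: weighted_eq (weightedZ (2^-1) (weightedD H (weighted_conj H))) => q.
by rewrite /=; case: (f q) => a b; apply: eqC => /=; field.
Qed.

Lemma weighted_Im k f : weighted z w k f -> weighted z w k (fun q => (complex.Im (f q))%:C%C).
Proof.
move=> H; apply: weighted_eq (weighted_Re (weightedZ (- 'i%C) H)) => q.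
by congr (_ %:C%C); case: (f q) => a b /=; ring.
Qed.

Lemma weighted_w : weighted z w 2 w.
Proof.
apply: weighted_eq (weightedD (weighted_u z w) (weightedZ 'i%C (weighted_v z w))) => q.
by rewrite /ucoord /vcoord; case: (w q) => a b; apply: eqC => /=; ring.
Qed.

End TaylorWeighted.

(** * Division by the defining function *)

Section Chart.
Variables (R : realType) (Omega : set 'rV[R]_4) (rho : 'rV[R]_4 -> R) (p : 'rV[R]_4).
Hypotheses (openO : open Omega) (srho : smooth_on Omega rho) (Op : Omega p).

Notation M := (zero_locus Omega rho).

(** For this gauge [z] has size 1 and [w] has size 2, as the equation
    [Im w = |z|^2] requires. *)
Definition gauge (z w : 'rV[R]_4 -> R[i]) (q : 'rV[R]_4) : R :=
  Num.sqrt (modulus (z q) ^+ 2 + modulus (w q)).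

(** Coordinates adapted to the hypersurface at [p]: its equation is
    [Im w = |z|^2] up to terms of weight 3.  The inverse map is affine in
    [Im w], which makes the intermediate value theorem applicable. *)
Record adapted_chart := AdaptedChart {
  ch_z : 'rV[R]_4 -> R[i];
  ch_w : 'rV[R]_4 -> R[i];
  ch_inv : R[i] -> R[i] -> 'rV[R]_4;
  ch_sign : R;
  ch_sign2 : ch_sign ^+ 2 = 1;
  ch_z_smooth : csmooth Omega ch_z;
  ch_w_smooth : csmooth Omega ch_w;
  ch_coord : forall j, weighted ch_z ch_w 1 (fun q => ((q - p) 0 j)%:C%C);
  ch_z_small : bigO (nbhs p) (fun q => `|q - p|) 1 ch_z;
  ch_w_small : bigO (nbhs p) (fun q => `|q - p|) 1 ch_w;
  ch_zK : forall a b, ch_z (ch_inv a b) = a;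
  ch_wK : forall a b, ch_w (ch_inv a b) = b;
  ch_inv_affine : forall a b, exists X Y : 'rV[R]_4,
     forall t : R, ch_inv a (b + 'i%C * t%:C%C) = X + t *: Y;
  ch_inv_small : exists C : R, forall a b, modulus a <= 1 ->
     `|ch_inv a b - p| <= C * (modulus a + modulus b);
  ch_eq : forall K, exists2 tau, weighted ch_z ch_w 3 tau &
     bigO (nbhs p) (fun q => `|q - p|) K (fun q => (rho q)%:C%C -
       ch_sign%:C%C * ((vcoord ch_w q)%:C%C - ch_z q * (ch_z q)^*%C) - tau q) }.

Variable ch : adapted_chart.
Notation z := (ch_z ch).
Notation w := (ch_w ch).
Notation u := (ucoord w).
Notation v := (vcoord w).
Notation eps := (ch_sign ch).
Notation del := (gauge z w).
Notation nrm := (fun q : 'rV[R]_4 => `|q - p|).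

Lemma gauge_ge0 q : 0 <= del q. Proof. exact: sqrtr_ge0. Qed.

Lemma gauge2 q : del q ^+ 2 = modulus (z q) ^+ 2 + modulus (w q).
Proof. by rewrite sqr_sqrtr // addr_ge0 ?modulus_ge0 // exprn_ge0 ?modulus_ge0. Qed.

Lemma z_le_gauge q : modulus (z q) <= del q.
Proof.
rewrite -(@ler_pXn2r _ 2) ?nnegrE ?modulus_ge0 ?gauge_ge0 // gauge2.
by rewrite lerDl modulus_ge0.
Qed.

Lemma w_le_gauge q : modulus (w q) <= del q ^+ 2.
Proof. by rewrite gauge2 lerDr exprn_ge0 ?modulus_ge0. Qed.

Lemma near_nrm01 : \forall q \near p, 0 <= nrm q <= 1.
Proof.
apply/near_normP; exists 1 => // x x1.
by rewrite [p + x - p]addrC addKr normr_ge0 ltW.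
Qed.

(* gauge^2 = O(|q - p|) *)
Lemma gauge2_small : exists2 C : R, 0 < C & \forall q \near p, del q ^+ 2 <= C * nrm q.
Proof.
have FF : Filter (nbhs p) by exact: nbhs_filter.
have [C C0 HC] := bigO_ge0 FF near_nrm01 (ch_z_small ch).
have [D D0 HD] := bigO_ge0 FF near_nrm01 (ch_w_small ch).
exists (C ^+ 2 + D + 1); first by rewrite ltr_wpDl // addr_ge0 // exprn_ge0.
near=> q; rewrite gauge2.
have Hz : modulus (z q) <= C * nrm q ^+ 1 by near: q.
have Hw : modulus (w q) <= D * nrm q ^+ 1 by near: q.
have /andP[n0 n1] : 0 <= nrm q <= 1 by near: q; apply: near_nrm01.
rewrite !expr1 in Hz Hw.
apply: (@le_trans _ _ ((C * nrm q) ^+ 2 + D * nrm q)).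
  by apply: lerD => //; rewrite lerXn2r ?nnegrE ?modulus_ge0 // mulr_ge0.
rewrite !mulrDl mul1r -addrA lerD // ?exprMn.
  by rewrite ler_wpM2l ?exprn_ge0 // expr2 ler_piMl.
by rewrite lerDl.
Unshelve. all: by end_near. Qed.

Lemma near_gauge01 : \forall q \near p, 0 <= del q <= 1.
Proof.
have [C C0 HC] := gauge2_small.
have H : \forall q \near p, nrm q < C^-1.
  apply/near_normP; exists C^-1; first by rewrite invr_gt0.
  by move=> x xC; rewrite [p + x - p]addrC addKr.
near=> q; rewrite gauge_ge0 /=.
have Hq : del q ^+ 2 <= C * nrm q by near: q.
have Hn : nrm q < C^-1 by near: q.
rewrite -(@ler_pXn2r _ 2) ?nnegrE ?gauge_ge0 // expr1n.
by apply: le_trans Hq _; rewrite mulrC -ler_pdivlMr // div1r ltW.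
Unshelve. all: by end_near. Qed.

Lemma bigO_gauge_z : bigO (nbhs p) del 1 z.
Proof. by exists 1; apply: nearW => q; rewrite mul1r expr1 z_le_gauge. Qed.

Lemma bigO_gauge_u : bigO (nbhs p) del 2 (fun q => (u q)%:C%C).
Proof.
exists 1; apply: nearW => q; rewrite mul1r modulusR.
by apply: le_trans (modulus_Re _) _; apply: w_le_gauge.
Qed.

Lemma bigO_gauge_v : bigO (nbhs p) del 2 (fun q => (v q)%:C%C).
Proof.
exists 1; apply: nearW => q; rewrite mul1r modulusR.
by apply: le_trans (modulus_Im _) _; apply: w_le_gauge.
Qed.

Let FF : Filter (nbhs p). Proof. exact: nbhs_filter. Qed.
Let g01 := near_gauge01.

Lemma weighted_bigO k f : weighted z w k f -> bigO (nbhs p) del k f.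
Proof.
elim => {k f}.
- by move=> c; apply: bigO_cst.
- exact: bigO_gauge_z.
- by apply: bigO_conj bigO_gauge_z.
- exact: bigO_gauge_u.
- exact: bigO_gauge_v.
- by move=> k f g _ Hf _ Hg; apply: bigOD.
- by move=> k l f g _ Hf _ Hg; apply: bigOM.
- by move=> k l f lk _ Hf; apply: bigO_le Hf.
Qed.

Lemma norm_le_sum (x : 'rV[R]_4) : `|x| <= \sum_j `|x 0 j|.
Proof.
have -> : `|x| = mx_norm x by [].
rewrite mx_normrE; apply: bigmax_le => [|[i j] _]; first exact: sumr_ge0.
by rewrite (bigD1 j) //= !ord1 lerDl sumr_ge0.
Qed.

Lemma nrm_gauge : exists2 C : R, 0 <= C & \forall q \near p, nrm q <= C * del q.
Proof.
have H j := bigO_ge0 FF g01 (weighted_bigO (ch_coord ch j)).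
have /choice[C HC] : forall j, exists C : R, 0 <= C /\ \forall q \near p,
   modulus ((q - p) 0 j)%:C%C <= C * del q ^+ 1.
  by move=> j; have [C C0 ?] := H j; exists C.
exists (\sum_j C j); first by apply: sumr_ge0 => j _; case: (HC j).
have HA : \forall q \near p, forall j, modulus ((q - p) 0 j)%:C%C <= C j * del q ^+ 1.
  apply: (@filter_forall _ 'I_4 (fun j q => modulus ((q - p) 0 j)%:C%C <= C j * del q ^+ 1) (nbhs p) FF) => j.
  by have [_] := HC j.
near=> q; apply: le_trans (norm_le_sum _) _; rewrite mulr_suml; apply: ler_sum => j _.
have /(_ j) : forall j, modulus ((q - p) 0 j)%:C%C <= C j * del q ^+ 1 by near: q.
by rewrite modulusR expr1.
Unshelve. all: by end_near. Qed.

Lemma bigO_nrm_gauge (F : set_system 'rV[R]_4) (Ff : Filter F) k f :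
  (forall A, nbhs p A -> F A) -> bigO F nrm k f -> bigO F del k f.
Proof.
move=> pF Hf.
have [C C0 HC] := bigO_ge0 Ff (pF _ near_nrm01) Hf.
have [D D0 /pF HD] := nrm_gauge.
exists (C * D ^+ k); near=> q.
have H1 : modulus (f q) <= C * nrm q ^+ k by near: q.
have H2 : nrm q <= D * del q by near: q.
apply: le_trans H1 _; rewrite -mulrA -exprMn ler_wpM2l // lerXn2r ?nnegrE //.
by rewrite mulr_ge0 ?gauge_ge0.
Unshelve. all: by end_near. Qed.

Lemma bigO_gauge_nrm (F : set_system 'rV[R]_4) (Ff : Filter F) k f :
  (forall A, nbhs p A -> F A) -> bigO F del k.*2 f -> bigO F nrm k f.
Proof.
move=> pF Hf.
have [C C0 HC] := bigO_ge0 Ff (pF _ g01) Hf.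
have [D D0 /pF HD] := gauge2_small.
exists (C * D ^+ k); near=> q.
have H1 : modulus (f q) <= C * del q ^+ k.*2 by near: q.
have H2 : del q ^+ 2 <= D * nrm q by near: q.
apply: le_trans H1 _; rewrite -mulrA -exprMn ler_wpM2l // -mul2n exprM lerXn2r ?nnegrE //.
- by rewrite exprn_ge0 ?gauge_ge0.
- by rewrite mulr_ge0 // ltW.
Unshelve. all: by end_near. Qed.

Lemma wpol_weighted k s : wpol k s -> weighted z w k (fun q => s (z q) (u q)).
Proof.
elim=> {s} [j psi kj H|s t _ Hs _ Ht]; last exact: weightedD.
apply: weighted_le kj _; elim: H => {j psi} [j|c a b m|j p1 p2 _ H1 _ H2].
- exact: weighted0.
- have X n (f : 'rV[R]_4 -> R[i]) e : weighted z w n f -> weighted z w (n * e) (fun q => f q ^+ e).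
    move=> Hf; elim: e => [|e IH].
      rewrite muln0; apply: weighted_eq (weighted_cst _ _ 1) => q; by rewrite expr0.
    rewrite mulnS; apply: weighted_eq (weightedM Hf IH) => q; by rewrite exprS.
  have := weightedM (weightedM (weightedZ c (X _ _ a (weighted_z z w)))
    (X _ _ b (weighted_zb z w))) (X _ _ m (weighted_u z w)).
  by rewrite !mul1n.
- exact: weightedD.
Qed.

Lemma weighted_smooth k f : weighted z w k f -> csmooth Omega f.
Proof.
elim => {k f}.
- by move=> c; apply: csmooth_cst.
- exact: ch_z_smooth.
- by apply: csmooth_conj => //; apply: ch_z_smooth.
- by have [h _] := ch_w_smooth ch; apply: csmooth_real.
- by have [_ h] := ch_w_smooth ch; apply: csmooth_real.
- by move=> k f g _ Hf _ Hg; apply: csmoothD.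
- by move=> k l f g _ Hf _ Hg; apply: csmoothM.
- by [].
Qed.

(** Along the hypersurface [Im w] is determined by [z] and [u], so polynomials in
    [z], its conjugate and [u] represent smooth functions modulo [rho]. *)
Definition divisible K n (f : 'rV[R]_4 -> R[i]) := exists h s,
  [/\ csmooth Omega h, wpol n s &
      bigO (nbhs p) del K (fun q => f q - h q * (rho q)%:C%C - s (z q) (u q))].

Lemma divisible_wpol K n s : wpol n s -> divisible K n (fun q => s (z q) (u q)).
Proof.
move=> Hs; exists (fun=> 0), s; split => //; first exact: csmooth_cst.
by apply: bigO_eq (bigO0 FF _ K) => q; rewrite mul0r subr0 subrr.
Qed.

Lemma divisibleD K n f g : divisible K n f -> divisible K n g ->
  divisible K n (fun q => f q + g q).
Proof.
move=> [h [s [sh ws Hs]]] [h' [s' [sh' ws' Hs']]].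
exists (fun q => h q + h' q), (fun z u => s z u + s' z u); split.
- exact: csmoothD.
- exact: wpolD.
- by apply: bigO_eq (bigOD FF Hs Hs') => q; ring.
Qed.

Lemma divisibleM K k l f g : weighted z w l g ->
  divisible (K + k) k f -> divisible (K + l) l g ->
  divisible (K + (k + l)) (k + l) (fun q => f q * g q).
Proof.
move=> wg [h [s [sh ws Hs]]] [h' [s' [sh' ws' Hs']]].
have wz := wpol_weighted ws.
exists (fun q => h q * g q + s (z q) (u q) * h' q), (fun z u => s z u * s' z u); split.
- apply: csmoothD => //; apply: csmoothM => //; first exact: weighted_smooth wg.
  exact: weighted_smooth wz.
- exact: wpolM.
have A := bigOM FF Hs (weighted_bigO wg).
have B := bigOM FF (weighted_bigO wz) Hs'.
rewrite -addnA in A; rewrite addnCA in B.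
by apply: bigO_eq (bigOD FF A B) => q; ring.
Qed.

Lemma divisible_le K k l f : (l <= k)%N -> divisible (K + k) k f -> divisible (K + l) l f.
Proof.
move=> lk [h [s [sh ws Hs]]]; exists h, s; split => //; first exact: wpol_le ws.
by apply: bigO_le Hs => //; rewrite leq_add2l.
Qed.

Lemma weighted_divisible K : divisible (K + 2) 2 (fun q => (v q)%:C%C) ->
  forall n f, weighted z w n f -> divisible (K + n) n f.
Proof.
move=> Hv n f; elim => {n f}.
- by move=> c; apply: divisible_wpol; apply: wpol_cst.
- exact: divisible_wpol (wpol_z R).
- exact: divisible_wpol (wpol_zb R).
- exact: divisible_wpol (wpol_u R).
- exact: Hv.
- by move=> k f g _ Hf _ Hg; apply: divisibleD.
- by move=> k l f g _ Hf wg Hg; apply: divisibleM.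
- by move=> k l f lk _; apply: divisible_le.
Qed.

(** Solving the equation of the hypersurface for [Im w] by iteration: the
    remainder in [ch_eq] has weight 3, so each substitution gains one order. *)
Lemma vcoord_divisible K : divisible (K + 2) 2 (fun q => (v q)%:C%C).
Proof.
elim: K => [|K IH].
  exists (fun=> 0), (fun _ _ => 0); split; [exact: csmooth_cst|exact: wpol0|].
  by apply: bigO_eq bigO_gauge_v => q; rewrite mul0r !subr0.
have [tau wtau Htau'] := ch_eq ch (K + 3).
have Htau := bigO_nrm_gauge FF (fun A H => H) Htau'.
have [h [s [sh ws Hs]]] := weighted_divisible IH wtau.
exists (fun q => eps%:C%C - eps%:C%C * h q),
  (fun z u => z * z^*%C + (- eps%:C%C) * s z u); split.
- apply: csmoothD => //; first exact: csmooth_cst.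
  by apply: csmoothN => //; apply: csmoothM => //; apply: csmooth_cst.
- apply: wpolD; first exact: wpolM (wpol_z R) (wpol_zb R).
  by apply: wpolZ; apply: wpol_le ws.
rewrite addSnnS.
apply: bigO_eq (bigOZ FF (- eps%:C%C) (bigOD FF Htau Hs)) => q /=.
have e2 : eps%:C%C * eps%:C%C = 1 :> R[i] by rewrite -rmorphM -expr2 ch_sign2.
set E := eps%:C%C in e2 *; set r := (rho q)%:C%C.
apply/eqP; rewrite -subr_eq0; apply/eqP.
transitivity ((E * E - 1) * ((v q)%:C%C - z q * (z q)^*%C)); first by ring.
by rewrite e2 subrr mul0r.
Qed.

Lemma smooth_divisible K f : csmooth Omega f -> divisible K 0 f.
Proof.
move=> [f1 f2].
pose P q := \sum_(d < K) (taylor_term p d (fun q => complex.Re (f q)) (q - p))%:C%C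
  + 'i%C * \sum_(d < K) (taylor_term p d (fun q => complex.Im (f q)) (q - p))%:C%C.
have wP : weighted z w 0 P.
  have H g : weighted z w 0 (fun q => \sum_(d < K) (taylor_term p d g (q - p))%:C%C).
    by apply: weighted_sum => d _; apply: weighted_le (leq0n d) (taylor_weighted (ch_coord ch) d g).
  by apply: weightedD => //; apply: weightedZ.
have [h [s [sh ws Hs]]] := weighted_divisible (vcoord_divisible K) wP.
rewrite addn0 in Hs; exists h, s; split => //.
have A := bigO_nrm_gauge FF (fun A H => H) (taylor_bigO openO K Op f1).
have B := bigO_nrm_gauge FF (fun A H => H) (taylor_bigO openO K Op f2).
apply: bigO_eq (bigOD FF (bigOD FF A (bigOZ FF 'i%C B)) Hs) => q.
have E : f q = (complex.Re (f q))%:C%C + 'i%C * (complex.Im (f q))%:C%C.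
  by case: (f q) => a b /=; simpc.
by rewrite [X in _ = X - _ - _]E /P; ring.
Qed.

(** * Points of the hypersurface *)

(** Above [(t z0, t^2 u0)] the function [rho] changes sign between
    [Im w = - K t^2] and [Im w = K t^2], so the intermediate value theorem gives
    a point of the hypersurface. *)
Lemma zero_locus_points (z0 : R[i]) (u0 : R) : exists D t0 : R,
  [/\ 0 <= D, 0 < t0 & forall e, 0 < e -> exists2 t1 : R, 0 < t1 & forall t, 0 < t < t1 ->
    exists q, [/\ M q, nrm q < e, z q = t%:C%C * z0, u q = t ^+ 2 * u0 & del q <= D * t]].
Proof.
have [tau wtau Htau'] := ch_eq ch 3.
have Htau := bigO_nrm_gauge FF (fun A H => H) Htau'.
have HB := bigOD FF Htau (weighted_bigO wtau).
have [C C0 HC] := bigO_ge0 FF g01 HB.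
(* on the hypersurface Im w is close to t^2 |z0|^2, so that |Im w| <= K0 t^2
   leaves room for a change of sign *)
pose K0 := modulus z0 ^+ 2 + 1.
have K00 : 0 < K0 by rewrite ltr_wpDl ?exprn_ge0 ?modulus_ge0.
pose D2 := modulus z0 ^+ 2 + `|u0| + K0.
have D20 : 0 <= D2 by rewrite !addr_ge0 ?exprn_ge0 ?modulus_ge0 // ltW.
pose D := Num.sqrt D2.
have D0 : 0 <= D by exact: sqrtr_ge0.
have DD : D ^+ 2 = D2 by rewrite sqr_sqrtr.
exists D, 1; split => // e e0.
have [B HBq] := ch_inv_small ch.
have HO := near_Omega openO Op.
have [r r0 Hr] := (near_normP p _).1 (filterI HO HC).
pose A := `|B| * (modulus z0 + `|u0| + K0) + 1.
have A0 : 0 < A.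
  have k0 := ltW K00; rewrite ltr_wpDl // mulr_ge0 //.
  by apply: addr_ge0 => //; apply: addr_ge0 => //; apply: modulus_ge0.
pose t1 := Num.min (Num.min 1 (modulus z0 + 1)^-1) (Num.min (Num.min e r / A) (C * D ^+ 3 + 1)^-1).
have CD0 : 0 < C * D ^+ 3 + 1 by rewrite ltr_wpDl // mulr_ge0 // exprn_ge0.
have z1 : 0 < modulus z0 + 1 by rewrite ltr_wpDl ?modulus_ge0.
exists t1; first by rewrite !lt_min ltr01 !invr_gt0 z1 CD0 divr_gt0 // lt_min e0 r0.
move=> t /andP[t0]; rewrite !lt_min => /andP[/andP[t_1 tz] /andP[tA tC]].
pose Q (s : R) := ch_inv ch (t%:C%C * z0) ((t ^+ 2 * u0)%:C%C + 'i%C * s%:C%C).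
have zQ s : z (Q s) = t%:C%C * z0 by exact: ch_zK.
have wQ s : w (Q s) = (t ^+ 2 * u0)%:C%C + 'i%C * s%:C%C by exact: ch_wK.
have uQ s : u (Q s) = t ^+ 2 * u0 by rewrite /ucoord wQ /=; ring.
have vQ s : v (Q s) = s by rewrite /vcoord wQ /=; ring.
have sb s : - (K0 * t ^+ 2) <= s <= K0 * t ^+ 2 -> `|s| <= K0 * t ^+ 2 by rewrite ler_norml.
have mw s : `|s| <= K0 * t ^+ 2 -> modulus (w (Q s)) <= t ^+ 2 * (`|u0| + K0).
  move=> Hs; rewrite wQ; apply: le_trans (modulusD _ _) _.
  rewrite modulusM !modulusR {1}/modulus /= expr0n expr1n add0r sqrtr1 mul1r.
  by rewrite normrM ger0_norm ?sqr_ge0 // mulrDr lerD // [leRHS]mulrC.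
have mz s : modulus (z (Q s)) = t * modulus z0.
  by rewrite zQ modulusM modulusR gtr0_norm.
have dQ s : `|s| <= K0 * t ^+ 2 -> del (Q s) <= D * t.
  move=> Hs; rewrite -(@ler_pXn2r _ 2) ?nnegrE ?gauge_ge0 ?mulr_ge0 ?(ltW t0) //.
  rewrite gauge2 mz !exprMn DD /D2 -addrA mulrDl [t ^+ 2 * _]mulrC lerD2l.
  by rewrite [leRHS]mulrC; apply: mw.
have nQ s : `|s| <= K0 * t ^+ 2 -> nrm (Q s) < Num.min e r.
  move=> Hs.
  have zs : modulus (t%:C%C * z0) <= 1.
    rewrite -(zQ s) mz; apply: le_trans (_ : t * (modulus z0 + 1) <= 1).
      by rewrite ler_wpM2l ?(ltW t0) // lerDl.
    by rewrite -ler_pdivlMr // div1r ltW.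
  apply: le_lt_trans (HBq _ _ zs) _.
  rewrite -(wQ s) -(zQ s) mz.
  have w1 : modulus (w (Q s)) <= t * (`|u0| + K0).
    apply: le_trans (mw _ Hs) _; rewrite ler_wpM2r //; first exact: addr_ge0 (normr_ge0 _) (ltW K00).
    by rewrite expr2 ler_piMl ?(ltW t0) // ltW.
  apply: (@le_lt_trans _ _ (`|B| * (t * (modulus z0 + `|u0| + K0)))).
    apply: le_trans (ler_wpM2r _ (ler_norm B)) _.
      by rewrite addr_ge0 ?modulus_ge0 // mulr_ge0 ?modulus_ge0 // ltW.
    by rewrite ler_wpM2l // -addrA [leRHS]mulrDr lerD2l.
  apply: (@lt_le_trans _ _ (t * A)).
    by rewrite mulrCA /A ltr_pM2l // ltrDl.
  by rewrite -ler_pdivlMr // ltW.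
have OQ s : `|s| <= K0 * t ^+ 2 -> Omega (Q s) /\
    `|rho (Q s) - eps * (s - t ^+ 2 * modulus z0 ^+ 2)| <= C * (D * t) ^+ 3.
  move=> Hs; have := nQ _ Hs; rewrite lt_min => /andP[_ nr].
  have [] := Hr _ nr; rewrite subrKC => OQs HQ; split => //.
  move: HQ; rewrite subrK vQ mul_conjc_modulus mz exprMn => HQ.
  rewrite -modulusR; apply: le_trans (_ : C * del (Q s) ^+ 3 <= _); last first.
    by rewrite ler_wpM2l // lerXn2r ?nnegrE ?gauge_ge0 ?mulr_ge0 ?(ltW t0) // dQ.
  apply: le_trans HQ; rewrite le_eqVlt; apply/orP; left; apply/eqP; congr modulus.
  by rewrite -rmorphB -rmorphM -rmorphB.
pose f (s : R) := eps * rho (Q s).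
have e1 : `|eps| = 1.
  by apply/eqP; rewrite -(@eqrXn2 _ 2) // expr1n real_normK ?num_real // ch_sign2.
have fE s : `|s| <= K0 * t ^+ 2 -> `|f s - (s - t ^+ 2 * modulus z0 ^+ 2)| <= C * (D * t) ^+ 3.
  move=> Hs; have [_] := OQ _ Hs; apply: le_trans.
  set Y := s - _; have -> : f s - Y = eps * (rho (Q s) - eps * Y).
    by rewrite mulrBr mulrA -expr2 ch_sign2 mul1r.
  by rewrite normrM e1 mul1r.
have small : C * (D * t) ^+ 3 < t ^+ 2.
  have -> : C * (D * t) ^+ 3 = t ^+ 2 * (t * (C * D ^+ 3)) by ring.
  rewrite gtr_pMr ?exprn_gt0 //.
  apply: (@lt_le_trans _ _ (t * (C * D ^+ 3 + 1))); first by rewrite ltr_pM2l // ltrDl.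
  by rewrite -ler_pdivlMr // div1r ltW.
have K0t : 0 < K0 * t ^+ 2 by rewrite mulr_gt0 // exprn_gt0.
have n1 : `|K0 * t ^+ 2| <= K0 * t ^+ 2 by rewrite gtr0_norm.
have n2 : `|- (K0 * t ^+ 2)| <= K0 * t ^+ 2 by rewrite normrN gtr0_norm.
have f1 : 0 <= f (K0 * t ^+ 2).
  have := fE _ n1; rewrite ler_norml => /andP[+ _].
  have -> : K0 * t ^+ 2 - t ^+ 2 * modulus z0 ^+ 2 = t ^+ 2 by rewrite /K0; ring.
  by lra.
have f2 : f (- (K0 * t ^+ 2)) <= 0.
  have := fE _ n2; rewrite ler_norml => /andP[_].
  have : 0 <= t ^+ 2 * modulus z0 ^+ 2 by rewrite mulr_ge0 ?sqr_ge0.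
  have : K0 * t ^+ 2 >= t ^+ 2.
    by rewrite ler_peMl ?sqr_ge0 // /K0 lerDr sqr_ge0.
  by lra.
have cf : {within `[- (K0 * t ^+ 2), K0 * t ^+ 2], continuous f}.
  apply: continuous_in_subspaceT => s; rewrite inE /= in_itv /= => /sb Hs.
  have [X [Y XY]] := ch_inv_affine ch (t%:C%C * z0) (t ^+ 2 * u0)%:C%C.
  have [OQs _] := OQ _ Hs.
  apply: continuousM; first exact: cst_continuous.
  have -> : (fun s => rho (Q s)) = rho \o (fun s => X + s *: Y).
    by apply/funext => s' /=; rewrite /Q XY.
  apply: continuous_comp.
    apply: continuousD; first exact: cst_continuous.
    by apply: continuousZl; apply: cvg_id.
  by rewrite -XY; apply: smooth_continuous srho _.
have ab : - (K0 * t ^+ 2) <= K0 * t ^+ 2 by rewrite ge0_cp ?ltW.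
have [|s /[!in_itv]/= /sb Hs fs] := IVT (v := 0) ab cf.
  by rewrite ge_min f2 /= le_max f1 orbT.
exists (Q s); split => //.
- split; first by have [] := OQ _ Hs.
  by move/eqP: fs; rewrite mulf_eq0 => /orP[/eqP e0'|/eqP//]; move: e1; rewrite e0' normr0 => /eqP; rewrite eq_sym oner_eq0.
- by have := nQ _ Hs; rewrite lt_min => /andP[].
- exact: dQ.
Qed.

Notation FM := (within M (nbhs p)).
Let FMF : Filter FM. Proof. exact: within_filter. Qed.

Lemma bigO_within k f : bigO (nbhs p) del k f -> bigO FM del k f.
Proof. by move=> [C HC]; exists C; apply: cvg_within. Qed.

(** A homogeneous polynomial of weight [k] that is of larger order along the
    hypersurface vanishes: [(z, u)] takes all values there. *)
Lemma whom_eq0 k psi : whom k psi -> bigO FM del k.+1 (fun q => psi (z q) (u q)) ->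
  forall z0 u0, psi z0 u0 = 0.
Proof.
move=> Hp HO z0 u0; apply: modulus_eq0.
have W01 : \forall q \near FM, 0 <= del q <= 1 by apply: cvg_within; apply: g01.
have [C C0 HC] := bigO_ge0 FMF W01 HO.
have [D [t0 [D0 _ HD]]] := zero_locus_points z0 u0.
have [r r0 Hr] := (near_normP p _).1 HC.
have [t1 t10 Ht] := HD _ r0.
apply/le_anti; rewrite modulus_ge0 andbT; apply/ler_addgt0Pl => e e0; rewrite addr0.
pose K := C * D ^+ k.+1 + 1.
have K0 : 0 < K by rewrite ltr_wpDl // mulr_ge0 // exprn_ge0.
pose t := Num.min t1 (e / K) / 2.
have m0 : 0 < Num.min t1 (e / K) by rewrite lt_min t10 divr_gt0.
have t0' : 0 < t by rewrite divr_gt0.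
have : t < Num.min t1 (e / K) by rewrite /t ltr_pdivrMr // mulr_natr mulr2n ltrDl.
rewrite lt_min => /andP[tt1 te].
have [|q [Mq nq zq uq dq]] := Ht t; first by rewrite t0' tt1.
have := Hr _ nq; rewrite subrKC => /(_ Mq).
rewrite zq uq (whom_scale t z0 u0 Hp) modulusM modulusX modulusR gtr0_norm // => H.
have : t ^+ k * modulus (psi z0 u0) <= t ^+ k * (t * (C * D ^+ k.+1)).
  apply: le_trans H _.
  have powE (a b c : R) n : a ^+ n * (a * (b * c ^+ n.+1)) = b * (c * a) ^+ n.+1.
    by rewrite exprMn !exprS; ring.
  rewrite powE.
  by rewrite ler_wpM2l // lerXn2r ?nnegrE ?gauge_ge0 ?mulr_ge0 // ltW.
rewrite ler_pM2l ?exprn_gt0 // => /le_trans; apply.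
apply: (@le_trans _ _ (t * K)); first by rewrite ler_pM2l // lerDl.
by rewrite -ler_pdivlMr // ltW.
Qed.

(** The homogeneous parts of weight less than [k] vanish one after the other. *)
Lemma wpol_order k s : wpol 0 s -> bigO FM del k (fun q => s (z q) (u q)) -> wpol k s.
Proof.
move=> s0 HO; have W01 : \forall q \near FM, 0 <= del q <= 1 by apply: cvg_within; apply: g01.
suff H j : (j <= k)%N -> wpol j s by exact: H.
elim: j => [//|j IH] jk.
have [psi [s' [Hp Hs' E]]] := wpol_peel (IH (ltnW jk)).
have psi0 : forall z0 u0, psi z0 u0 = 0.
  apply: (whom_eq0 Hp).
  have A := bigO_le FMF W01 jk HO.
  have B := bigO_within (weighted_bigO (wpol_weighted Hs')).
  by apply: bigO_eq (bigOB FMF A B) => q; rewrite E addrK.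
have -> : s = s'; last by [].
by apply/funext => a; apply/funext => b; rewrite E psi0 add0r.
Qed.

End Chart.

(** * The Hessian and the Levi form *)

Section VectorCoordinates.
Variable R : realType.

Definition cvec (a b : R[i]) : 'rV[R]_4 :=
  \row_j [:: complex.Re a; complex.Im a; complex.Re b; complex.Im b]`_j.

Lemma zcoord_cvec a b : zcoord (cvec a b) = a.
Proof. by case: a => x y; rewrite /zcoord !mxE. Qed.

Lemma wcoord_cvec a b : wcoord (cvec a b) = b.
Proof. by case: b => x y; rewrite /wcoord !mxE. Qed.

Lemma cvec_coord x : cvec (zcoord x) (wcoord x) = x.
Proof.
apply/rowP => -[[|[|[|[|//]]]] ?]; rewrite mxE /=; congr (x _ _); exact: val_inj.
Qed.

Lemma cvecD a b c d : cvec (a + c) (b + d) = cvec a b + cvec c d.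
Proof. by apply/rowP => -[[|[|[|[|//]]]] ?]; rewrite !mxE /= ?ReD ?ImD. Qed.

Lemma cvecZ (t : R) a b : cvec (t%:C%C * a) (t%:C%C * b) = t *: cvec a b.
Proof.
by apply/rowP => -[[|[|[|[|//]]]] ?]; rewrite !mxE /= ?ReM ?ImM /=; ring.
Qed.

Lemma norm_cvec a b : `|cvec a b| <= (modulus a + modulus b) *+ 2.
Proof.
have -> : `|cvec a b| = mx_norm (cvec a b) by [].
rewrite mx_normrE; apply: bigmax_le => [|[i j] _].
  by rewrite mulrn_wge0 // addr_ge0 ?modulus_ge0.
have h1 := modulus_Re a; have h2 := modulus_Im a; have h3 := modulus_Re b; have h4 := modulus_Im b.
have h5 := modulus_ge0 a; have h6 := modulus_ge0 b.
case: j => [[|[|[|[|//]]]] ?]; rewrite mxE /=; lra.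
Qed.

Lemma modulus_zcoord (x : 'rV[R]_4) : modulus (zcoord x) <= `|x| *+ 2.
Proof.
apply: le_trans (modulus_le_ReIm _) _; rewrite mulr2n.
by apply: lerD; apply: coord_le_norm.
Qed.

Lemma modulus_wcoord (x : 'rV[R]_4) : modulus (wcoord x) <= `|x| *+ 2.
Proof.
apply: le_trans (modulus_le_ReIm _) _; rewrite mulr2n.
by apply: lerD; apply: coord_le_norm.
Qed.

End VectorCoordinates.

Section HessianAlgebra.
Variable R : realType.

Lemma hermitian_part (h : 'I_4 -> 'I_4 -> R) (a b : R[i]) :
  (forall i j, h i j = h j i) ->
  let Q (x : 'rV[R]_4) := \sum_(i < 4) x 0 i * \sum_(j < 4) x 0 j * h i j in
  let s := - 'i%C : R[i] in let t := 'i%C : R[i] in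
  let H i j i' j' := ((h i i')%:C%C + s * (h j i')%:C%C + t * ((h i j')%:C%C + s * (h j j')%:C%C)) / 2 / 2 in
  H 0 1 0 1 * a * a^*%C + H 0 1 2 3 * a * b^*%C + H 2 3 0 1 * b * a^*%C + H 2 3 2 3 * b * b^*%C =
  ((Q (cvec a b) + Q (cvec ('i%C * a) ('i%C * b))) / 4)%:C%C.
Proof.
move=> sym Q s t H.
have l1 : lift ord0 (ord0 : 'I_3) = 1 :> 'I_4 by exact: val_inj.
have l2 : lift ord0 (lift ord0 (ord0 : 'I_2)) = 2 :> 'I_4 by exact: val_inj.
have l3 : lift ord0 (lift ord0 (lift ord0 (ord0 : 'I_1))) = 3 :> 'I_4 by exact: val_inj.
have E x : Q x = \sum_(i <- [:: 0; 1; 2; 3]) x 0 i * \sum_(j <- [:: 0; 1; 2; 3]) x 0 j * h i j.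
  by rewrite /Q !big_ord_recl !big_ord0 l3 l2 l1 !big_cons !big_nil.
rewrite !E !big_cons !big_nil !mxE /= /H /s /t.
rewrite (sym 1 0) (sym 2 0) (sym 3 0) (sym 2 1) (sym 3 1) (sym 3 2).
have -> : 2 = (2 : R)%:C%C :> R[i] by rewrite rmorph_nat.
rewrite -!fmorphV.
move: (h 0 0) (h 0 1) (h 0 2) (h 0 3) (h 1 1) (h 1 2) (h 1 3) (h 2 2) (h 2 3) (h 3 3).
case: a => a1 a2; case: b => b1 b2 h00 h01 h02 h03 h11 h12 h13 h22 h23 h33.
by apply: eqC; rewrite /=; field.
Qed.

End HessianAlgebra.

Section ChartExistence.
Variables (R : realType) (Omega : set 'rV[R]_4) (rho : 'rV[R]_4 -> R) (p : 'rV[R]_4).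
Hypotheses (openO : open Omega) (srho : smooth_on Omega rho) (Op : Omega p).

Notation partial i f := ('D_(delta_mx 0 i) f).
Notation r := (cplx_fun rho).

(** The Hessian as a bilinear form, so that the second order term of the Taylor
    expansion is half of its diagonal. *)
Definition hess (x y : 'rV[R]_4) : R :=
  \sum_(i < 4) x 0 i * \sum_(j < 4) y 0 j * partial j (partial i rho) p.

Lemma taylor_term2 x : taylor_term p 2 rho x = hess x x / 2.
Proof.
rewrite /= /hess; congr (_ / _); apply: eq_bigr => i _; by rewrite divr1.
Qed.

Lemma hessDl x y x' : hess (x + x') y = hess x y + hess x' y.
Proof. by rewrite /hess -big_split /=; apply: eq_bigr => i _; rewrite mxE mulrDl. Qed.

Lemma hessDr x y y' : hess x (y + y') = hess x y + hess x y'.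
Proof.
rewrite /hess -big_split /=; apply: eq_bigr => i _.
under eq_bigr => j _ do rewrite mxE mulrDl.
by rewrite big_split mulrDr.
Qed.

Lemma hessZl t x y : hess (t *: x) y = t * hess x y.
Proof. by rewrite /hess mulr_sumr; apply: eq_bigr => i _; rewrite mxE mulrA. Qed.

Lemma hessZr t x y : hess x (t *: y) = t * hess x y.
Proof.
rewrite /hess mulr_sumr; apply: eq_bigr => i _.
under eq_bigr => j _ do rewrite mxE -mulrA.
by rewrite -mulr_sumr mulrCA.
Qed.

Definition sm_real f (sf : smooth_on Omega f) := mksm openO (csmooth_real openO sf).

Lemma sm_pd_real i f (sf : smooth_on Omega f) :
  sm_pd i (sm_real sf) = sm_real (smooth_derive i sf).
Proof.
apply: smP => q Oq; rewrite !mksmE //.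
rewrite (@pderiv_eq _ _ openO i _ (cplx_fun f) q Oq); last by move=> x Ox; rewrite mksmE.
by rewrite /pderiv /cplx_fun /= derive_cst.
Qed.

Lemma sm_real_partial i j : (sm_pd j (sm_pd i (sm_real srho))) p =
  (partial j (partial i rho) p)%:C%C.
Proof. by rewrite !sm_pd_real mksmE. Qed.

Lemma dz_rho : d_z r p = (partial 0 rho p +i* - partial 1 rho p)%C / 2.
Proof.
rewrite /d_z /pderiv /cplx_fun /= !derive_cst; congr (_ / _).
by apply: eqC => /=; ring.
Qed.

Lemma dw_rho : d_w r p = (partial 2 rho p +i* - partial 3 rho p)%C / 2.
Proof.
rewrite /d_w /pderiv /cplx_fun /= !derive_cst; congr (_ / _).
by apply: eqC => /=; ring.
Qed.

Lemma sm_wirtE i j s (a : smooth_fun openO) q : Omega q ->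
  sm_wirt i j s a q = (sm_pd i a q + s * sm_pd j a q) / 2.
Proof. by move=> Oq; rewrite /sm_wirt smM // smD // smM // !sm_cstE. Qed.

Lemma sm_pd_wirt k i j s (a : smooth_fun openO) :
  sm_pd k (sm_wirt i j s a) =
  (sm_pd k (sm_pd i a) + sm_cst openO s * sm_pd k (sm_pd j a))
   * sm_cst openO (2^-1).
Proof.
rewrite /sm_wirt sm_pdM sm_pd_cst mulr0 addr0 sm_pdD sm_pdM sm_pd_cst mul0r add0r.
by [].
Qed.

Lemma sm_eval_wirt (a b c d : smooth_fun openO) q : Omega q ->
  ((a + c * b) * d) q = (a q + c q * b q) * d q.
Proof. by move=> Oq; rewrite smM // smD // smM. Qed.

Lemma wirt2 i j i' j' s t :
  sm_wirt i' j' t (sm_wirt i j s (sm_real srho)) p =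
  ((partial i' (partial i rho) p)%:C%C + s * (partial i' (partial j rho) p)%:C%C
   + t * ((partial j' (partial i rho) p)%:C%C + s * (partial j' (partial j rho) p)%:C%C)) / 2 / 2.
Proof.
have H k : sm_pd k (sm_wirt i j s (sm_real srho)) p =
    ((partial k (partial i rho) p)%:C%C + s * (partial k (partial j rho) p)%:C%C) / 2.
  refine (etrans (congr1 (fun a : smooth_fun openO => smval a p) (sm_pd_wirt k i j s (sm_real srho))) _).
  refine (etrans (sm_eval_wirt _ _ _ _ Op) _).
  congr ((_ + _ * _) * _).
  - exact: sm_real_partial.
  - exact: sm_cstE Op.
  - exact: sm_real_partial.
  - exact: sm_cstE Op.
refine (etrans (sm_wirtE i' j' t (sm_wirt i j s (sm_real srho)) Op) _).
refine (etrans (congr2 (fun x y => (x + t * y) / 2) (H i') (H j')) _).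
have aux (a b c d s' t' : R[i]) : ((a + s' * b) / 2 + t' * ((c + s' * d) / 2)) / 2 = (a + s' * b + t' * (c + s' * d)) / 2 / 2 by ring.
exact: aux.
Qed.

Lemma d_z_eq f (a : smooth_fun openO) q : (forall x, Omega x -> f x = a x) ->
  Omega q -> d_z f q = dz a q.
Proof.
move=> E Oq; refine (etrans _ (esym (dzE a Oq))); rewrite /d_z.
by rewrite (pderiv_eq openO 0 Oq E) (pderiv_eq openO 1 Oq E).
Qed.

Lemma d_zbar_eq f (a : smooth_fun openO) q : (forall x, Omega x -> f x = a x) ->
  Omega q -> d_zbar f q = dzb a q.
Proof.
move=> E Oq; refine (etrans _ (esym (dzbE a Oq))); rewrite /d_zbar.
by rewrite (pderiv_eq openO 0 Oq E) (pderiv_eq openO 1 Oq E).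
Qed.

Lemma d_w_eq f (a : smooth_fun openO) q : (forall x, Omega x -> f x = a x) ->
  Omega q -> d_w f q = dw a q.
Proof.
move=> E Oq; refine (etrans _ (esym (dwE a Oq))); rewrite /d_w.
by rewrite (pderiv_eq openO 2 Oq E) (pderiv_eq openO 3 Oq E).
Qed.

Lemma d_wbar_eq f (a : smooth_fun openO) q : (forall x, Omega x -> f x = a x) ->
  Omega q -> d_wbar f q = dwb a q.
Proof.
move=> E Oq; refine (etrans _ (esym (dwbE a Oq))); rewrite /d_wbar.
by rewrite (pderiv_eq openO 2 Oq E) (pderiv_eq openO 3 Oq E).
Qed.

(** The Levi form along a vector is the Hermitian part of the Hessian, that is
    its average over the multiplication of the vector by [i]. *)
Lemma levi_form_hess a b : levi_form rho p a b a b =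
  ((hess (cvec a b) (cvec a b) + hess (cvec ('i%C * a) ('i%C * b)) (cvec ('i%C * a) ('i%C * b)))
    / 4)%:C%C.
Proof.
have sr q : Omega q -> r q = sm_real srho q by move=> Oq; rewrite mksmE.
have E1 q : Omega q -> d_z r q = dz (sm_real srho) q by exact: d_z_eq.
have E2 q : Omega q -> d_w r q = dw (sm_real srho) q by exact: d_w_eq.
have G1 := etrans (d_zbar_eq E1 Op) (wirt2 0 1 0 1 (- 'i%C) 'i%C).
have G2 := etrans (d_wbar_eq E1 Op) (wirt2 0 1 2 3 (- 'i%C) 'i%C).
have G3 := etrans (d_zbar_eq E2 Op) (wirt2 2 3 0 1 (- 'i%C) 'i%C).
have G4 := etrans (d_wbar_eq E2 Op) (wirt2 2 3 2 3 (- 'i%C) 'i%C).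
have sym i j : partial j (partial i rho) p = partial i (partial j rho) p.
  exact: (mixed_partials openO i j Op srho).
have cg (x1 x2 x3 x4 y1 y2 y3 y4 : R[i]) : x1 = y1 -> x2 = y2 -> x3 = y3 -> x4 = y4 ->
    x1 * a * a^*%C + x2 * a * b^*%C + x3 * b * a^*%C + x4 * b * b^*%C =
    y1 * a * a^*%C + y2 * a * b^*%C + y3 * b * a^*%C + y4 * b * b^*%C.
  by move=> -> -> -> ->.
refine (etrans (cg _ _ _ _ _ _ _ _ G1 G2 G3 G4) _).
exact: (@hermitian_part R (fun i j => partial j (partial i rho) p) a b (fun i j => sym i j)).
Qed.

End ChartExistence.

(** * Construction of adapted coordinates *)

Section ChartConstruction.
Variables (R : realType) (Omega : set 'rV[R]_4) (rho : 'rV[R]_4 -> R) (p : 'rV[R]_4).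
Hypotheses (openO : open Omega) (srho : smooth_on Omega rho) (Op : Omega p).
Hypothesis rho0 : rho p = 0.

Notation partial i f := ('D_(delta_mx 0 i) f).
Notation r := (cplx_fun rho).
Notation hessp := (hess rho p).
Notation A := (d_z r p).
Notation B := (d_w r p).

Variables (L1 L2 M1 M2 a1 a2 : R[i]) (eps : R).
Hypotheses (aL : a1 * L1 + a2 * L2 = 1) (AL : A * L1 + B * L2 = 0)
  (aM : a1 * M1 + a2 * M2 = 0) (AM : A * M1 + B * M2 = 1)
  (I11 : L1 * a1 + M1 * A = 1) (I12 : L1 * a2 + M1 * B = 0)
  (I21 : L2 * a1 + M2 * A = 0) (I22 : L2 * a2 + M2 * B = 1).
Let X := cvec L1 L2.
Let Y := cvec ('i%C * L1) ('i%C * L2).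
Hypotheses (eps2 : eps ^+ 2 = 1) (hess_eps : (hessp X X + hessp Y Y) / 4 = - eps).

(** The coefficient of the part of the tangential Hessian that is not Hermitian;
    [w] is corrected by [kappa z^2] so as to absorb it. *)
Definition kappa : R[i] :=
  ((hessp X X - hessp Y Y) / 4 +i* - ((hessp X Y + hessp Y X) / 4))%C.

Definition zf (q : 'rV[R]_4) : R[i] := a1 * zcoord (q - p) + a2 * wcoord (q - p).
Definition lf (q : 'rV[R]_4) : R[i] := A * zcoord (q - p) + B * wcoord (q - p).
Definition wf (q : 'rV[R]_4) : R[i] := eps%:C%C * ('i%C * (2 * lf q + kappa * zf q ^+ 2)).
Definition linv (a b : R[i]) : R[i] := (- 'i%C * (eps%:C%C * b) - kappa * a ^+ 2) / 2.
Definition qinv (a b : R[i]) : 'rV[R]_4 :=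
  p + cvec (L1 * a + M1 * linv a b) (L2 * a + M2 * linv a b).

Lemma i2 : 'i%C * 'i%C = -1 :> R[i].
Proof. by apply: eqC => /=; ring. Qed.

Lemma epsC2 : eps%:C%C * eps%:C%C = 1 :> R[i].
Proof. by rewrite -rmorphM -expr2 eps2. Qed.

Lemma linvE q : linv (zf q) (wf q) = lf q.
Proof.
rewrite /linv /wf.
have -> : - 'i%C * (eps%:C%C * (eps%:C%C * ('i%C * (2 * lf q + kappa * zf q ^+ 2)))) =
  - ('i%C * 'i%C) * (eps%:C%C * eps%:C%C) * (2 * lf q + kappa * zf q ^+ 2) by ring.
by rewrite i2 epsC2; field.
Qed.

Lemma zcoordE q : zcoord (q - p) = L1 * zf q + M1 * lf q.
Proof.
rewrite /zf /lf; set x := zcoord _; set y := wcoord _.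
have -> : L1 * (a1 * x + a2 * y) + M1 * (A * x + B * y) =
  (L1 * a1 + M1 * A) * x + (L1 * a2 + M1 * B) * y by ring.
by rewrite I11 I12; ring.
Qed.

Lemma wcoordE q : wcoord (q - p) = L2 * zf q + M2 * lf q.
Proof.
rewrite /zf /lf; set x := zcoord _; set y := wcoord _.
have -> : L2 * (a1 * x + a2 * y) + M2 * (A * x + B * y) =
  (L2 * a1 + M2 * A) * x + (L2 * a2 + M2 * B) * y by ring.
by rewrite I21 I22; ring.
Qed.

Lemma subpE q : q - p = cvec (L1 * zf q) (L2 * zf q) + cvec (M1 * lf q) (M2 * lf q).
Proof. by rewrite -cvecD -zcoordE -wcoordE cvec_coord. Qed.

Lemma zf_qinv a b : zf (qinv a b) = a.
Proof.
rewrite /zf /qinv [p + _]addrC addrK zcoord_cvec wcoord_cvec.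
move: (linv a b) => l.
have -> : a1 * (L1 * a + M1 * l) + a2 * (L2 * a + M2 * l) =
  (a1 * L1 + a2 * L2) * a + (a1 * M1 + a2 * M2) * l by ring.
by rewrite aL aM; ring.
Qed.

Lemma lf_qinv a b : lf (qinv a b) = linv a b.
Proof.
rewrite /lf /qinv [p + _]addrC addrK zcoord_cvec wcoord_cvec.
move: (linv a b) => l.
have -> : A * (L1 * a + M1 * l) + B * (L2 * a + M2 * l) =
  (A * L1 + B * L2) * a + (A * M1 + B * M2) * l by ring.
by rewrite AL AM; ring.
Qed.

Lemma wf_qinv a b : wf (qinv a b) = b.
Proof.
rewrite /wf lf_qinv zf_qinv /linv.
have -> : eps%:C%C * ('i%C * (2 * ((- 'i%C * (eps%:C%C * b) - kappa * a ^+ 2) / 2) + kappa * a ^+ 2)) =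
  - ('i%C * 'i%C) * (eps%:C%C * eps%:C%C) * b by field.
by rewrite i2 epsC2; ring.
Qed.

Lemma qinv_affine a b : exists X Y : 'rV[R]_4,
   forall t : R, qinv a (b + 'i%C * t%:C%C) = X + t *: Y.
Proof.
exists (qinv a b), (cvec (M1 * (eps / 2)%:C%C) (M2 * (eps / 2)%:C%C)) => t.
rewrite /qinv -addrA -cvecZ -cvecD; congr (p + cvec _ _).
  have -> : linv a (b + 'i%C * t%:C%C) = linv a b + t%:C%C * (eps / 2)%:C%C.
    rewrite [(eps / 2)%:C%C]rmorphM /= fmorphV rmorph_nat /linv.
    have -> : - 'i%C * (eps%:C%C * (b + 'i%C * t%:C%C)) =
       - 'i%C * (eps%:C%C * b) + - ('i%C * 'i%C) * eps%:C%C * t%:C%C by ring.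
    by rewrite i2; field.
  by ring.
have -> : linv a (b + 'i%C * t%:C%C) = linv a b + t%:C%C * (eps / 2)%:C%C.
  rewrite [(eps / 2)%:C%C]rmorphM /= fmorphV rmorph_nat /linv.
  have -> : - 'i%C * (eps%:C%C * (b + 'i%C * t%:C%C)) =
     - 'i%C * (eps%:C%C * b) + - ('i%C * 'i%C) * eps%:C%C * t%:C%C by ring.
  by rewrite i2; field.
by ring.
Qed.

Lemma linv_small : exists C : R, forall a b, modulus a <= 1 ->
  modulus (linv a b) <= C * (modulus a + modulus b).
Proof.
exists ((`|eps| + modulus kappa) * modulus (2^-1 : R[i])) => a b a_1.
rewrite modulusM mulrAC ler_wpM2r ?modulus_ge0 //.
apply: le_trans (modulusB _ _) _.
rewrite !modulusM modulusN !modulusR.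
have -> : modulus ('i%C : R[i]) = 1.
  by rewrite /modulus /= expr0n expr1n add0r sqrtr1.
rewrite mul1r.
have ma := modulus_ge0 a; have mb := modulus_ge0 b; have mk := modulus_ge0 kappa.
have e0 := normr_ge0 eps.
have aa : modulus a * modulus a <= modulus a by rewrite ler_piMl.
have k1 : modulus kappa * (modulus a * modulus a) <= modulus kappa * (modulus a + modulus b).
  by rewrite ler_wpM2l // (le_trans aa) // lerDl.
have k2 : `|eps| * modulus b <= `|eps| * (modulus a + modulus b).
  by rewrite ler_wpM2l // lerDr.
lra.
Qed.

Lemma qinv_small : exists C : R, forall a b, modulus a <= 1 ->
  `|qinv a b - p| <= C * (modulus a + modulus b).
Proof.
have [C HC] := linv_small.
exists (2 * (modulus L1 + modulus L2 + (modulus M1 + modulus M2) * `|C|)) => a b a_1.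
rewrite /qinv [p + _]addrC addrK; apply: le_trans (norm_cvec _ _) _.
have := HC a b a_1; move: (linv a b) => l Hl.
have ma := modulus_ge0 a; have mb := modulus_ge0 b.
have {}Hl : modulus l <= `|C| * (modulus a + modulus b).
  by apply: le_trans Hl _; rewrite ler_wpM2r ?addr_ge0 ?ler_norm.
have h1 := modulusD (L1 * a) (M1 * l).
have h2 := modulusD (L2 * a) (M2 * l).
rewrite !modulusM in h1 h2.
have k1 := modulus_ge0 L1; have k2 := modulus_ge0 L2.
have k3 := modulus_ge0 M1; have k4 := modulus_ge0 M2.
have g1 : modulus M1 * modulus l <= modulus M1 * (`|C| * (modulus a + modulus b)).
  by rewrite ler_wpM2l.
have g2 : modulus M2 * modulus l <= modulus M2 * (`|C| * (modulus a + modulus b)).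
  by rewrite ler_wpM2l.
have g3 : modulus L1 * modulus a <= modulus L1 * (modulus a + modulus b).
  by rewrite ler_wpM2l // lerDl.
have g4 : modulus L2 * modulus a <= modulus L2 * (modulus a + modulus b).
  by rewrite ler_wpM2l // lerDl.
rewrite -[leLHS]mulr_natl -mulrA ler_pM2l ?ltr0n //.
apply: le_trans (lerD h1 h2) _.
apply: le_trans (lerD (lerD g3 g1) (lerD g4 g2)) _.
by rewrite le_eqVlt; apply/orP; left; apply/eqP; ring.
Qed.

Lemma csmooth_zcoord : csmooth Omega (fun q => zcoord (q - p)).
Proof. by split; apply: smooth_on_coord. Qed.
Lemma csmooth_wcoord : csmooth Omega (fun q => wcoord (q - p)).
Proof. by split; apply: smooth_on_coord. Qed.

Lemma csmoothZ c f : csmooth Omega f -> csmooth Omega (fun q => c * f q).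
Proof. by move=> H; apply: csmoothM => //; apply: csmooth_cst. Qed.

Lemma zf_smooth : csmooth Omega zf.
Proof.
by apply: csmoothD => //; apply: csmoothZ; [apply: csmooth_zcoord|apply: csmooth_wcoord].
Qed.
Lemma wf_smooth : csmooth Omega wf.
Proof.
do 2 apply: csmoothZ; apply: csmoothD => //.
  apply: csmoothZ; apply: csmoothD => //; apply: csmoothZ; [exact: csmooth_zcoord|exact: csmooth_wcoord].
apply: csmoothZ; have := csmoothM openO zf_smooth zf_smooth.
by apply: csmooth_eq => // q _; rewrite expr2.
Qed.

Notation nrm := (fun q : 'rV[R]_4 => `|q - p|).

Lemma small_zcoord : bigO (nbhs p) nrm 1 (fun q => zcoord (q - p)).
Proof.
exists 2; apply: nearW => q; rewrite expr1 mulrC mulr_natr; exact: modulus_zcoord.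
Qed.
Lemma small_wcoord : bigO (nbhs p) nrm 1 (fun q => wcoord (q - p)).
Proof.
exists 2; apply: nearW => q; rewrite expr1 mulrC mulr_natr; exact: modulus_wcoord.
Qed.

Let FF : Filter (nbhs p). Proof. exact: nbhs_filter. Qed.

Lemma small_zf : bigO (nbhs p) nrm 1 zf.
Proof.
apply: bigOD => //; apply: bigOZ => //; [exact: small_zcoord|exact: small_wcoord].
Qed.

Lemma small_wf : bigO (nbhs p) nrm 1 wf.
Proof.
apply: bigOZ => //; apply: bigOZ => //; apply: bigOD => //.
  apply: bigOZ => //; apply: bigOD => //; apply: bigOZ => //; [exact: small_zcoord|exact: small_wcoord].
apply: bigOZ => //; have := bigOM FF small_zf small_zf.
have n01 : \forall q \near p, 0 <= nrm q <= 1 by exact: near_nrm01.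
move=> H; apply: (bigO_le FF n01 (_ : 1 <= 1 + 1)%N) => //.
Qed.

Notation weighted := (weighted zf wf).

Lemma weighted_lf : weighted 2 lf.
Proof.
have H : weighted 2 (fun q => (- 'i%C * eps%:C%C / 2) * wf q + (- kappa / 2) * (zf q * zf q)).
  apply: weightedD; apply: weightedZ; first exact: weighted_w.
  exact: (weightedM (weighted_z _ _) (weighted_z _ _)).
apply: weighted_eq H => q; rewrite -[RHS]linvE /linv.
by move: (zf q) (wf q) => z w; field.
Qed.

Lemma weighted_cvec k f g : weighted k f -> weighted k g ->
  forall j, weighted k (fun q => (cvec (f q) (g q) 0 j)%:C%C).
Proof.
move=> Hf Hg; case=> [[|[|[|[|//]]]] jlt].
- by apply: weighted_eq (weighted_Re Hf) => q; rewrite mxE.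
- by apply: weighted_eq (weighted_Im Hf) => q; rewrite mxE.
- by apply: weighted_eq (weighted_Re Hg) => q; rewrite mxE.
- by apply: weighted_eq (weighted_Im Hg) => q; rewrite mxE.
Qed.

Lemma weighted_coord j : weighted 1 (fun q => ((q - p) 0 j)%:C%C).
Proof.
have Hz : weighted 1 zf by exact: weighted_z.
have Hl : weighted 1 lf by apply: weighted_le weighted_lf.
have H := weightedD (weighted_cvec (weightedZ L1 Hz) (weightedZ L2 Hz) j)
   (weighted_cvec (weightedZ M1 Hl) (weightedZ M2 Hl) j).
apply: weighted_eq H => q.
rewrite -rmorphD /=; congr (_ %:C%C); rewrite [in RHS]subpE; by rewrite [RHS]mxE.
Qed.

Lemma weighted_hess k l (f g : 'rV[R]_4 -> 'rV[R]_4) :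
  (forall j, weighted k (fun q => (f q 0 j)%:C%C)) ->
  (forall j, weighted l (fun q => (g q 0 j)%:C%C)) ->
  weighted (k + l) (fun q => (hessp (f q) (g q))%:C%C).
Proof.
move=> Hf Hg.
have H : weighted (k + l) (fun q => \sum_(i < 4) (f q 0 i)%:C%C *
     \sum_(j < 4) (partial j (partial i rho) p)%:C%C * (g q 0 j)%:C%C).
  apply: weighted_sum => i _; apply: weightedM (Hf i) _.
  by apply: weighted_sum => j _; apply: weightedZ.
apply: weighted_eq H => q; rewrite /hess rmorph_sum /=; apply: eq_bigr => i _.
rewrite [RHS]rmorphM /= rmorph_sum /=; congr (_ * _); apply: eq_bigr => j _.
by rewrite [RHS]rmorphM mulrC.
Qed.

Lemma taylor1_lf q : taylor_term p 1 rho (q - p) = 2 * complex.Re (lf q).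
Proof.
rewrite taylor_term1 /lf (dz_rho rho p) (dw_rho rho p).
have l1 : lift ord0 (ord0 : 'I_3) = 1 :> 'I_4 by exact: val_inj.
have l2 : lift ord0 (lift ord0 (ord0 : 'I_2)) = 2 :> 'I_4 by exact: val_inj.
have l3 : lift ord0 (lift ord0 (lift ord0 (ord0 : 'I_1))) = 3 :> 'I_4 by exact: val_inj.
rewrite !big_ord_recl big_ord0 l3 l2 l1 -[ord0]/(0 : 'I_4).
have -> : 2^-1 = (2^-1 : R)%:C%C :> R[i] by rewrite fmorphV rmorph_nat.
rewrite /zcoord /wcoord.
move: (partial 0 rho p) (partial 1 rho p) (partial 2 rho p) (partial 3 rho p).
move: ((q - p) 0 0) ((q - p) 0 1) ((q - p) 0 2) ((q - p) 0 3) => x0 x1 x2 x3 d0 d1 d2 d3.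
by rewrite /=; field.
Qed.

Lemma hess_tangent (z : R[i]) : hessp (cvec (L1 * z) (L2 * z)) (cvec (L1 * z) (L2 * z)) / 2 =
  complex.Re (kappa * z ^+ 2) - eps * (complex.Re z ^+ 2 + complex.Im z ^+ 2).
Proof.
have -> : cvec (L1 * z) (L2 * z) = complex.Re z *: X + complex.Im z *: Y.
  rewrite -!cvecZ -cvecD; congr cvec.
    by case: z => s t; apply: eqC; rewrite ?ReD ?ImD ?ReM ?ImM ?ReM ?ImM /=; ring.
  by case: z => s t; apply: eqC; rewrite ?ReD ?ImD ?ReM ?ImM ?ReM ?ImM /=; ring.
rewrite !hessDl !hessDr !hessZl !hessZr -[eps]opprK -hess_eps /kappa.
move: (hessp X X) (hessp X Y) (hessp Y X) (hessp Y Y) => h1 h2 h3 h4.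
by case: z => s t /=; field.
Qed.

(** The first order term of [rho] is [2 Re l], and its second order term along the
    tangent vector is [Re (kappa z^2) - eps |z|^2]; what remains has weight 3. *)
Lemma chart_eq K : exists2 tau, weighted 3 tau & bigO (nbhs p) nrm K (fun q =>
  (rho q)%:C%C - eps%:C%C * ((vcoord wf q)%:C%C - zf q * (zf q)^*%C) - tau q).
Proof.
pose x q := cvec (L1 * zf q) (L2 * zf q); pose y q := cvec (M1 * lf q) (M2 * lf q).
have wz : weighted 1 zf by exact: weighted_z.
have wl := weighted_lf.
have wx := weighted_cvec (weightedZ L1 wz) (weightedZ L2 wz).
have wy := weighted_cvec (weightedZ M1 wl) (weightedZ M2 wl).
exists (fun q => 2^-1 * ((hessp (x q) (y q))%:C%C + (hessp (y q) (x q))%:C%C + (hessp (y q) (y q))%:C%C)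
   + \sum_(d < K) (taylor_term p (3 + d) rho (q - p))%:C%C).
  apply: weightedD.
    apply: weightedZ; apply: weightedD; last exact: weighted_le (weighted_hess wy wy).
    by apply: weightedD; [exact: weighted_hess wx wy|exact: weighted_hess wy wx].
  apply: weighted_sum => d _; apply: weighted_le (taylor_weighted weighted_coord _ _).
  exact: leq_addr.
have n01 : \forall q \near p, 0 <= nrm q <= 1 by exact: near_nrm01.
apply: (bigO_le FF n01 (leq_addl 3 K)).
apply: bigO_eq (taylor_bigO openO (3 + K) Op srho) => q.
have E3 : \sum_(d < 3) (taylor_term p d rho (q - p))%:C%C =
    eps%:C%C * ((vcoord wf q)%:C%C - zf q * (zf q)^*%C) +
    2^-1 * ((hessp (x q) (y q))%:C%C + (hessp (y q) (x q))%:C%C + (hessp (y q) (y q))%:C%C).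
  rewrite !big_ord_recl big_ord0 addr0.
  rewrite -[taylor_term p ord0 _ _]/(rho p) rho0 add0r.
  rewrite -[taylor_term p (lift ord0 ord0) _ _]/(taylor_term p 1 rho (q - p)).
  rewrite -[taylor_term p (lift ord0 (lift ord0 ord0)) _ _]/(taylor_term p 2 rho (q - p)).
  rewrite taylor1_lf taylor_term2 [X in hessp X]subpE [X in hessp _ X]subpE -/(x q) -/(y q).
  rewrite hessDl !hessDr.
  have -> : (hessp (x q) (x q) + hessp (x q) (y q) + (hessp (y q) (x q) + hessp (y q) (y q))) / 2 =
    hessp (x q) (x q) / 2 + (hessp (x q) (y q) + hessp (y q) (x q) + hessp (y q) (y q)) / 2 by field.
  rewrite hess_tangent mul_conjc_modulus.
  have -> : modulus (zf q) ^+ 2 = complex.Re (zf q) ^+ 2 + complex.Im (zf q) ^+ 2.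
    by case: (zf q) => s t; rewrite /modulus /= sqr_sqrtr // addr_ge0 ?sqr_ge0.
  have -> : vcoord wf q = eps * (2 * complex.Re (lf q) + complex.Re (kappa * zf q ^+ 2)).
    rewrite /vcoord /wf; move: (kappa * _) (lf q) => k l.
    by case: k => k1 k2; case: l => l1 l2 /=; ring.
  move: (complex.Re (lf q)) (complex.Re (kappa * _)) (complex.Re (zf q)) (complex.Im (zf q)) => c1 c2 c3 c4.
  move: (hessp (x q) (y q)) (hessp (y q) (x q)) (hessp (y q) (y q)) => h1 h2 h3.
  have -> : 2^-1 = (2^-1 : R)%:C%C :> R[i] by rewrite fmorphV rmorph_nat.
  rewrite -!rmorphD -rmorphM -rmorphB -!rmorphM -rmorphD /=; congr (_ %:C%C).
  apply/eqP; rewrite -subr_eq0; apply/eqP.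
  transitivity ((1 - eps ^+ 2) * (2 * c1 + c2)); first by field.
  by rewrite eps2 subrr mul0r.
rewrite big_split_ord /= E3.
have -> : \sum_(d < K) (taylor_term p (rshift 3 d) rho (q - p))%:C%C =
  \sum_(d < K) (taylor_term p (3 + d) rho (q - p))%:C%C by [].
by rewrite !opprD !addrA.
Qed.

Definition the_chart : adapted_chart Omega rho p :=
  AdaptedChart eps2 zf_smooth wf_smooth weighted_coord small_zf small_wf
    zf_qinv wf_qinv qinv_affine qinv_small chart_eq.

End ChartConstruction.

(** * Existence of adapted coordinates *)

Lemma sum_conj_eq0 (R : realType) (a b : R[i]) : a * a^*%C + b * b^*%C = 0 -> a = 0 /\ b = 0.
Proof.
rewrite !mul_conjc_modulus -rmorphD => /(congr1 (@complex.Re R)) /= /eqP.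
rewrite paddr_eq0 ?sqr_ge0 // !sqrf_eq0 => /andP[/eqP a0 /eqP b0].
by split; apply: modulus_eq0.
Qed.

Lemma ord4_cases (i : 'I_4) : [\/ i = 0, i = 1, i = 2 | i = 3].
Proof.
case: i => [[|[|[|[|//]]]] ilt].
- by constructor 1; apply: val_inj.
- by constructor 2; apply: val_inj.
- by constructor 3; apply: val_inj.
- by constructor 4; apply: val_inj.
Qed.

Lemma sesquilinear_scale (R : realType) (x1 x2 x3 x4 a b k l : R[i]) :
  x1 * (k * a) * (l * a)^*%C + x2 * (k * a) * (l * b)^*%C +
  x3 * (k * b) * (l * a)^*%C + x4 * (k * b) * (l * b)^*%C =
  k * l^*%C * (x1 * a * a^*%C + x2 * a * b^*%C + x3 * b * a^*%C + x4 * b * b^*%C).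
Proof. by rewrite !rmorphM; ring. Qed.

Lemma tangent_multiple (R : realType) (A B c d : R[i]) :
  A * A^*%C + B * B^*%C != 0 -> A * c + B * d = 0 ->
  exists k, c = k * - B /\ d = k * A.
Proof.
move=> n0 cd; exists ((A^*%C * d - B^*%C * c) / (A * A^*%C + B * B^*%C)).
move: n0 cd; move: (A^*%C) (B^*%C) => A' B' n0 cd; split; apply: (mulIf n0).
  rewrite mulrAC divfK //.
  have -> : (A' * d - B' * c) * - B = c * (A * A' + B * B') - A' * (A * c + B * d) by ring.
  by rewrite cd mulr0 subr0.
rewrite mulrAC divfK //.
have -> : (A' * d - B' * c) * A = d * (A * A' + B * B') - B' * (A * c + B * d) by ring.
by rewrite cd mulr0 subr0.
Qed.

(** A frame made of a tangent and a transversal vector, with the dual frame. *)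
Lemma frame_exists (R : realType) (A B m : R[i]) :
  A * A^*%C + B * B^*%C != 0 -> m != 0 ->
  let L1 := m^-1 * - B in let L2 := m^-1 * A in
  exists M1 M2 a1 a2,
   [/\ a1 * L1 + a2 * L2 = 1, A * L1 + B * L2 = 0, a1 * M1 + a2 * M2 = 0 & A * M1 + B * M2 = 1] /\
   [/\ L1 * a1 + M1 * A = 1, L1 * a2 + M1 * B = 0, L2 * a1 + M2 * A = 0 & L2 * a2 + M2 * B = 1].
Proof.
move=> n0 m0 L1 L2; rewrite /L1 /L2.
exists (A^*%C / (A * A^*%C + B * B^*%C)), (B^*%C / (A * A^*%C + B * B^*%C)),
  (- (m * B^*%C) / (A * A^*%C + B * B^*%C)), (m * A^*%C / (A * A^*%C + B * B^*%C)).
by move: n0; move: (A^*%C) (B^*%C) => A' B' n0; split; split; field; rewrite ?m0 ?n0.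
Qed.

Lemma det_frame (R : realType) (A B L1 L2 M1 M2 a1 a2 : R[i]) :
  a1 * L1 + a2 * L2 = 1 -> A * L1 + B * L2 = 0 -> a1 * M1 + a2 * M2 = 0 ->
  A * M1 + B * M2 = 1 -> (a1 * B - a2 * A) * (L1 * M2 - L2 * M1) = 1.
Proof.
move=> aL AL aM AM.
have -> : (a1 * B - a2 * A) * (L1 * M2 - L2 * M1) =
  (a1 * L1 + a2 * L2) * (A * M1 + B * M2) - (a1 * M1 + a2 * M2) * (A * L1 + B * L2) by ring.
by rewrite aL AL AM aM; ring.
Qed.

Lemma tangent_vector (R : realType) (A B : R[i]) : A * - B + B * A = 0.
Proof. by ring. Qed.

Lemma wf_expand (R : realType) (e i k x y A B z : R[i]) :
  e * (i * (2 * (A * x + B * y) + k * z ^+ 2)) =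
  e * i * 2 * A * x + e * i * 2 * B * y + e * i * k * z ^+ 2.
Proof. by ring. Qed.

Lemma det_scale (R : realType) (a1 a2 c A B : R[i]) :
  a1 * (c * 2 * B) - a2 * (c * 2 * A) = c * 2 * (a1 * B - a2 * A).
Proof. by ring. Qed.

Section ChartExists.
Variables (R : realType) (Omega : set 'rV[R]_4) (rho : 'rV[R]_4 -> R) (p : 'rV[R]_4).
Hypotheses (openO : open Omega) (srho : smooth_on Omega rho) (Op : Omega p).
Hypothesis rho0 : rho p = 0.
Hypothesis drho : exists v : 'rV[R]_4, 'd rho p v != 0.
Hypothesis levi : forall a b : R[i], hol_tangent rho p a b ->
    (forall c d : R[i], hol_tangent rho p c d -> levi_form rho p a b c d = 0) ->
    a = 0 /\ b = 0.

Notation partial i f := ('D_(delta_mx 0 i) f).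
Notation r := (cplx_fun rho).
Notation hess := (hess rho p).

Lemma grad_neq0 : d_z r p * (d_z r p)^*%C + d_w r p * (d_w r p)^*%C != 0.
Proof.
apply/eqP => /sum_conj_eq0[A0 B0].
have [v] := drho; suff -> : 'd rho p v = 0 by rewrite eqxx.
have dr : differentiable rho p by exact: smooth_diff srho Op.
have half0 (a : R[i]) : a / 2 = 0 -> a = 0.
  by move=> /eqP; rewrite mulf_eq0 invr_eq0 pnatr_eq0 orbF => /eqP.
move: A0 B0; rewrite dz_rho dw_rho => /half0 [d0 /eqP d1] /half0 [d2 /eqP d3].
rewrite oppr_eq0 in d1; rewrite oppr_eq0 in d3.
rewrite (row_sum_delta v) linear_sum big1 // => i _.
rewrite linearZ /= -deriveE //.
suff -> : partial i rho p = 0 by rewrite scaler0.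
case: (ord4_cases i) => ->; [exact: d0|exact: (eqP d1)|exact: d2|exact: (eqP d3)].
Qed.

Lemma levi_formZ a b k l : levi_form rho p (k * a) (k * b) (l * a) (l * b) =
  k * l^*%C * levi_form rho p a b a b.
Proof.
exact: sesquilinear_scale.
Qed.

(** The complex tangent space is a line, so a non-degenerate form does not vanish
    on its generator. *)
Lemma levi_tangent_neq0 :
  levi_form rho p (- d_w r p) (d_z r p) (- d_w r p) (d_z r p) != 0.
Proof.
apply/eqP => l0; have n0 := grad_neq0.
have L0 : hol_tangent rho p (- d_w r p) (d_z r p).
  exact: tangent_vector.
have [|B0 A0] := levi L0.
  move=> c d /(tangent_multiple n0)[k [-> ->]].
  have := levi_formZ (- d_w r p) (d_z r p) 1 k.
  by rewrite l0 mulr0 !mul1r.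
move/eqP: n0; apply; move/eqP: B0; rewrite oppr_eq0 => /eqP ->.
by rewrite A0 !mul0r addr0.
Qed.

(** Non-degeneracy lets one scale the complex tangent vector so that the Levi
    form takes the value 1 or -1 on it. *)
Lemma chart_exists : exists (ch : adapted_chart Omega rho p) (a1 a2 b1 b2 k : R[i]),
  [/\ forall q, ch_z ch q = a1 * zcoord (q - p) + a2 * wcoord (q - p),
      forall q, ch_w ch q = b1 * zcoord (q - p) + b2 * wcoord (q - p) + k * ch_z ch q ^+ 2 &
      a1 * b2 - a2 * b1 != 0].
Proof.
have n0 := grad_neq0; have l0 := levi_tangent_neq0.
rewrite (levi_form_hess openO srho Op) in l0.
pose lam : R := (hess (cvec (- d_w r p) (d_z r p)) (cvec (- d_w r p) (d_z r p)) +
  hess (cvec ('i%C * - d_w r p) ('i%C * d_z r p)) (cvec ('i%C * - d_w r p) ('i%C * d_z r p))) / 4.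
have lam0 : lam != 0 by apply: contra_neq l0 => lam0; rewrite -/lam lam0.
pose mu := Num.sqrt `|lam|.
have mu0 : 0 < mu by rewrite sqrtr_gt0 normr_gt0.
have mu2 : mu ^+ 2 = `|lam| by rewrite sqr_sqrtr.
have muC : mu%:C%C != 0 :> R[i].
  by apply/eqP => /(congr1 (@complex.Re R)) /= m0; rewrite m0 ltxx in mu0.
(* minus the sign of the Levi form; dividing the tangent vector by mu
   normalizes its absolute value to 1 *)
pose eps := - (lam / `|lam|).
have eps2 : eps ^+ 2 = 1.
  by rewrite /eps sqrrN exprMn exprVn real_normK ?num_real // divff // expf_neq0.
have [M1 [M2 [a1 [a2 [[aL AL aM AM] [I11 I12 I21 I22]]]]]] := frame_exists n0 muC.
pose L1 := mu%:C%C^-1 * - d_w r p; pose L2 := mu%:C%C^-1 * d_z r p.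
have hess_eps : (hess (cvec L1 L2) (cvec L1 L2) +
    hess (cvec ('i%C * L1) ('i%C * L2)) (cvec ('i%C * L1) ('i%C * L2))) / 4 = - eps.
  have H := levi_form_hess openO srho Op L1 L2.
  have E := levi_formZ (- d_w r p) (d_z r p) (mu%:C%C^-1) (mu%:C%C^-1).
  have H' := levi_form_hess openO srho Op (- d_w r p) (d_z r p).
  have E' := etrans (etrans (esym H) E) (congr1 ( *%R _) H').
  have mV : mu%:C%C^-1 * (mu%:C%C^-1)^*%C = (mu^-1 * mu^-1)%:C%C :> R[i].
    by rewrite -fmorphV rmorphM; congr (_ * _); rewrite /= oppr0.
  rewrite mV -rmorphM in E'.
  have {}E' := congr1 (@complex.Re R) E'.
  refine (etrans E' _); rewrite /eps opprK -mu2 /= -/lam expr2 invfM mulrC.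
  by [].
have D0 : (a1 * d_w r p - a2 * d_z r p) * (L1 * M2 - L2 * M1) = 1.
  exact: det_frame aL AL aM AM.
pose ch := the_chart openO srho Op rho0 aL AL aM AM I11 I12 I21 I22 eps2 hess_eps.
pose c := eps%:C%C * 'i%C : R[i].
exists ch, a1, a2, (c * 2 * d_z r p), (c * 2 * d_w r p), (c * kappa rho p L1 L2).
have c0 : c != 0.
  have : c * c = -1.
    rewrite /c mulrACA -rmorphM -expr2 eps2 mul1r; exact: i2.
  by move=> cc; apply/eqP => c0; move: cc; rewrite c0 mul0r => /esym/eqP; rewrite oppr_eq0 oner_eq0.
split.
- by [].
- by move=> q; apply: wf_expand.
rewrite det_scale; apply: mulf_neq0; first by apply: mulf_neq0; rewrite ?pnatr_eq0.
by apply/eqP => d0; move/eqP: D0; rewrite d0 mul0r eq_sym oner_eq0.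
Qed.

End ChartExists.

(** * Holomorphic polynomials in the ring of smooth functions *)

Section CommutingDerivations.
Variables (S : comPzRingType) (D1 D2 : S -> S) (P1 : derivation D1) (P2 : derivation D2).

Lemma deriv_commD a b : D1 (D2 a) = D2 (D1 a) -> D1 (D2 b) = D2 (D1 b) ->
  D1 (D2 (a + b)) = D2 (D1 (a + b)).
Proof. by move=> a3 b3; rewrite (derivD P2) !(derivD P1) (derivD P2) a3 b3. Qed.

Lemma deriv_commM a b : D1 (D2 a) = D2 (D1 a) -> D1 (D2 b) = D2 (D1 b) ->
  D1 (D2 (a * b)) = D2 (D1 (a * b)).
Proof.
move=> a3 b3; rewrite (derivM P2) (derivM P1) (derivD P1) (derivD P2).
by rewrite !(derivM P1) !(derivM P2) a3 b3; ring.
Qed.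

End CommutingDerivations.

Section HolomorphicPolynomials.
Variables (R : realType) (Omega : set 'rV[R]_4) (p : 'rV[R]_4).
Hypotheses (openO : open Omega) (Op : Omega p).

Notation S := (smooth_fun openO).
Notation cst := (sm_cst openO).
Notation zeta := (zeta openO p).
Notation omega := (omega openO p).

Lemma dz_derivation : derivation (@dz R Omega openO).
Proof. by split; [apply: sm_wirtD|apply: sm_wirtM]. Qed.
Lemma dzb_derivation : derivation (@dzb R Omega openO).
Proof. by split; [apply: sm_wirtD|apply: sm_wirtM]. Qed.
Lemma dw_derivation : derivation (@dw R Omega openO).
Proof. by split; [apply: sm_wirtD|apply: sm_wirtM]. Qed.
Lemma dwb_derivation : derivation (@dwb R Omega openO).
Proof. by split; [apply: sm_wirtD|apply: sm_wirtM]. Qed.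

Lemma sm_cst1 : cst 1 = 1. Proof. by apply: smP => q Oq; rewrite sm_cstE ?sm1. Qed.
Lemma sm_cst0 : cst 0 = 0. Proof. by apply: smP => q Oq; rewrite sm_cstE ?sm0. Qed.

Lemma cst_half : cst 2^-1 + cst 2^-1 = 1.
Proof. by rewrite -sm_cst1 -sm_cstD; congr (cst _); field. Qed.

Lemma cst_i2 : cst 'i%C * cst 'i%C = - 1.
Proof. by rewrite -sm_cstM (i2 R) sm_cstN sm_cst1. Qed.

Lemma wirt_coord (i j k l : 'I_4) (s t : R[i]) :
  sm_wirt i j s (sm_coord openO p k + cst t * sm_coord openO p l) =
  ((i == k)%:R + cst t * (i == l)%:R + cst s * ((j == k)%:R + cst t * (j == l)%:R)) * cst 2^-1.
Proof. by rewrite /sm_wirt !sm_pdD !sm_pdM !sm_pd_cst !sm_pd_coord !mul0r !add0r. Qed.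

Lemma coordN k l : sm_coord openO p k - cst 'i%C * sm_coord openO p l =
  sm_coord openO p k + cst (- 'i%C) * sm_coord openO p l.
Proof. by rewrite sm_cstN mulNr. Qed.

Lemma half1 : (1 + 1) * cst 2^-1 = 1.
Proof. by rewrite mulrDl !mul1r cst_half. Qed.

Lemma wirt_aux1 (i : S) : i * i = -1 -> (1 + i * 0 + - i * (0 + i * 1)) * cst 2^-1 = 1.
Proof.
move=> ii; have -> : 1 + i * 0 + - i * (0 + i * 1) = 1 - i * i by ring.
by rewrite ii opprK half1.
Qed.
Lemma wirt_aux2 (i : S) : i * i = -1 -> (1 + i * 0 + i * (0 + i * 1)) * cst 2^-1 = 0.
Proof.
move=> ii; have -> : 1 + i * 0 + i * (0 + i * 1) = 1 + i * i by ring.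
by rewrite ii subrr mul0r.
Qed.
Lemma wirt_aux3 (i : S) : i * i = -1 -> (1 + - i * 0 + - i * (0 + - i * 1)) * cst 2^-1 = 0.
Proof.
move=> ii; have -> : 1 + - i * 0 + - i * (0 + - i * 1) = 1 + i * i by ring.
by rewrite ii subrr mul0r.
Qed.
Lemma wirt_aux4 (i : S) : i * i = -1 -> (1 + - i * 0 + i * (0 + - i * 1)) * cst 2^-1 = 1.
Proof.
move=> ii; have -> : 1 + - i * 0 + i * (0 + - i * 1) = 1 - i * i by ring.
by rewrite ii opprK half1.
Qed.
Lemma wirt_aux0 (a b : S) : (0 + a * 0 + b * (0 + a * 0)) * cst 2^-1 = 0.
Proof. by ring. Qed.

Lemma dz_zeta : dz zeta = 1.
Proof. rewrite /dz wirt_coord sm_cstN; exact: wirt_aux1 cst_i2. Qed.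
Lemma dzb_zeta : dzb zeta = 0.
Proof. rewrite /dzb wirt_coord; exact: wirt_aux2 cst_i2. Qed.
Lemma dw_zeta : dw zeta = 0.
Proof. rewrite /dw wirt_coord; exact: wirt_aux0. Qed.
Lemma dwb_zeta : dwb zeta = 0.
Proof. rewrite /dwb wirt_coord; exact: wirt_aux0. Qed.
Lemma dz_zetab : dz (zetab openO p) = 0.
Proof. rewrite /dz /zetab coordN wirt_coord !sm_cstN; exact: wirt_aux3 cst_i2. Qed.
Lemma dzb_zetab : dzb (zetab openO p) = 1.
Proof. rewrite /dzb /zetab coordN wirt_coord !sm_cstN; exact: wirt_aux4 cst_i2. Qed.
Lemma dw_zetab : dw (zetab openO p) = 0.
Proof. rewrite /dw /zetab coordN wirt_coord; exact: wirt_aux0. Qed.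
Lemma dwb_zetab : dwb (zetab openO p) = 0.
Proof. rewrite /dwb /zetab coordN wirt_coord; exact: wirt_aux0. Qed.
Lemma dz_omega : dz omega = 0.
Proof. rewrite /dz wirt_coord; exact: wirt_aux0. Qed.
Lemma dzb_omega : dzb omega = 0.
Proof. rewrite /dzb wirt_coord; exact: wirt_aux0. Qed.
Lemma dw_omega : dw omega = 1.
Proof. rewrite /dw wirt_coord sm_cstN; exact: wirt_aux1 cst_i2. Qed.
Lemma dwb_omega : dwb omega = 0.
Proof. rewrite /dwb wirt_coord; exact: wirt_aux2 cst_i2. Qed.
Lemma dz_omegab : dz (omegab openO p) = 0.
Proof. rewrite /dz /omegab coordN wirt_coord; exact: wirt_aux0. Qed.
Lemma dzb_omegab : dzb (omegab openO p) = 0.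
Proof. rewrite /dzb /omegab coordN wirt_coord; exact: wirt_aux0. Qed.
Lemma dw_omegab : dw (omegab openO p) = 0.
Proof. rewrite /dw /omegab coordN wirt_coord !sm_cstN; exact: wirt_aux3 cst_i2. Qed.
Lemma dwb_omegab : dwb (omegab openO p) = 1.
Proof. rewrite /dwb /omegab coordN wirt_coord !sm_cstN; exact: wirt_aux4 cst_i2. Qed.

(** Truncated changes of coordinates belong to these classes, on which the
    Wirtinger derivatives are determined by induction. *)
Inductive holpoly : S -> Prop :=
| holpoly_cst c : holpoly (cst c)
| holpoly_zeta : holpoly zeta
| holpoly_omega : holpoly omega
| holpolyD a b : holpoly a -> holpoly b -> holpoly (a + b)
| holpolyM a b : holpoly a -> holpoly b -> holpoly (a * b).

Inductive aholpoly : S -> Prop :=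
| aholpoly_cst c : aholpoly (cst c)
| aholpoly_zetab : aholpoly (zetab openO p)
| aholpoly_omegab : aholpoly (omegab openO p)
| aholpolyD a b : aholpoly a -> aholpoly b -> aholpoly (a + b)
| aholpolyM a b : aholpoly a -> aholpoly b -> aholpoly (a * b).

Lemma holpoly0 : holpoly 0. Proof. by rewrite -sm_cst0; apply: holpoly_cst. Qed.
Lemma holpoly1 : holpoly 1. Proof. by rewrite -sm_cst1; apply: holpoly_cst. Qed.
Lemma aholpoly0 : aholpoly 0. Proof. by rewrite -sm_cst0; apply: aholpoly_cst. Qed.
Lemma aholpoly1 : aholpoly 1. Proof. by rewrite -sm_cst1; apply: aholpoly_cst. Qed.

Lemma holpoly_hol a : holpoly a -> holomorphic (@dzb R Omega openO) (@dwb R Omega openO) a.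
Proof.
have [Pz Pw] := (dzb_derivation, dwb_derivation).
elim=> {a} [c|||a b _ [a1 a2] _ [b1 b2]|a b _ [a1 a2] _ [b1 b2]]; split.
- exact: sm_wirt_cst.
- exact: sm_wirt_cst.
- exact: dzb_zeta.
- exact: dwb_zeta.
- exact: dzb_omega.
- exact: dwb_omega.
- by rewrite (derivD Pz) a1 b1 addr0.
- by rewrite (derivD Pw) a2 b2 addr0.
- by rewrite (derivM Pz) a1 b1 mul0r mulr0 addr0.
- by rewrite (derivM Pw) a2 b2 mul0r mulr0 addr0.
Qed.

Lemma aholpoly_ahol a : aholpoly a -> dz a = 0 /\ dw a = 0.
Proof.
have [Pz Pw] := (dz_derivation, dw_derivation).
elim=> {a} [c|||a b _ [a1 a2] _ [b1 b2]|a b _ [a1 a2] _ [b1 b2]]; split.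
- exact: sm_wirt_cst.
- exact: sm_wirt_cst.
- exact: dz_zetab.
- exact: dw_zetab.
- exact: dz_omegab.
- exact: dw_omegab.
- by rewrite (derivD Pz) a1 b1 addr0.
- by rewrite (derivD Pw) a2 b2 addr0.
- by rewrite (derivM Pz) a1 b1 mul0r mulr0 addr0.
- by rewrite (derivM Pw) a2 b2 mul0r mulr0 addr0.
Qed.

Lemma holpoly_der a : holpoly a ->
  [/\ holpoly (dz a), holpoly (dw a) & dz (dw a) = dw (dz a)].
Proof.
have [Pz Pw] := (dz_derivation, dw_derivation).
elim=> {a} [c|||a b Ha [a1 a2 a3] Hb [b1 b2 b3]|a b Ha [a1 a2 a3] Hb [b1 b2 b3]].
- have -> : dz (cst c) = 0 by exact: sm_wirt_cst.
  have -> : dw (cst c) = 0 by exact: sm_wirt_cst.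
  by split; rewrite ?(deriv0 Pz) ?(deriv0 Pw) //; apply: holpoly0.
- rewrite dz_zeta dw_zeta (deriv0 Pz) (deriv1 Pw).
  by split => //; [exact: holpoly1|exact: holpoly0].
- rewrite dz_omega dw_omega (deriv0 Pw) (deriv1 Pz).
  by split => //; [exact: holpoly0|exact: holpoly1].
- split; last exact: (deriv_commD Pz Pw a3 b3).
    by rewrite (derivD Pz a b); apply: holpolyD.
  by rewrite (derivD Pw a b); apply: holpolyD.
split; last exact: (deriv_commM Pz Pw a3 b3).
  by rewrite (derivM Pz a b); apply: holpolyD; apply: holpolyM.
by rewrite (derivM Pw a b); apply: holpolyD; apply: holpolyM.
Qed.

Lemma holpolyX a n : holpoly a -> holpoly (a ^+ n).
Proof.
by move=> Ha; elim: n => [|n IH]; [apply: holpoly1|rewrite exprS; apply: holpolyM].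
Qed.
Lemma aholpolyX a n : aholpoly a -> aholpoly (a ^+ n).
Proof.
by move=> Ha; elim: n => [|n IH]; [apply: aholpoly1|rewrite exprS; apply: aholpolyM].
Qed.
Lemma holpoly_sum I (r : seq I) (P : pred I) (f : I -> S) :
  (forall i, P i -> holpoly (f i)) -> holpoly (\sum_(i <- r | P i) f i).
Proof. by move=> H; elim/big_rec: _ => [|i x Pi Hx]; [exact: holpoly0|apply: holpolyD; auto]. Qed.
Lemma aholpoly_sum I (r : seq I) (P : pred I) (f : I -> S) :
  (forall i, P i -> aholpoly (f i)) -> aholpoly (\sum_(i <- r | P i) f i).
Proof. by move=> H; elim/big_rec: _ => [|i x Pi Hx]; [exact: aholpoly0|apply: aholpolyD; auto]. Qed.

Definition trunc_at (N : nat) (F : nat -> nat -> R[i]) (x y : S) : S :=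
  \sum_(j < N.+1) \sum_(k < N.+1 | (j + k <= N)%N) cst (F j k) * x ^+ j * y ^+ k.

Lemma trunc_atE N F (x y : S) q : Omega q ->
  trunc_at N F x y q = hol_trunc N F (x q) (y q).
Proof.
move=> Oq; rewrite sm_sum //; apply: eq_bigr => j _; rewrite sm_sum //.
by apply: eq_bigr => k _; rewrite !smM // !smX // sm_cstE.
Qed.

Lemma trunc_at_der (D : S -> S) N F (x y : S) : derivation D -> (forall c, D (cst c) = 0) ->
  x p = 0 -> y p = 0 -> (0 < N)%N ->
  D (trunc_at N F x y) p = F 1%N 0%N * D x p + F 0%N 1%N * D y p.
Proof.
case: N => // N DP Dc x0 y0 _.
have E : D (trunc_at N.+1 F x y) = \sum_(j < N.+2) \sum_(k < N.+2 | (j + k <= N.+1)%N)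
    cst (F j k) * (x ^+ j.-1 *+ j * y ^+ k * D x + x ^+ j * (y ^+ k.-1 *+ k) * D y).
  rewrite (deriv_sum DP); apply: eq_bigr => j _; rewrite (deriv_sum DP).
  apply: eq_bigr => k _; rewrite !(derivM DP) !(derivX DP) Dc; ring.
rewrite E sm_sum //.
pose g j k := F j k * ((j == 1%N)%:R * (k == 0%N)%:R * D x p + (j == 0%N)%:R * (k == 1%N)%:R * D y p).
have pow0 n : (0 : R[i]) ^+ n = (n == 0%N)%:R by rewrite expr0n.
have pow1 n : (0 : R[i]) ^+ n.-1 *+ n = (n == 1%N)%:R.
  by case: n => [|[|n]] //=; rewrite ?mulr1n // exprS mul0r mul0rn.
rewrite (eq_bigr (fun j : 'I_N.+2 => \sum_(k < N.+2 | (j + k <= N.+1)%N) g j k)); last first.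
  move=> j _; rewrite sm_sum //; apply: eq_bigr => k _.
  rewrite smM // smD // sm_cstE // !smM // !sm_natmul // !smX // x0 y0 /g.
  by rewrite !pow1 !pow0.
rewrite !big_ord_recl /= [X in _ + (_ + X)]big1 ?addr0; last first.
  by move=> j _; apply: big1 => k _; rewrite /g /bump /=; ring.
rewrite [X in X + _](_ : _ = g 0%N 1%N); last first.
  rewrite big_mkcond !big_ord_recl /= big1 ?addr0.
    by rewrite /g /bump /=; ring.
  by move=> k _; rewrite /g /bump /=; case: ifP => // _; ring.
rewrite [X in _ + X](_ : _ = g 1%N 0%N); last first.
  rewrite big_mkcond !big_ord_recl /= big1 ?addr0.
    by rewrite /g /bump /=; do ?case: ifP => // _; ring.
  by move=> k _; rewrite /g /bump /=; case: ifP => // _; ring.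
by rewrite /g /=; ring.
Qed.

End HolomorphicPolynomials.

(** * Flatness and evaluation at a point *)

Section FlatIdeals.
Variables (R : realType) (Omega : set 'rV[R]_4) (p : 'rV[R]_4).
Hypotheses (openO : open Omega) (Op : Omega p).
Notation S := (smooth_fun openO).
Notation nrm := (fun q : 'rV[R]_4 => `|q - p|).

Let FF : Filter (nbhs p). Proof. exact: nbhs_filter. Qed.

(** Each derivative halves the order of vanishing that is under control, whence
    the powers of two. *)
Definition flat_to (n : nat) (a : S) := bigO (nbhs p) nrm (2 ^ n) a.

Lemma smooth_bounded (a : S) : bigO (nbhs p) nrm 0 a.
Proof.
have [s1 s2] := smvalP a.
have H1 := taylor_bigO openO 0 Op s1; have H2 := taylor_bigO openO 0 Op s2.
apply: bigO_eq (bigOD FF H1 (bigOZ FF 'i%C H2)) => q.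
rewrite !big_ord0 !subr0; apply: eqC; rewrite ?ReD ?ImD ?ReM ?ImM /=; ring.
Qed.

Lemma flat_to_ideal n : ideal (flat_to n).
Proof.
have NO : \forall q \near p, Omega q by apply: near_Omega.
split.
- apply: bigO_eq (bigO0 FF nrm _) => q; by rewrite (sm0 openO q).
- move=> a b Ha Hb; apply: (bigO_near FF _ (bigOD FF Ha Hb)).
  by near=> q; rewrite smD //; near: q.
- move=> a b Hb; apply: (bigO_near FF _ (bigOM FF (smooth_bounded a) Hb)).
  by near=> q; rewrite smM //; near: q.
Unshelve. all: by end_near. Qed.

Lemma flat_pd n i (a : S) : flat_to n.+1 a -> bigO (nbhs p) nrm (2 ^ n) (sm_pd i a).
Proof.
move=> [C HC].
have [s1 s2] := smvalP a.
have NO : \forall q \near p, Omega q by apply: near_Omega.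
have e2 : (2 ^ n.+1 = (2 ^ n).*2)%N by rewrite expnS mul2n.
have [C1 H1] : exists C : R, \forall q \near p,
    `|'D_(delta_mx 0 i) (fun x => complex.Re (a x)) q| <= C * nrm q ^+ (2 ^ n).
  apply: (flat_partial openO i Op s1); exists C; near=> q.
  apply: le_trans (modulus_Re _) _; rewrite -e2; by near: q.
have [C2 H2] : exists C : R, \forall q \near p,
    `|'D_(delta_mx 0 i) (fun x => complex.Im (a x)) q| <= C * nrm q ^+ (2 ^ n).
  apply: (flat_partial openO i Op s2); exists C; near=> q.
  apply: le_trans (modulus_Im _) _; rewrite -e2; by near: q.
exists (C1 + C2); near=> q.
have Oq : Omega q by near: q.
rewrite mksmE //; apply: le_trans (modulus_le_ReIm _) _; rewrite mulrDl.
by apply: lerD; near: q.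
Unshelve. all: by end_near. Qed.

Lemma flat_wirt n i j s (a : S) : flat_to n.+1 a -> flat_to n (sm_wirt i j s a).
Proof.
move=> Ha; have idn := flat_to_ideal n.
rewrite /sm_wirt; apply: (idealMr idn); apply: (idealD idn); first exact: flat_pd.
by apply: (idealMl idn); apply: flat_pd.
Qed.

Lemma flat_to_vanish (a : S) : flat_to 0 a -> a p = 0.
Proof.
move=> [C HC]; apply: modulus_eq0; apply/le_anti; rewrite modulus_ge0 andbT.
by have := nbhs_singleton HC; rewrite /= subrr normr0 expn0 expr1 mulr0.
Qed.

End FlatIdeals.

Section Evaluation.
Variables (R : realType) (Omega : set 'rV[R]_4) (rho : 'rV[R]_4 -> R) (p : 'rV[R]_4).
Hypotheses (openO : open Omega) (srho : smooth_on Omega rho) (Op : Omega p).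
Notation S := (smooth_fun openO).

Definition eval_at (_ : Omega p) (a : S) : R[i] := a p.

Lemma eval_at_zmod : zmod_morphism (eval_at Op).
Proof. by move=> a b; rewrite /eval_at (smD a (- b) Op) (smN b Op). Qed.
Lemma eval_at_monoid : monoid_morphism (eval_at Op).
Proof.
by split=> [|a b]; rewrite /eval_at; [exact: (sm1 openO Op)|exact: (smM a b Op)].
Qed.
HB.instance Definition _ := GRing.isZmodMorphism.Build S R[i] (eval_at Op) eval_at_zmod.
HB.instance Definition _ := GRing.isMonoidMorphism.Build S R[i] (eval_at Op) eval_at_monoid.

Notation rhoS := (sm_real openO srho).
Notation Dz := (@dz R Omega openO).
Notation Dzb := (@dzb R Omega openO).
Notation Dw := (@dw R Omega openO).
Notation Dwb := (@dwb R Omega openO).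

Lemma rhoSE q : Omega q -> cplx_fun rho q = rhoS q.
Proof. by move=> Oq; rewrite mksmE. Qed.

Lemma Lbar_eq f (a : S) q : (forall x, Omega x -> f x = a x) -> Omega q ->
  Lbar rho f q = Lb Dzb Dwb rhoS a q.
Proof.
move=> E Oq; rewrite /Lbar /Lb.
refine (etrans _ (esym (smD _ _ Oq))).
refine (etrans _ (esym (congr2 +%R (smM _ _ Oq) (smM _ _ Oq)))).
refine (etrans _ (esym (congr2 +%R (congr2 *%R (smN _ Oq) (erefl _)) (erefl _)))).
by rewrite (d_zbar_eq rhoSE Oq) (d_wbar_eq rhoSE Oq) (d_zbar_eq E Oq) (d_wbar_eq E Oq).
Qed.

Lemma ZZ_eval (x y z s t : S) q : Omega q ->
  (x * t ^+ 2 - 2%:R * y * s * t + z * s ^+ 2) q =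
  x q * t q ^+ 2 - 2 * y q * s q * t q + z q * s q ^+ 2.
Proof.
move=> Oq; rewrite (smD _ _ Oq); congr (_ + _).
  rewrite (smD _ _ Oq) (smN _ Oq); congr (_ - _).
    by rewrite (smM _ _ Oq) (smX _ 2 Oq).
  rewrite !(smM _ _ Oq); congr (_ * _ * _ * _).
  by rewrite (sm_natmul 1 2 Oq) (sm1 openO Oq).
by rewrite (smM _ _ Oq) (smX _ 2 Oq).
Qed.

Lemma A3col_eq i q : Omega q -> nth (fun=> 0) (A3_col rho) i q = (A3col Dz Dw rhoS)`_i q.
Proof.
move=> Oq.
have hz q' : Omega q' -> d_z (cplx_fun rho) q' = Dz rhoS q' by exact: (d_z_eq rhoSE).
have hw q' : Omega q' -> d_w (cplx_fun rho) q' = Dw rhoS q' by exact: (d_w_eq rhoSE).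
have hzz := d_z_eq hz Oq; have hwz := d_w_eq hz Oq; have hww := d_w_eq hw Oq.
have {}hz := hz q Oq; have {}hw := hw q Oq.
case: i => [|[|[|[|[|i]]]]]; last by rewrite !nth_default // (sm0 openO q).
- exact: (etrans (congr1 (fun x => x ^+ 3) hw) (esym (smX _ 3 Oq))).
- refine (etrans (congr2 (fun x y => x * y ^+ 2) hz hw) _).
  exact: (esym (etrans (smM _ _ Oq) (congr1 _ (smX _ 2 Oq)))).
- refine (etrans (congr2 (fun x y => x ^+ 2 * y) hz hw) _).
  exact: (esym (etrans (smM _ _ Oq) (congr1 ( *%R ^~ _) (smX _ 2 Oq)))).
- exact: (etrans (congr1 (fun x => x ^+ 3) hz) (esym (smX _ 3 Oq))).
refine (etrans _ (esym (ZZ_eval _ _ _ _ _ Oq))).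
have cg (x y z s t x' y' z' s' t' : R[i]) : x = x' -> y = y' -> z = z' -> s = s' -> t = t' ->
    x * t ^+ 2 - 2 * y * s * t + z * s ^+ 2 = x' * t' ^+ 2 - 2 * y' * s' * t' + z' * s' ^+ 2.
  by move=> -> -> -> -> ->.
exact: cg hzz hwz hww hz hw.
Qed.

Lemma iter_Lbar_eq j f (a : S) q : (forall x, Omega x -> f x = a x) -> Omega q ->
  iter j (Lbar rho) f q = iter j (Lb Dzb Dwb rhoS) a q.
Proof.
move=> E; elim: j q => [|j IH] q Oq; first exact: E.
by rewrite !iterS; apply: Lbar_eq.
Qed.

Lemma A3_eval : A3 rho p = map_mx (eval_at Op) (A3ring Dz Dzb Dw Dwb rhoS).
Proof.
apply/matrixP => i j; rewrite !mxE; apply: iter_Lbar_eq Op => q Oq.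
exact: A3col_eq.
Qed.

End Evaluation.

(** * The determinant and the coefficient of a normal form *)

Lemma det_mul_eq0 (K : fieldType) n (A B C : 'M[K]_n) :
  A = B *m C -> \det C != 0 -> \det A = 0 <-> \det B = 0.
Proof.
move=> -> C0; rewrite det_mulmx; split=> [/eqP|->]; last by rewrite mul0r.
by rewrite mulf_eq0 (negbTE C0) orbF => /eqP.
Qed.

Section NormalFormCoefficient.
Variables (R : realType) (Omega : set 'rV[R]_4) (rho : 'rV[R]_4 -> R) (p : 'rV[R]_4).
Hypotheses (openO : open Omega) (srho : smooth_on Omega rho) (Op : Omega p).
Hypothesis rho0 : rho p = 0.
Variable ch : adapted_chart Omega rho p.
Variables (F G : nat -> nat -> R[i]) (phi : nat -> nat -> nat -> R[i]) (N : nat).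
Hypotheses (FG : formal_coords F G) (CM : chern_moser_normal phi) (N127 : (127 <= N)%N).
Hypothesis given : formally_given_by (zero_locus Omega rho) p F G phi.

Notation S := (smooth_fun openO).
Notation cst := (sm_cst openO).
Notation M := (zero_locus Omega rho).
Notation nrm := (fun q : 'rV[R]_4 => `|q - p|).
Notation rhoS := (sm_real openO srho).
Notation Dz := (@dz R Omega openO).
Notation Dzb := (@dzb R Omega openO).
Notation Dw := (@dw R Omega openO).
Notation Dwb := (@dwb R Omega openO).
Notation ev := (eval_at (openO := openO) Op).

Lemma zetabE q : Omega q -> zetab openO p q = (zcoord (q - p))^*%C.
Proof.
move=> Oq; rewrite smD // smN // smM // !mksmE // /zcoord; apply: eqC; rewrite /=; ring.
Qed.
Lemma omegaE q : Omega q -> omega openO p q = wcoord (q - p).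
Proof.
move=> Oq; rewrite smD // smM // !mksmE // /wcoord; apply: eqC; rewrite /=; ring.
Qed.
Lemma omegabE q : Omega q -> omegab openO p q = (wcoord (q - p))^*%C.
Proof.
move=> Oq; rewrite smD // smN // smM // !mksmE // /wcoord; apply: eqC; rewrite /=; ring.
Qed.

Let cc : R[i] := - 'i%C / 2.
Let Fs : S := trunc_at N F (zeta openO p) (omega openO p).
Let Gs : S := trunc_at N G (zeta openO p) (omega openO p).
Let Fbs : S := trunc_at N (fun j k => (F j k)^*%C) (zetab openO p) (omegab openO p).
Let Gbs : S := trunc_at N (fun j k => (G j k)^*%C) (zetab openO p) (omegab openO p).
Let phis k l m : S := cst (phi k l m).
Let nfs : S := nf Fs Gs Fbs Gbs (cst 2^-1) (cst cc) N phis.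

Lemma hol_trunc_conj (H : nat -> nat -> R[i]) x y :
  hol_trunc N (fun j k => (H j k)^*%C) x^*%C y^*%C = (hol_trunc N H x y)^*%C.
Proof.
rewrite /hol_trunc rmorph_sum; apply: eq_bigr => j _; rewrite rmorph_sum.
by apply: eq_bigr => k _; rewrite !rmorphM !rmorphXn.
Qed.

Lemma FsE q : Omega q -> Fs q = hol_trunc N F (zcoord (q - p)) (wcoord (q - p)).
Proof. by move=> Oq; rewrite /Fs trunc_atE // zetaE // omegaE. Qed.
Lemma GsE q : Omega q -> Gs q = hol_trunc N G (zcoord (q - p)) (wcoord (q - p)).
Proof. by move=> Oq; rewrite /Gs trunc_atE // zetaE // omegaE. Qed.
Lemma FbsE q : Omega q -> Fbs q = (Fs q)^*%C.
Proof. by move=> Oq; rewrite FsE // /Fbs trunc_atE // zetabE // omegabE // hol_trunc_conj. Qed.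
Lemma GbsE q : Omega q -> Gbs q = (Gs q)^*%C.
Proof. by move=> Oq; rewrite GsE // /Gbs trunc_atE // zetabE // omegabE // hol_trunc_conj. Qed.

Lemma Im_conjE (x : R[i]) : (x - x^*%C) * cc = (complex.Im x)%:C%C.
Proof.
rewrite /cc; have -> : 2^-1 = (2^-1 : R)%:C%C :> R[i] by rewrite fmorphV rmorph_nat.
by case: x => a b; apply: eqC => /=; field.
Qed.

Lemma Re_conjE (x : R[i]) : (x + x^*%C) * 2^-1 = (complex.Re x)%:C%C.
Proof.
have -> : 2^-1 = (2^-1 : R)%:C%C :> R[i] by rewrite fmorphV rmorph_nat.
by case: x => a b; apply: eqC => /=; field.
Qed.

Lemma nfsE q : Omega q -> nfs q =
  (complex.Im (Gs q))%:C%C - phi_trunc N phi (Fs q) (complex.Re (Gs q)).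
Proof.
move=> Oq; rewrite /nfs /nf.
rewrite (smD _ _ Oq) (smN _ Oq) (smM _ _ Oq) (smD _ _ Oq) (smN _ Oq) (sm_cstE openO cc Oq) GbsE // Im_conjE.
congr (_ - _); rewrite /phi_der /poly_der sm_sum //; apply: eq_bigr => k _.
rewrite sm_sum //; apply: eq_bigr => l _; rewrite sm_sum //; apply: eq_bigr => m _.
rewrite !ffactn0 !muln1 mulr1n !subn0 (smM _ _ Oq) (smX _ _ Oq) (smM _ _ Oq) (smX _ _ Oq) (smM _ _ Oq) (smX _ _ Oq).
rewrite (sm_cstE openO _ Oq) FbsE // /realG (smM _ _ Oq) (smD _ _ Oq) (sm_cstE openO _ Oq) GbsE //.
by rewrite Re_conjE.
Qed.

Let FF : Filter (nbhs p). Proof. exact: nbhs_filter. Qed.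
Let FMF : Filter (within M (nbhs p)). Proof. exact: within_filter. Qed.
Let n01 : \forall q \near p, 0 <= nrm q <= 1. Proof. exact: near_nrm01. Qed.

(** Six levels of flatness take [2^6 = 64] orders in the distance to [p], that is
    128 in the gauge. *)
Lemma nfs_small : bigO (within M (nbhs p)) nrm 128 nfs.
Proof.
have W01 : \forall q \near within M (nbhs p), 0 <= nrm q <= 1 by apply: cvg_within; apply: n01.
apply: (bigO_le FMF W01 (_ : 128 <= N.+1)%N) => //.
have [C HC] := given N; exists C.
have NO : \forall q \near within M (nbhs p), Omega q.
  by apply: cvg_within; apply: near_Omega.
near=> q.
have Oq : Omega q by near: q.
rewrite nfsE // FsE // GsE // -le_normcE; by near: q.
Unshelve. all: by end_near. Qed.

(** The truncated equation vanishes along the hypersurface to high order, hence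
    it is a multiple of [rho] up to a flat error. *)
Lemma nfs_divisible : exists h : S, flat_to p 6 (nfs - h * rhoS).
Proof.
have [h [s [sh ws Hs]]] := smooth_divisible openO Op ch 256 (smvalP nfs).
have g01 := near_gauge01 ch.
have W01 : \forall q \near within M (nbhs p), 0 <= gauge (ch_z ch) (ch_w ch) q <= 1.
  by apply: cvg_within; apply: g01.
have wle A : nbhs p A -> within M (nbhs p) A by move=> HA; apply: filterS HA => x Ax _.
have sM : bigO (within M (nbhs p)) (gauge (ch_z ch) (ch_w ch)) 128
    (fun q => s (ch_z ch q) (ucoord (ch_w ch) q)).
  have A := bigO_nrm_gauge ch FMF wle nfs_small.
  have B := bigO_le FMF W01 (isT : (128 <= 256)%N) (bigO_within Hs).
  apply: (bigO_near FMF _ (bigOB FMF A B)).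
  apply: (@filterS _ (nbhs p) _ setT) => [q _ Mq|]; last exact: filterT.
  by have [_ ->] := Mq; rewrite mulr0 subr0 subKr.
have ws' := wpol_order openO srho Op ws sM.
have sO := weighted_bigO (wpol_weighted ch ws').
exists (mksm openO sh).
have K := bigOD FF (bigO_le FF g01 (isT : (128 <= 256)%N) Hs) sO.
have K' := bigO_gauge_nrm (k := 64) FF (fun A H => H) K.
have NO : \forall q \near p, Omega q by apply: near_Omega.
apply: (bigO_near FF _ K').
near=> q; have Oq : Omega q by near: q.
rewrite (smD _ _ Oq) (smN _ Oq) (smM _ _ Oq) (mksmE openO sh Oq) -(rhoSE openO srho Oq).
by rewrite /cplx_fun subrK.
Unshelve. all: by end_near. Qed.

Lemma trunc_holpoly (H : nat -> nat -> R[i]) :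
  holpoly p (trunc_at N H (zeta openO p) (omega openO p)).
Proof.
apply: holpoly_sum => j _; apply: holpoly_sum => k _.
apply: holpolyM; last by apply: holpolyX; apply: holpoly_omega.
by apply: holpolyM; [apply: holpoly_cst|apply: holpolyX; apply: holpoly_zeta].
Qed.

Lemma trunc_aholpoly (H : nat -> nat -> R[i]) :
  aholpoly p (trunc_at N H (zetab openO p) (omegab openO p)).
Proof.
apply: aholpoly_sum => j _; apply: aholpoly_sum => k _.
apply: aholpolyM; last by apply: aholpolyX; apply: aholpoly_omegab.
by apply: aholpolyM; [apply: aholpoly_cst|apply: aholpolyX; apply: aholpoly_zetab].
Qed.

Lemma coord_p : [/\ zeta openO p p = 0, omega openO p p = 0, zetab openO p p = 0 & omegab openO p p = 0].
Proof.
by split; rewrite ?zetaE ?omegaE ?zetabE ?omegabE // subrr /zcoord /wcoord !mxE //;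
  apply: eqC => //=; rewrite oppr0.
Qed.

Lemma hol_trunc0 (H : nat -> nat -> R[i]) : hol_trunc N H 0 0 = H 0%N 0%N.
Proof.
have nz (j : 'I_N.+1) : j != ord0 -> 0 ^+ j = 0 :> R[i].
  by rewrite -(inj_eq val_inj) expr0n /= => /negbTE ->.
rewrite /hol_trunc (bigD1 ord0) //= [X in _ + X]big1 ?addr0; last first.
  by move=> j j0; apply: big1 => k _; rewrite nz // mulr0 mul0r.
rewrite (bigD1 ord0) //= big1 ?addr0; last first.
  by move=> k /andP[_ k0]; rewrite [X in _ * X]nz // mulr0.
by rewrite !expr0 !mulr1.
Qed.

Lemma zcoord0 : zcoord (p - p) = 0 /\ wcoord (p - p) = 0.
Proof. by rewrite subrr /zcoord /wcoord !mxE. Qed.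

Lemma Fs_p : Fs p = 0.
Proof.
have [z0 w0] := zcoord0; rewrite FsE // z0 w0 hol_trunc0.
by case: FG.
Qed.
Lemma Gs_p : Gs p = 0.
Proof.
have [z0 w0] := zcoord0; rewrite GsE // z0 w0 hol_trunc0.
by case: FG.
Qed.

Lemma derivs_p (H : nat -> nat -> R[i]) (Hs := trunc_at N H (zeta openO p) (omega openO p))
    (Hbs := trunc_at N (fun j k => (H j k)^*%C) (zetab openO p) (omegab openO p)) :
  [/\ Dz Hs p = H 1%N 0%N, Dw Hs p = H 0%N 1%N,
      Dzb Hbs p = (H 1%N 0%N)^*%C & Dwb Hbs p = (H 0%N 1%N)^*%C].
Proof.
have [c1 c2 c3 c4] := coord_p; have N0 : (0 < N)%N by apply: leq_trans N127.
split.
- rewrite (trunc_at_der Op _ (dz_derivation openO) _ c1 c2 N0); last exact: sm_wirt_cst.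
  by rewrite dz_zeta dz_omega (sm1 openO Op) (sm0 openO p) mulr1 mulr0 addr0.
- rewrite (trunc_at_der Op _ (dw_derivation openO) _ c1 c2 N0); last exact: sm_wirt_cst.
  by rewrite dw_zeta dw_omega (sm1 openO Op) (sm0 openO p) mulr1 mulr0 add0r.
- rewrite (trunc_at_der Op _ (dzb_derivation openO) _ c3 c4 N0); last exact: sm_wirt_cst.
  by rewrite dzb_zetab dzb_omegab (sm1 openO Op) (sm0 openO p) mulr1 mulr0 addr0.
- rewrite (trunc_at_der Op _ (dwb_derivation openO) _ c3 c4 N0); last exact: sm_wirt_cst.
  by rewrite dwb_zetab dwb_omegab (sm1 openO Op) (sm0 openO p) mulr1 mulr0 add0r.
Qed.

Lemma cst_scalar c : scalar Dz Dzb Dw Dwb (cst c).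
Proof. by split; apply: sm_wirt_cst. Qed.

Lemma ev_flat_mod (a : S) : flat_mod (@flat_to R Omega p openO) rhoS 0 a -> ev a = 0.
Proof.
move=> [c Hc]; have := flat_to_vanish Hc.
have Hr : rhoS p = 0 by rewrite mksmE // /cplx_fun rho0.
rewrite (smD _ _ Op) (smN _ Op) (smM _ _ Op) Hr mulr0 subr0 //.
Qed.

Lemma conjC_eq0 (x : R[i]) : x^*%C = 0 -> x = 0.
Proof. by move=> /(congr1 (fun y : R[i] => y^*%C)); rewrite conjcK rmorph0. Qed.

Lemma phi_trunc0 : (forall m, phi 0%N 0%N m = 0) -> phi_trunc N phi 0 0 = 0.
Proof.
move=> h; rewrite /phi_trunc big1 // => k _; rewrite big1 // => l _; rewrite big1 // => m _.
rewrite (rmorph0 (@conjc R)) !expr0n.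
case: k => [[|k] ?]; last by rewrite mulr0 !mul0r.
case: l => [[|l] ?]; last by rewrite !(mulr0, mul0r).
by rewrite h !mul0r.
Qed.

Lemma sm_jacE (a b c d : S) : (a * b - c * d) p = a p * b p - c p * d p.
Proof.
rewrite (smD _ _ Op); congr (_ + _); first exact: (smM a b Op).
refine (etrans (smN _ Op) _); congr (- _); exact: (smM c d Op).
Qed.

Lemma det_nfs_eq0 :
  (\det (map_mx ev (A3ring Dz Dzb Dw Dwb nfs)) = 0 <-> phi 2%N 4%N 0%N = 0) /\
  (ev (Dz nfs) = 0 -> ev (Dw nfs) = 0 -> False).
Proof.
case: FG => F0 G0 J0; case: CM => [herm [c11 [c0 [c1 c22]]]].
have [Fz Fw Fbz Fbw] := derivs_p F; have [Gz Gw Gbz Gbw] := derivs_p G.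
have jacE : ev (jac Dz Dw Fs Gs) = F 1%N 0%N * G 0%N 1%N - F 0%N 1%N * G 1%N 0%N.
  rewrite -Fz -Gw -Fw -Gz; exact: (sm_jacE (Dz Fs) (Dw Gs) (Dw Fs) (Dz Gs)).
have jacbE : ev (jacb Dzb Dwb Fbs Gbs) =
    (F 1%N 0%N)^*%C * (G 0%N 1%N)^*%C - (F 0%N 1%N)^*%C * (G 1%N 0%N)^*%C.
  rewrite -Fbz -Gbw -Fbw -Gbz; exact: (sm_jacE (Dzb Fbs) (Dwb Gbs) (Dwb Fbs) (Dzb Gbs)).
have HF := trunc_holpoly F; have HG := trunc_holpoly G.
have [Fz1 Fw1 Fc] := holpoly_der HF; have [Gz1 Gw1 Gc] := holpoly_der HG.
have [Fzz Fzw _] := holpoly_der Fz1; have [_ Fww _] := holpoly_der Fw1.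
have [Gzz Gzw _] := holpoly_der Gz1; have [_ Gww _] := holpoly_der Gw1.
have hol := @holpoly_hol R Omega p openO.
have fact : ev (phis 2 4 0) = phi 2%N 4%N 0%N by exact: (sm_cstE openO _ Op).
rewrite -fact.
have herm0 k m : phi k 0%N m = 0 by rewrite herm c0 rmorph0.
have h21 m : phi 2%N 1%N m = 0 by rewrite herm (c1 2%N m isT) rmorph0.
have h22 m : phi 2%N 2%N m = 0 by case: (c22 m).
have h23 m : phi 2%N 3%N m = 0 by case: (c22 m).
have e_of (a : S) c : a p = c -> ev a = c by [].
have cc0 : cc * (2 * 'i%C) = 1.
  rewrite /cc; have -> : - 'i%C / 2 * (2 * 'i%C) = - ('i%C * 'i%C) * (2 / 2) :> R[i] by ring.
  by rewrite (i2 R) opprK mul1r divff ?pnatr_eq0.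
apply: (@det_nf_eq0 S Dz Dzb Dw Dwb (dz_derivation openO) (dzb_derivation openO)
  (dw_derivation openO) (dwb_derivation openO) Fs Gs Fbs Gbs (cst 2^-1) (cst cc) N phis
  (cst_scalar _) (cst_scalar _) (fun k l m => cst_scalar _)
  (hol _ HF) (hol _ HG) (hol _ Fz1) (hol _ Fw1) (hol _ Gz1) (hol _ Gw1)
  (hol _ Fzz) (hol _ Fzw) (hol _ Fww) (hol _ Gzz) (hol _ Gzw) (hol _ Gww)
  (aholpoly_ahol (trunc_aholpoly _)) (aholpoly_ahol (trunc_aholpoly _))
  (cst (2 * 'i%C))).
- by rewrite -sm_cstM cc0 sm_cst1.
- by apply: leq_trans N127.
- by move=> k m; rewrite /phis c0 sm_cst0.
- by move=> m; rewrite /phis herm0 sm_cst0.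
- move=> m; rewrite /phis c11; case: eqP => _; [exact: sm_cst1|exact: sm_cst0].
- by move=> k m k2; rewrite /phis c1 // sm_cst0.
- case=> [|[|[|[|//]]]] m _; rewrite /phis.
  + by rewrite herm0 sm_cst0.
  + by rewrite h21 sm_cst0.
  + by rewrite h22 sm_cst0.
  + by rewrite h23 sm_cst0.
- exact: Fs_p.
- exact: Gs_p.
- by apply: e_of; rewrite (FbsE Op) Fs_p rmorph0.
- apply: e_of; rewrite (nfsE Op) Fs_p Gs_p.
  rewrite -[complex.Re 0]/(0 : R) -[complex.Im 0]/(0 : R) (phi_trunc0 (c0 0%N)).
  by rewrite subr0.
- by apply/eqP => j0; move/eqP: J0; apply; rewrite -jacE.
- apply/eqP => j0; move/eqP: J0; apply; apply: conjC_eq0.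
  by rewrite rmorphB !rmorphM -jacbE.
Qed.

(** The matrices of [rho] and of the normal form equation differ by a triangular
    factor whose diagonal consists of powers of [h p], which is not zero because
    the normal form equation has a nonzero differential. *)
Lemma det_A3_eq0_iff : \det (A3 rho p) = 0 <-> phi 2%N 4%N 0%N = 0.
Proof.
have [<- nreg] := det_nfs_eq0; rewrite (A3_eval openO srho Op).
have [h Hh] := nfs_divisible.
have FE n : (n <= 6)%N -> flat_to p n (nfs - h * rhoS).
  by move=> n6; apply: (bigO_le FF n01 _ Hh); rewrite leq_exp2l.
have dE i j s n (a : S) : flat_to p n.+1 a -> flat_to p n (sm_wirt i j s a).
  exact: flat_wirt.
have [C [C0 Cd CE]] := A3ring_rescale (dz_derivation openO) (dzb_derivation openO)
  (dw_derivation openO) (dwb_derivation openO) (flat_to_ideal openO Op)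
  (fun n a Ha => And4 (dE _ _ _ n a Ha) (dE _ _ _ n a Ha)
     (dE _ _ _ n a Ha) (dE _ _ _ n a Ha)) FE.
have E : map_mx ev (A3ring Dz Dzb Dw Dwb nfs) =
    map_mx ev (A3ring Dz Dzb Dw Dwb rhoS) *m map_mx ev C.
  rewrite -map_mxM; apply/matrixP => i j; have := ev_flat_mod (CE i j).
  by rewrite rmorphB => /subr0_eq X; rewrite mxE X [in RHS]mxE.
have der (d : S -> S) : derivation d ->
    (forall n a, flat_to p n.+1 a -> flat_to p n (d a)) -> ev (d nfs) = ev h * ev (d rhoS).
  move=> dP dfl; have := flat_mod_der (flat_to_ideal openO Op) dP dfl (FE 1%N isT).
  by move=> /ev_flat_mod /eqP; rewrite rmorphB rmorphM subr_eq0 => /eqP.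
(* were h to vanish at p, so would both derivatives of the normal form equation *)
have h0 : ev h != 0.
  apply/eqP => h0; apply: nreg.
    by rewrite (der _ (dz_derivation openO) (fun n a => dE _ _ _ n a)) h0 mul0r.
  by rewrite (der _ (dw_derivation openO) (fun n a => dE _ _ _ n a)) h0 mul0r.
have detC : \det (map_mx ev C) != 0.
  rewrite -det_tr det_trig; last first.
    by apply/is_trig_mxP => i j ij; rewrite !mxE (C0 _ _ ij) rmorph0.
  apply/prodf_neq0 => i _; rewrite !mxE Cd rmorphXn; exact: expf_neq0.
exact: (iff_sym (det_mul_eq0 E detC)).
Qed.

End NormalFormCoefficient.

(** * The linear step towards the normal form *)

Section TruncationLemmas.
Variable R : realType.
Implicit Types phi eta : nat -> nat -> nat -> R[i].

Lemma sum_ord_widen (V : nmodType) (h : nat -> V) n m : (n <= m)%N ->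
  (forall i, (n <= i)%N -> h i = 0) -> \sum_(i < n) h i = \sum_(i < m) h i.
Proof.
move=> nm h0; rewrite (big_ord_widen _ _ nm) big_mkcond; apply: eq_bigr => i _.
by case: ltnP => // /h0 ->.
Qed.

Lemma phi_trunc_box N K phi z u : (N <= K)%N -> phi_trunc N phi z u =
  \sum_(k < K.+1) \sum_(l < K.+1) \sum_(m < K.+1)
    (if (k + l + m <= N)%N then phi k l m else 0) * z ^+ k * z^*%C ^+ l * u%:C%C ^+ m.
Proof.
move=> NK; rewrite /phi_trunc.
pose t k l m : R[i] := (if (k + l + m <= N)%N then phi k l m else 0) * z ^+ k * z^*%C ^+ l * u%:C%C ^+ m.
have t0 k l m : (N < k + l + m)%N -> t k l m = 0.
  by move=> h; rewrite /t leqNgt h /= !mul0r.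
transitivity (\sum_(k < N.+1) \sum_(l < N.+1) \sum_(m < N.+1) t k l m).
  do 2!(apply: eq_bigr => ? _); rewrite big_mkcond; apply: eq_bigr => m _.
  by rewrite /t; case: ifP => // _; rewrite !mul0r.
have NK1 : (N.+1 <= K.+1)%N by [].
rewrite (sum_ord_widen (h := fun k => \sum_(l < N.+1) \sum_(m < N.+1) t k l m) NK1); last first.
  by move=> k Nk; rewrite big1 // => l _; rewrite big1 // => m _; apply: t0; lia.
apply: eq_bigr => k _.
rewrite (sum_ord_widen (h := fun l => \sum_(m < N.+1) t k l m) NK1); last first.
  by move=> l Nl; rewrite big1 // => m _; apply: t0; lia.
apply: eq_bigr => l _.
by rewrite (sum_ord_widen (h := fun m => t k l m) NK1) // => m Nm; apply: t0; lia.
Qed.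

Lemma phi_truncD N phi eta z u :
  phi_trunc N (fun k l m => phi k l m + eta k l m) z u = phi_trunc N phi z u + phi_trunc N eta z u.
Proof.
rewrite /phi_trunc -big_split; apply: eq_bigr => k _; rewrite -big_split.
by apply: eq_bigr => l _; rewrite -big_split; apply: eq_bigr => m _; rewrite /= !mulrDl.
Qed.

Lemma phi_trunc_le N K phi z u : (N <= K)%N ->
  (forall k l m, (N < k + l + m)%N -> phi k l m = 0) -> phi_trunc K phi z u = phi_trunc N phi z u.
Proof.
move=> NK h; rewrite (phi_trunc_box phi z u (leqnn K)) (phi_trunc_box phi z u NK).
do 3!(apply: eq_bigr => ? _); congr (_ * _ * _ * _).
by case: leqP => // h1; case: leqP => // h2; rewrite h // (leq_ltn_trans NK).
Qed.

Definition delta_arr (c : R[i]) (a b n : nat) : nat -> nat -> nat -> R[i] :=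
  fun k l m => if (k == a) && (l == b) && (m == n) then c else 0.

Lemma phi_trunc_delta N c a b n z u : (a + b + n <= N)%N ->
  phi_trunc N (delta_arr c a b n) z u = c * z ^+ a * z^*%C ^+ b * u%:C%C ^+ n.
Proof.
move=> H; rewrite (phi_trunc_box _ _ _ (leqnn N)) /delta_arr.
have la : (a < N.+1)%N by lia.
have lb : (b < N.+1)%N by lia.
have ln : (n < N.+1)%N by lia.
rewrite (bigD1 (Ordinal la)) //= [X in _ + X]big1 ?addr0; last first.
  move=> k; rewrite -(inj_eq val_inj) /= => /negbTE ka; rewrite big1 // => l _; rewrite big1 // => m _.
  by rewrite ka /= if_same !mul0r.
rewrite (bigD1 (Ordinal lb)) //= [X in _ + X]big1 ?addr0; last first.
  move=> l; rewrite -(inj_eq val_inj) /= => /negbTE lb'; rewrite big1 // => m _.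
  by rewrite lb' andbF /= if_same !mul0r.
rewrite (bigD1 (Ordinal ln)) //= [X in _ + X]big1 ?addr0; last first.
  move=> m; rewrite -(inj_eq val_inj) /= => /negbTE mn.
  by rewrite mn andbF if_same !mul0r.
by rewrite !eqxx H.
Qed.

End TruncationLemmas.

Section Cancellations.
Variables (A : comPzRingType) (J : {rmorphism A -> A}).

(** The identities behind the cancellations below.  Conjugation is an abstract
    morphism [J], and [w], [w1], [w2] are powers of [u + i |z|^2] with tails
    [t], [t1], [t2]. *)
Lemma cancel22 (i z u c gam k n um w t : A) :
  J (J z) = z -> J i = - i -> i * i = -1 -> J u = u -> J um = um -> J n = n -> J gam = gam ->
  J c = - c - gam * (2%:R * n) -> w = u * um + n * (i * z * J z) * um + t ->
  (k * 0 - J z * (i * gam * z ^+ 1 * w)) + J (k * 0 - J z * (i * gam * z ^+ 1 * w)) +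
  (c * z ^+ 2 * J z ^+ 2 * um + J (c * z ^+ 2 * J z ^+ 2 * um)) =
  - (i * gam) * z ^+ 1 * J z ^+ 1 * t + J (- (i * gam) * z ^+ 1 * J z ^+ 1 * t).
Proof.
move=> JJ Ji ii Ju Jm Jn Jg Jc ->.
rewrite !(rmorphB, rmorphD, rmorphN, rmorphM, rmorphXn, rmorph0) /= !JJ Ji Ju Jm Jn Jg Jc.
ring: ii.
Qed.

Lemma cancel32 (i z u c al be n n1 c2 um w1 w2 t1 t2 : A) :
  J (J z) = z -> J i = - i -> i * i = -1 -> J u = u -> J um = um ->
  J n = n -> J n1 = n1 -> J c2 = c2 -> J be = al -> J al = be ->
  c = - (2%:R * n * n1 * be) ->
  w1 = u ^+ 2 * um + n * (i * z * J z) * (u * um) + c2 * (i * z * J z) ^+ 2 * um + t1 ->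
  w2 = u * um + n1 * (i * z * J z) * um + t2 ->
  let x := be * z ^+ 1 * w1 - J z * (al * z ^+ 0 * w1 + 2%:R * i * n * be * z ^+ 2 * w2) in
  x + J x + (c * z ^+ 3 * J z ^+ 2 * um + J (c * z ^+ 3 * J z ^+ 2 * um)) =
  (be * z ^+ 1 * J z ^+ 0 * t1 + J (be * z ^+ 1 * J z ^+ 0 * t1)) +
  (- al * z ^+ 0 * J z ^+ 1 * t1 + J (- al * z ^+ 0 * J z ^+ 1 * t1)) +
  (- (2%:R * i * n * be) * z ^+ 2 * J z ^+ 1 * t2 + J (- (2%:R * i * n * be) * z ^+ 2 * J z ^+ 1 * t2)).
Proof.
move=> JJ Ji ii Ju Jm Jn Jn1 Jc2 Jb Ja -> -> -> /=.
rewrite !(rmorphB, rmorphD, rmorphN, rmorphM, rmorphXn, rmorph0, rmorph_nat) /= !JJ Ji Ju Jm Jn Jn1 Jc2 Jb Ja.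
ring: ii.
Qed.

Lemma cancel33 (i z u c s n n1 c2 c2' c3 um w1 w2 t1 t2 : A) :
  J (J z) = z -> J i = - i -> i * i = -1 -> J u = u -> J um = um ->
  J n = n -> J n1 = n1 -> J c2 = c2 -> J c2' = c2' -> J c3 = c3 -> J s = s ->
  J c = - c + 4%:R * s * c3 -> n * c2' = 3%:R * c3 ->
  w1 = u ^+ 3 * um + n * (i * z * J z) * (u ^+ 2 * um) + c2 * (i * z * J z) ^+ 2 * (u * um)
       + c3 * (i * z * J z) ^+ 3 * um + t1 ->
  w2 = u ^+ 2 * um + n1 * (i * z * J z) * (u * um) + c2' * (i * z * J z) ^+ 2 * um + t2 ->
  let x := i * s * z ^+ 0 * w1 - J z * (- (s * n) * z ^+ 1 * w2) in
  x + J x + (c * z ^+ 3 * J z ^+ 3 * um + J (c * z ^+ 3 * J z ^+ 3 * um)) =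
  (i * s * z ^+ 0 * J z ^+ 0 * t1 + J (i * s * z ^+ 0 * J z ^+ 0 * t1)) +
  (s * n * z ^+ 1 * J z ^+ 1 * t2 + J (s * n * z ^+ 1 * J z ^+ 1 * t2)).
Proof.
move=> JJ Ji ii Ju Jm Jn Jn1 Jc2 Jc2' Jc3 Js Jc nc -> -> /=.
rewrite !(rmorphB, rmorphD, rmorphN, rmorphM, rmorphXn, rmorph0, rmorph_nat) /= !JJ Ji Ju Jm Jn Jn1 Jc2 Jc2' Jc3 Js Jc.
ring: ii nc.
Qed.

End Cancellations.

Section LinearStep.
Variable R : realType.
Notation C := R[i].
Notation cc := (- 'i%C / 2 : C).

(** Polynomials in [(z, w)] as lists of monomials [(c, a, b)]. *)
Definition leval (A : comPzRingType) (iota : C -> A) (z w : A) (s : seq (C * nat * nat)) : A :=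
  \sum_(x <- s) iota x.1.1 * z ^+ x.1.2 * w ^+ x.2.

Definition all_weight k (s : seq (C * nat * nat)) :=
  all (fun x => (x.1.2 + 2 * x.2 == k) && (2 <= x.1.2 + x.2))%N s.

(** The last condition covers the coefficients [(2, 2)], [(2, 3)], [(3, 2)] and
    [(3, 3)], the others in its range being excluded by the previous one. *)
Definition normal_arr k (eta : nat -> nat -> nat -> C) :=
  [/\ forall a b m, eta b a m = (eta a b m)^*%C,
      forall a b m, (a + b + 2 * m)%N != k -> eta a b m = 0,
      forall a b m, (a < 2)%N -> eta a b m = 0 &
      forall a b m, (a < 4)%N -> (b < 4)%N -> eta a b m = 0].

(** The value of [w] on the quadric [Im w = |z|^2] over [(z, u)]. *)
Definition wmodel (z : C) (u : R) : C := u%:C%C + 'i%C * z * z^*%C.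

(** The linearization of the equation [Im w = |z|^2 + phi] at the quadric,
    applied to an infinitesimal change of coordinates [(f, g)]. *)
Definition lin (f g : seq (C * nat * nat)) (z : C) (u : R) : C :=
  let fv := leval id z (wmodel z u) f in let gv := leval id z (wmodel z u) g in
  cc * (gv - gv^*%C) - (z^*%C * fv + z * fv^*%C).

(** The terms [chi] can be removed by a change of coordinates, up to terms that a
    normal form may contain. *)
Definition solv k (chi : C -> R -> C) := exists f g eta,
  [/\ all_weight k.-1 f, all_weight k g, normal_arr k eta &
      forall z u, lin f g z u + chi z u = phi_trunc k eta z u].

Definition twice_re (x : C) := x + x^*%C.

Lemma leval_cat A iota z w s t : @leval A iota z w (s ++ t) = leval iota z w s + leval iota z w t.
Proof. by rewrite /leval big_cat. Qed.

Lemma lin_cat f g f' g' z u : lin (f ++ f') (g ++ g') z u = lin f g z u + lin f' g' z u.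
Proof. by rewrite /lin !leval_cat !rmorphD /=; ring. Qed.

Lemma solv_ext k chi chi' : (forall z u, chi z u = chi' z u) -> solv k chi -> solv k chi'.
Proof. by move=> E [f [g [eta [wf wg ne H]]]]; exists f, g, eta; split=> // z u; rewrite -E. Qed.

Lemma normal_arr0 k : normal_arr k (fun _ _ _ => 0).
Proof. by split=> // *; rewrite rmorph0. Qed.

Lemma normal_arrD k eta eta' : normal_arr k eta -> normal_arr k eta' ->
  normal_arr k (fun a b m => eta a b m + eta' a b m).
Proof.
move=> [h1 h2 h3 h4] [h1' h2' h3' h4']; split=> [a b m|a b m H|a b m H|a b m H H'].
- by rewrite h1 h1' rmorphD.
- by rewrite h2 // h2' // addr0.
- by rewrite h3 // h3' // addr0.
- by rewrite h4 // h4' // addr0.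
Qed.

Lemma phi_trunc_zero N z u : phi_trunc N (fun _ _ _ => 0) z u = 0 :> C.
Proof. by rewrite /phi_trunc; do 3!(rewrite big1 // => ? _); rewrite !mul0r. Qed.

Lemma solv0 k : solv k (fun _ _ => 0).
Proof.
exists [::], [::], (fun _ _ _ => 0); split => //; first exact: normal_arr0.
by move=> z u; rewrite phi_trunc_zero /lin /leval !big_nil rmorph0; ring.
Qed.

Lemma solvD k chi chi' : solv k chi -> solv k chi' -> solv k (fun z u => chi z u + chi' z u).
Proof.
move=> [f [g [eta [wf wg ne H]]]] [f' [g' [eta' [wf' wg' ne' H']]]].
exists (f ++ f'), (g ++ g'), (fun a b m => eta a b m + eta' a b m); split.
- by rewrite /all_weight all_cat; apply/andP.
- by rewrite /all_weight all_cat; apply/andP.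
- exact: normal_arrD.
by move=> z u; rewrite phi_truncD -H -H' lin_cat addrACA.
Qed.

Lemma solv_sum k n (h : nat -> C -> R -> C) : (forall i, (i < n)%N -> solv k (h i)) ->
  solv k (fun z u => \sum_(i < n) h i z u).
Proof.
elim: n => [|n IH] H; first by apply: solv_ext (solv0 k) => z u; rewrite big_ord0.
apply: solv_ext (solvD (IH (fun i h => H i (ltnW h))) (H n (ltnSn n))) => z u.
by rewrite big_ord_recr.
Qed.

Lemma solv_shift k f g chi chi' : all_weight k.-1 f -> all_weight k g ->
  (forall z u, lin f g z u + chi z u = chi' z u) -> solv k chi' -> solv k chi.
Proof.
move=> wf wg E [f' [g' [eta [wf' wg' ne H]]]].
exists (f ++ f'), (g ++ g'), eta; split=> //.
- by rewrite /all_weight all_cat; apply/andP.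
- by rewrite /all_weight all_cat; apply/andP.
by move=> z u; rewrite lin_cat -H -E; ring.
Qed.

Definition mono (c : C) a b m (z : C) (u : R) : C :=
  twice_re (c * z ^+ a * z^*%C ^+ b * u%:C%C ^+ m).

(* the terms of the expansion of w^n of degree at least r in |z|^2 *)
Definition tail r n (z : C) (u : R) : C := \sum_(j < n.+1 - r)
  'C(n, j + r)%:R * ('i%C * z * z^*%C) ^+ (j + r) * u%:C%C ^+ (n - (j + r)).

Lemma wmodelX r n z u : (r <= n.+1)%N -> wmodel z u ^+ n =
  \sum_(j < r) 'C(n, j)%:R * ('i%C * z * z^*%C) ^+ j * u%:C%C ^+ (n - j) + tail r n z u.
Proof.
move=> rn; rewrite /wmodel exprDn.
pose h j := 'C(n, j)%:R * ('i%C * z * z^*%C) ^+ j * u%:C%C ^+ (n - j).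
transitivity (\sum_(0 <= j < n.+1) h j).
  by rewrite big_mkord; apply: eq_bigr => j _; rewrite -mulr_natl /h; ring.
rewrite (big_cat_nat (leq0n r) rn) /= big_mkord; congr (_ + _).
rewrite -{1}[r]add0n big_addn big_mkord; apply: eq_bigr => j _ //.
Qed.

Lemma conj_R (u : R) : (u%:C%C : C)^*%C = u%:C%C.
Proof. by apply: eqC => /=; rewrite ?oppr0. Qed.

Lemma conj_RX (u : R) n : (u%:C%C ^+ n : C)^*%C = u%:C%C ^+ n.
Proof. by refine (etrans (rmorphXn (@conjc R) n _) _); congr (_ ^+ _); apply: conj_R. Qed.

Lemma conj_mono (c z : C) (u : R) a b m : (c * z ^+ a * z^*%C ^+ b * u%:C%C ^+ m)^*%C =
  c^*%C * z ^+ b * z^*%C ^+ a * u%:C%C ^+ m.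
Proof.
refine (etrans (rmorphM (@conjc R) _ _) _).
refine (etrans (congr2 *%R (rmorphM (@conjc R) _ _) (conj_RX u m)) _); congr (_ * _).
refine (etrans (congr2 *%R (rmorphM (@conjc R) _ _) erefl) _).
rewrite mulrAC; congr (_ * _ * _); last exact: (rmorphXn (@conjc R)).
by refine (etrans (rmorphXn (@conjc R) _ _) _); congr (_ ^+ _); apply: conjcK.
Qed.

Section Induction.
Variables (k m : nat).
Hypothesis IH : forall (c : C) a b n, (n < m)%N -> (a + b + 2 * n)%N = k -> solv k (mono c a b n).

Lemma solv_tail (c : C) a b r n : (n < m + r)%N -> (a + b + 2 * n)%N = k ->
  solv k (fun z u => twice_re (c * z ^+ a * z^*%C ^+ b * tail r n z u)).
Proof.
move=> nr E.
pose h j (z : C) u := mono (c * 'C(n, j + r)%:R * 'i%C ^+ (j + r)) (a + (j + r)) (b + (j + r)) (n - (j + r)) z u.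
have H : solv k (fun z u => \sum_(j < n.+1 - r) h j z u).
  by apply: solv_sum => j jn; apply: IH; lia.
apply: solv_ext H => z u; rewrite /tail mulr_sumr /twice_re rmorph_sum -big_split /=.
apply: eq_bigr => j _; rewrite /h /mono /twice_re; congr (_ + _^*%C);
  rewrite !exprMn !exprD; ring.
Qed.

End Induction.

Lemma conj_i : ('i%C : C)^*%C = - 'i%C.
Proof. by apply: eqC => /=; rewrite ?oppr0. Qed.

Lemma conj_cc : cc^*%C = - cc.
Proof.
have -> : 2^-1 = (2^-1 : R)%:C%C :> C by rewrite fmorphV rmorph_nat.
by apply: eqC => /=; ring.
Qed.

Lemma cc_neq0 : cc != 0.
Proof.
rewrite mulf_neq0 ?invr_eq0 ?pnatr_eq0 // oppr_eq0.
by apply/eqP => /(congr1 (@complex.Im R)) /eqP; rewrite /= oner_eq0.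
Qed.

Lemma twice_reD x y : twice_re (x + y) = twice_re x + twice_re y.
Proof. by rewrite /twice_re rmorphD /= addrACA. Qed.

Lemma linE f g z u : lin f g z u =
  twice_re (cc * leval id z (wmodel z u) g - z^*%C * leval id z (wmodel z u) f).
Proof.
rewrite /lin /twice_re; move: (leval _ _ _ g) (leval _ _ _ f) (cc) conj_cc => gv fv k kJ.
rewrite rmorphB !rmorphM [in RHS]/= kJ conjcK; ring.
Qed.

Lemma leval1 c a b (z w : C) : leval id z w [:: (c, a, b)] = c * z ^+ a * w ^+ b.
Proof. by rewrite /leval big_seq1. Qed.

Lemma leval0 (z w : C) : leval id z w [::] = 0.
Proof. by rewrite /leval big_nil. Qed.

Lemma leval2 c a b c' a' b' (z w : C) : leval id z w [:: (c, a, b); (c', a', b')] =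
  c * z ^+ a * w ^+ b + c' * z ^+ a' * w ^+ b'.
Proof. by rewrite /leval big_cons big_seq1. Qed.

Lemma all_weight1 k c a b : (a + 2 * b)%N = k -> (2 <= a + b)%N -> all_weight k [:: (c, a, b)].
Proof. by move=> h1 h2; rewrite /all_weight /= andbT; apply/andP; split; [apply/eqP|]. Qed.

Section Induction2.
Variables (k m : nat).
Hypothesis k3 : (3 <= k)%N.
Hypothesis IH : forall (c : C) a b n, (n < m)%N -> (a + b + 2 * n)%N = k -> solv k (mono c a b n).

(** Harmonic terms are removed by [g]. *)
Lemma solv_b0 (c : C) a : (a + 2 * m)%N = k -> solv k (mono c a 0 m).
Proof.
move=> E; apply: (@solv_shift k [::] [:: (- (c / cc), a, m)] _
   (fun z u => twice_re (- c * z ^+ a * z^*%C ^+ 0 * tail 1 m z u))).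
- by [].
- by apply: all_weight1 => //; lia.
- move=> z u; rewrite linE leval0 leval1 /mono -twice_reD (@wmodelX 1) // big_ord1.
  congr twice_re; rewrite bin0 subn0; move: (tail _ _ _ _) => t.
  move: (cc) cc_neq0 => k' k0'; rewrite expr0; by field.
by apply: (solv_tail IH); lia.
Qed.

(** Terms linear in the conjugate of [z] are removed by [f]. *)
Lemma solv_b1 (c : C) a : (0 < a)%N -> (a + 1 + 2 * m)%N = k -> solv k (mono c a 1 m).
Proof.
move=> a0 E; apply: (@solv_shift k [:: (c, a, m)] [::] _
   (fun z u => twice_re (- c * z ^+ a * z^*%C ^+ 1 * tail 1 m z u))).
- by apply: all_weight1; lia.
- by [].
- move=> z u; rewrite linE leval0 leval1 /mono -twice_reD (@wmodelX 1) // big_ord1.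
  congr twice_re; rewrite bin0 subn0; move: (tail _ _ _ _) => t; ring.
by apply: (solv_tail IH); lia.
Qed.

(** For real [gam], the leading term [i gam |z|^2 u^(m+1)] of the expansion
    contributes nothing to the real part, and the next one is a multiple of
    [|z|^4 u^m]. *)
Lemma solv_22 (c : C) : (4 + 2 * m)%N = k -> solv k (mono c 2 2 m).
Proof.
move=> E; pose gam : C := - (c + c^*%C) / (2 * m.+1%:R).
(* f = i gam z w^(m+1) contributes 2 gam (m + 1) |z|^4 u^m *)
have gamE : c^*%C = - c - gam * (2 * m.+1%:R).
  by rewrite /gam divfK ?mulf_neq0 ?pnatr_eq0 //; ring.
have gamJ : gam^*%C = gam.
  rewrite /gam rmorphM rmorphN rmorphD /= conjcK fmorphV rmorphM !rmorph_nat [in LHS]addrC //.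
apply: (@solv_shift k [:: ('i%C * gam, 1, m.+1)] [::] _
   (fun z u => twice_re (- ('i%C * gam) * z ^+ 1 * z^*%C ^+ 1 * tail 2 m.+1 z u))).
- by apply: all_weight1; lia.
- by [].
- move=> z u; rewrite linE leval0 leval1 /mono /twice_re.
  apply: (@cancel22 _ (@conjc R) _ _ _ _ _ _ m.+1%:R (u%:C%C ^+ m)) => //.
  + exact: conjcK.
  + exact: conj_i.
  + exact: i2.
  + exact: conj_R.
  + by rewrite rmorphXn; congr (_ ^+ _); apply: conj_R.
  + by rewrite rmorph_nat.
  rewrite (@wmodelX 2) // !big_ord_recr big_ord0 /= bin0 bin1 subn0 subSS subn0.
  by rewrite add0r expr0 expr1 mulr1 mul1r exprS.
by apply: (solv_tail IH); lia.
Qed.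

Lemma leval_scaled c a b (z w : C) : cc * leval id z w [:: (c / cc, a, b)] = c * z ^+ a * w ^+ b.
Proof. by rewrite leval1; move: (cc) cc_neq0 => k' k0; rewrite /=; field. Qed.

Lemma conj_nat n : (n%:R : C)^*%C = n%:R.
Proof. exact: (rmorph_nat (@conjc R)). Qed.

(** The coefficients of [f] and [g] are tied so that the terms
    [z |z|^2 u^(m+1)] cancel, [m + 2] being the exponent of [w]. *)
Lemma solv_32 (c : C) : (5 + 2 * m)%N = k -> solv k (mono c 3 2 m).
Proof.
move=> E; pose n : C := m.+2%:R; pose n1 : C := m.+1%:R.
pose be : C := - c / (2%:R * n * n1).
(* the part of f in z^2 w^(m+1), forced by the cancellation of the terms in
   z |z|^2 u^(m+1), contributes 2 n n1 be z^3 zb^2 u^m *)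
have cE : c = - (2%:R * n * n1 * be).
  by rewrite /be mulrC divfK ?opprK // !mulf_neq0 ?pnatr_eq0.
have H := solv_tail IH.
have S : solv k (fun z u => twice_re (be * z ^+ 1 * z^*%C ^+ 0 * tail 3 m.+2 z u) +
    twice_re (- be^*%C * z ^+ 0 * z^*%C ^+ 1 * tail 3 m.+2 z u) +
    twice_re (- (2%:R * 'i%C * n * be) * z ^+ 2 * z^*%C ^+ 1 * tail 2 m.+1 z u)).
  by apply: solvD; [apply: solvD|]; apply: H; lia.
apply: (@solv_shift k [:: (be^*%C, 0%N, m.+2); (2%:R * 'i%C * n * be, 2%N, m.+1)]
  [:: (be / cc, 1%N, m.+2)] _ _ _ _ _ S).
- by rewrite /all_weight /= andbT; lia.
- by rewrite /all_weight /= andbT; lia.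
move=> z u; rewrite linE leval_scaled leval2 /mono /twice_re.
apply: (@cancel32 _ (@conjc R) _ _ _ _ _ _ _ n1 'C(m.+2, 2)%:R (u%:C%C ^+ m)).
- exact: conjcK.
- exact: conj_i.
- exact: i2.
- exact: conj_R.
- exact: conj_RX.
- exact: conj_nat.
- exact: conj_nat.
- exact: conj_nat.
- by [].
- exact: conjcK.
- exact: cE.
- rewrite (@wmodelX 3) // !big_ord_recr big_ord0 /= bin0 bin1 subn0.
  have -> : (m.+2 - 1 = m.+1)%N by lia.
  have -> : (m.+2 - 2 = m)%N by lia.
  by rewrite (exprD _ 2 m : _ ^+ m.+2 = _) [_ ^+ m.+1]exprS add0r expr0 expr1 mulr1 mul1r.
- rewrite (@wmodelX 2) // !big_ord_recr big_ord0 /= bin0 bin1 subn0 subSS subn0.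
  by rewrite add0r expr0 expr1 mulr1 mul1r exprS.
Qed.

(** The same with a cancellation of [|z|^2 u^(m+2)]; the terms in [|z|^6 u^m]
    have the coefficient [2 'C(m + 3, 3)], which is not zero. *)
Lemma solv_33 (c : C) : (6 + 2 * m)%N = k -> solv k (mono c 3 3 m).
Proof.
move=> E; pose n : C := m.+3%:R; pose c3 : C := 'C(m.+3, 3)%:R.
have c30 : c3 != 0 by rewrite pnatr_eq0 -lt0n bin_gt0.
pose s : C := (c + c^*%C) / (4%:R * c3).
(* n 'C(m + 2, 2) = 3 c3 leaves - 4 s c3 |z|^6 u^m *)
have cE : c^*%C = - c + 4%:R * s * c3.
  have -> : 4%:R * s * c3 = s * (4%:R * c3) by ring.
  by rewrite /s divfK ?mulf_neq0 // ?pnatr_eq0 // addrA addNr add0r.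
have sJ : s^*%C = s.
  rewrite /s; refine (etrans (rmorphM (@conjc R) _ _) _); rewrite rmorphD /= conjcK addrC.
  by rewrite fmorphV rmorphM !rmorph_nat.
have H := solv_tail IH.
have S : solv k (fun z u => twice_re ('i%C * s * z ^+ 0 * z^*%C ^+ 0 * tail 4 m.+3 z u) +
    twice_re (s * n * z ^+ 1 * z^*%C ^+ 1 * tail 3 m.+2 z u)).
  by apply: solvD; apply: H; lia.
apply: (@solv_shift k [:: (- (s * n), 1%N, m.+2)] [:: ('i%C * s / cc, 0%N, m.+3)] _ _ _ _ _ S).
- by rewrite /all_weight /= andbT; lia.
- by rewrite /all_weight /= andbT; lia.
move=> z u; rewrite linE leval_scaled leval1 /mono /twice_re.
apply: (@cancel33 _ (@conjc R) _ _ _ _ _ _ m.+2%:R 'C(m.+3, 2)%:R 'C(m.+2, 2)%:R c3 (u%:C%C ^+ m)).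
- exact: conjcK.
- exact: conj_i.
- exact: i2.
- exact: conj_R.
- exact: conj_RX.
- exact: conj_nat.
- exact: conj_nat.
- exact: conj_nat.
- exact: conj_nat.
- exact: conj_nat.
- exact: sJ.
- exact: cE.
- by rewrite /n /c3 -!natrM mul_bin_diag.
- rewrite (@wmodelX 4) // !big_ord_recr big_ord0 /= bin0 bin1 subn0.
  have -> : (m.+3 - 1 = m.+2)%N by lia.
  have -> : (m.+3 - 2 = m.+1)%N by lia.
  have -> : (m.+3 - 3 = m)%N by lia.
  by rewrite (exprD _ 3 m : _ ^+ m.+3 = _) (exprD _ 2 m : _ ^+ m.+2 = _) [_ ^+ m.+1]exprS add0r expr0 expr1 mulr1 mul1r.
- rewrite (@wmodelX 3) // !big_ord_recr big_ord0 /= bin0 bin1 subn0.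
  have -> : (m.+2 - 1 = m.+1)%N by lia.
  have -> : (m.+2 - 2 = m)%N by lia.
  by rewrite (exprD _ 2 m : _ ^+ m.+2 = _) [_ ^+ m.+1]exprS add0r expr0 expr1 mulr1 mul1r.
Qed.

Lemma solv_normal (c : C) a b : (4 <= a)%N -> (2 <= b)%N -> (a + b + 2 * m)%N = k ->
  solv k (mono c a b m).
Proof.
move=> a4 b2 E; exists [::], [::], (fun x y n => delta_arr c a b m x y n + delta_arr c^*%C b a m x y n).
split=> //.
- split=> [x y n|x y n|x y n x2|x y n x4 y4]; rewrite /delta_arr.
  + rewrite addrC rmorphD; congr (_ + _); rewrite [X in X && _]andbC; case: ifP => _;
      by rewrite ?rmorph0 //= conjcK.
  + move=> xk; rewrite !ifF ?addr0 //; apply/negbTE/negP => /andP[/andP[/eqP h1 /eqP h2] /eqP h3];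
      by move/eqP: xk; lia.
  + by rewrite !ifF ?addr0 //; apply/negbTE/negP => /andP[/andP[/eqP h1 /eqP h2] /eqP h3]; lia.
  + by rewrite !ifF ?addr0 //; apply/negbTE/negP => /andP[/andP[/eqP h1 /eqP h2] /eqP h3]; lia.
- move=> z u; rewrite phi_truncD !phi_trunc_delta; try lia.
  rewrite linE !leval0 /mono /twice_re !mulr0 subr0 rmorph0 !add0r; congr (_ + _).
  by rewrite conj_mono.
Qed.

End Induction2.

(** Induction on the exponent of [u].  When [w] is replaced by [u + i |z|^2], the
    monomials chosen in [f] and [g] produce the term to be removed and terms with
    a smaller exponent of [u]. *)
Lemma solv_mono k : (3 <= k)%N -> forall m c a b, (a + b + 2 * m)%N = k -> solv k (mono c a b m).
Proof.
move=> k3 m; elim/ltn_ind: m => m IHm.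
have IH (c : C) a b n : (n < m)%N -> (a + b + 2 * n)%N = k -> solv k (mono c a b n).
  by move=> nm; apply: IHm.
suff H (c : C) a b : (b <= a)%N -> (a + b + 2 * m)%N = k -> solv k (mono c a b m).
  move=> c a b E; have [ba|ab] := leqP b a; first exact: H.
  have S : solv k (mono c^*%C b a m) by apply: H; lia.
  apply: solv_ext S => z u; rewrite /mono /twice_re [RHS]addrC.
  by rewrite !conj_mono conjcK.
case: b => [|[|b]] ba E.
- by apply: (solv_b0 k3 IH); lia.
- by apply: (solv_b1 k3 IH); lia.
have [a4|a4] := leqP 4 a; first by apply: solv_normal.
have : (a = 2%N /\ b = 0%N) \/ (a = 3%N /\ b = 0%N) \/ (a = 3%N /\ b = 1%N).
  by move: ba a4; clear; lia.
case=> [|[|]] [ea eb]; rewrite {}ea {}eb in E *.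
- by apply: (solv_22 k3 IH); lia.
- by apply: (solv_32 k3 IH); lia.
- by apply: (solv_33 k3 IH); lia.
Qed.

Lemma solv_whom k psi : (3 <= k)%N -> whom k psi -> solv k (fun z u => twice_re (psi z u)).
Proof.
move=> k3 H; elim: H k3 => {k psi} [k|c a b m|k psi chi _ IH1 _ IH2] k3.
- by apply: solv_ext (solv0 k) => z u; rewrite /twice_re rmorph0 addr0.
- exact: solv_mono.
- by apply: solv_ext (solvD (IH1 k3) (IH2 k3)) => z u; rewrite twice_reD.
Qed.

End LinearStep.

(** * Polynomial changes of coordinates *)

Section BivariatePolynomials.
Variable R : realType.
Notation C := R[i].
Notation P2 := {poly {poly C}}.
Implicit Types p q : P2.

Definition pol2_cst (c : C) : P2 := c%:P%:P.
Definition pol2_x : P2 := 'X.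
Definition pol2_y : P2 := 'X%:P.
Definition pol2_coef p a b : C := (p`_a)`_b.
(** The outer variable is [x], the inner one [y]. *)
Definition pol2_eval (x y : C) p : C := p.[x%:P].[y].

Lemma pol2_evalD x y p q : pol2_eval x y (p + q) = pol2_eval x y p + pol2_eval x y q.
Proof. by rewrite /pol2_eval !hornerE. Qed.
Lemma pol2_evalM x y p q : pol2_eval x y (p * q) = pol2_eval x y p * pol2_eval x y q.
Proof. by rewrite /pol2_eval !hornerM. Qed.
Lemma pol2_evalX x y p n : pol2_eval x y (p ^+ n) = pol2_eval x y p ^+ n.
Proof. by rewrite /pol2_eval !horner_exp. Qed.
Lemma pol2_eval_cst x y c : pol2_eval x y (pol2_cst c) = c.
Proof. by rewrite /pol2_eval !hornerC. Qed.
Lemma pol2_eval_x x y : pol2_eval x y pol2_x = x.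
Proof. by rewrite /pol2_eval hornerX hornerC. Qed.
Lemma pol2_eval_y x y : pol2_eval x y pol2_y = y.
Proof. by rewrite /pol2_eval hornerC hornerX. Qed.

Lemma pol2_eval_leval x y (z w : P2) (s : seq (C * nat * nat)) :
  pol2_eval x y (leval pol2_cst z w s) = leval id (pol2_eval x y z) (pol2_eval x y w) s.
Proof.
elim: s => [|t s IH]; first by rewrite /leval !big_nil /pol2_eval !horner0.
rewrite -cat1s !leval_cat pol2_evalD IH; congr (_ + _).
by rewrite /leval !big_seq1 !pol2_evalM !pol2_evalX pol2_eval_cst.
Qed.

Lemma pol2_coefD p q a b : pol2_coef (p + q) a b = pol2_coef p a b + pol2_coef q a b.
Proof. by rewrite /pol2_coef !coefD. Qed.

Definition pol2_order n p := forall a b, (a + b < n)%N -> pol2_coef p a b = 0.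

Lemma pol2_order_le m n p : (m <= n)%N -> pol2_order n p -> pol2_order m p.
Proof. by move=> mn H a b ab; apply: H; apply: leq_trans mn. Qed.

Lemma pol2_orderD n p q : pol2_order n p -> pol2_order n q -> pol2_order n (p + q).
Proof. by move=> Hp Hq a b ab; rewrite pol2_coefD Hp // Hq // addr0. Qed.

Lemma pol2_order0 n : pol2_order n 0.
Proof. by move=> a b _; rewrite /pol2_coef !coef0. Qed.

Lemma pol2_orderM m n p q : pol2_order m p -> pol2_order n q -> pol2_order (m + n) (p * q).
Proof.
move=> Hp Hq a b ab; rewrite /pol2_coef coefM coef_sum big1 // => i _.
rewrite coefM big1 // => j _; case: (ltnP (i + j) m) => ij.
  by rewrite [X in X * _](Hp _ _ ij) mul0r.
rewrite [X in _ * X]Hq ?mulr0 //; have := ltn_ord i; have := ltn_ord j; lia.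
Qed.

Lemma pol2_orderX m n p : pol2_order m p -> pol2_order (m * n) (p ^+ n).
Proof.
move=> H; elim: n => [|n IH]; first by rewrite muln0.
by rewrite mulnS exprS; apply: pol2_orderM.
Qed.

Lemma pol2_orderZ n c p : pol2_order n p -> pol2_order n (pol2_cst c * p).
Proof. by move=> H; rewrite -[n]add0n; apply: pol2_orderM. Qed.

Lemma pol2_order_leval n (z w : P2) s : pol2_order 1 z -> pol2_order 1 w ->
  all (fun x : C * nat * nat => n <= x.1.2 + x.2)%N s -> pol2_order n (leval pol2_cst z w s).
Proof.
move=> Hz Hw; elim: s => [|t s IH]; first by rewrite /leval big_nil => _; apply: pol2_order0.
move=> /= /andP[ht hs]; rewrite -cat1s leval_cat; apply: pol2_orderD; last exact: IH.
rewrite /leval big_seq1; apply: pol2_order_le ht _.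
have := pol2_orderM (@pol2_orderX 1 t.1.2 _ Hz) (@pol2_orderX 1 t.2 _ Hw); rewrite !mul1n.
by move=> /(@pol2_orderZ _ t.1.1); rewrite mulrA.
Qed.

Lemma pol2_order_x : pol2_order 1 pol2_x.
Proof.
by move=> [|a] [|b] // _; rewrite /pol2_coef coefX /= coef0.
Qed.
Lemma pol2_order_y : pol2_order 1 pol2_y.
Proof. by move=> [|a] [|b] // _; rewrite /pol2_coef coefC /= coefX. Qed.

Lemma pol2_coef_linear c d : let p := pol2_cst c * pol2_x + pol2_cst d * pol2_y in
  pol2_coef p 1 0 = c /\ pol2_coef p 0 1 = d.
Proof.
rewrite /= !pol2_coefD /pol2_coef /pol2_cst /pol2_x /pol2_y !coefCM !coefC !coefX /=.
have -> : (1 : {poly C})`_0 = 1 by rewrite polyseq1.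
rewrite coef0 (mulr0 d) (mulr0 c) (mulr1 c) (mulr1 d) addr0 add0r.
split; reflexivity.
Qed.

Lemma pol2_order1_linear c d : pol2_order 1 (pol2_cst c * pol2_x + pol2_cst d * pol2_y).
Proof.
by apply: pol2_orderD; apply: pol2_orderZ; [apply: pol2_order_x|apply: pol2_order_y].
Qed.

Lemma pol2_eval_box p : exists B, forall K, (B <= K)%N -> forall x y,
  pol2_eval x y p = \sum_(a < K) \sum_(b < K) pol2_coef p a b * x ^+ a * y ^+ b.
Proof.
pose B : nat := maxn (size p) (\max_(a < size p) size (p`_a)%R)%N.
exists B => K BK x y.
have sp : (size p <= K)%N by apply: leq_trans BK; apply: leq_maxl.
have spa a : (size (p`_a)%R <= K)%N.
  case: (ltnP a (size p)) => ha; last by rewrite nth_default // size_poly0.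
  apply: leq_trans BK; apply: leq_trans (leq_maxr _ _).
  exact: (leq_bigmax_cond (F := fun a : 'I_(size p) => size (p`_a)%R) (Ordinal ha)).
rewrite /pol2_eval (horner_coef_wide _ sp) horner_sum; apply: eq_bigr => a _.
rewrite hornerM -rmorphXn /= hornerC (horner_coef_wide _ (spa a)) mulr_suml.
by apply: eq_bigr => b _; rewrite mulrAC.
Qed.

Lemma hol_trunc_box N K (F : nat -> nat -> C) x y : (N < K)%N -> hol_trunc N F x y =
  \sum_(a < K) \sum_(b < K) (if (a + b <= N)%N then F a b else 0) * x ^+ a * y ^+ b.
Proof.
move=> NK; rewrite /hol_trunc.
pose t a b : C := (if (a + b <= N)%N then F a b else 0) * x ^+ a * y ^+ b.
have t0 a b : (N < a + b)%N -> t a b = 0.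
  by move=> h; rewrite /t leqNgt h /= !mul0r.
transitivity (\sum_(a < N.+1) \sum_(b < N.+1) t a b).
  apply: eq_bigr => ? _; rewrite big_mkcond; apply: eq_bigr => b _.
  by rewrite /t; case: ifP => // _; rewrite !mul0r.
rewrite (sum_ord_widen (h := fun a => \sum_(b < N.+1) t a b) NK); last first.
  by move=> a Na; rewrite big1 // => b _; apply: t0; lia.
apply: eq_bigr => a _; rewrite (sum_ord_widen (h := fun b => t a b) NK) // => b Nb; apply: t0; lia.
Qed.

End BivariatePolynomials.

Section Close.
Variables (R : realType) (T : Type) (F : set_system T) (FF : Filter F) (g : T -> R).
Hypothesis g01 : \forall q \near F, 0 <= g q <= 1.

(** The gain [d] of the difference over the order of the functions is preserved
    by products, so that weights can be added up in comparisons. *)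
Definition close a d (A B : T -> R[i]) :=
  [/\ bigO F g a A, bigO F g a B & bigO F g (a + d) (fun q => A q - B q)].

Lemma close_eq a d A B A' B' : A =1 A' -> B =1 B' -> close a d A B -> close a d A' B'.
Proof. by move=> /funext -> /funext ->. Qed.

Lemma close_cst d c : close 0 d (fun=> c) (fun=> c).
Proof.
split; [exact: bigO_cst|exact: bigO_cst|].
by apply: bigO_eq (bigO0 FF g (0 + d)) => q; rewrite subrr.
Qed.

Lemma closeM a b d A B A' B' : close a d A B -> close b d A' B' ->
  close (a + b) d (fun q => A q * A' q) (fun q => B q * B' q).
Proof.
move=> [h1 h2 h3] [h1' h2' h3']; split; [exact: bigOM|exact: bigOM|].
have e : (a + d + b = a + (b + d))%N by lia.
have := bigOM FF h3 h1'; rewrite e => X; have := bigOD FF X (bigOM FF h2 h3').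
by rewrite -addnA; apply: bigO_eq => q; ring.
Qed.

Lemma closeX a d A B n : close a d A B ->
  close (n * a) d (fun q => A q ^+ n) (fun q => B q ^+ n).
Proof.
move=> H; elim: n => [|n IH].
  by apply: close_eq (close_cst d 1) => q; rewrite expr0.
by rewrite mulSn; apply: close_eq (closeM H IH) => q; rewrite exprS.
Qed.

Lemma close_conj a d A B : close a d A B ->
  close a d (fun q => (A q)^*%C) (fun q => (B q)^*%C).
Proof.
move=> [h1 h2 h3]; split; [exact: bigO_conj|exact: bigO_conj|].
by apply: bigO_eq (bigO_conj FF h3) => q; rewrite rmorphB.
Qed.

Lemma bigO_R a (A : T -> R[i]) : bigO F g a A -> bigO F g a (fun q => (complex.Re (A q))%:C%C).
Proof.
move=> [K HK]; exists K; apply: filterS HK => q; apply: le_trans.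
by rewrite modulusR; exact: modulus_Re.
Qed.

Lemma close_Re a d A B : close a d A B ->
  close a d (fun q => (complex.Re (A q))%:C%C) (fun q => (complex.Re (B q))%:C%C).
Proof.
move=> [h1 h2 h3]; split; [exact: bigO_R|exact: bigO_R|].
apply: bigO_eq (bigO_R h3) => q; by case: (A q) (B q) => ? ? [? ?]; apply: eqC => /=; ring.
Qed.

End Close.

(** * Newton iteration *)

Section CloseSums.
Variables (R : realType) (T : Type) (F : set_system T) (FF : Filter F) (g : T -> R).
Hypothesis g01 : \forall q \near F, 0 <= g q <= 1.

Lemma close_intro a d (A B : T -> R[i]) :
  bigO F g a B -> bigO F g (a + d) (fun q => A q - B q) -> close F g a d A B.
Proof.
move=> hB hAB; split => //.
by apply: bigO_eq (bigOD FF (bigO_le FF g01 (leq_addr d a) hAB) hB) => q; rewrite subrK.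
Qed.

Lemma close_diff n a d (A B : T -> R[i]) : close F g a d A B -> (n <= a + d)%N ->
  bigO F g n (fun q => A q - B q).
Proof. by move=> [_ _ h] na; apply: bigO_le h. Qed.

(** Nearby arguments give nearby values of a truncated series, with a gain given
    by the weights of its monomials. *)
Lemma close_phi_trunc N j e d (phi : nat -> nat -> nat -> R[i]) (z z' w w' : T -> R[i]) :
  (forall a b m, (a + b + e * m < j)%N -> phi a b m = 0) ->
  close F g 1 d z z' -> close F g e d w w' ->
  bigO F g (j + d) (fun q => phi_trunc N phi (z q) (complex.Re (w q)) -
                             phi_trunc N phi (z' q) (complex.Re (w' q))).
Proof.
move=> ph Hz /(close_Re FF) Hw; rewrite /phi_trunc.
have H k l m : bigO F g (j + d) (fun q =>
    phi k l m * z q ^+ k * (z q)^*%C ^+ l * (complex.Re (w q))%:C%C ^+ m -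
    phi k l m * z' q ^+ k * (z' q)^*%C ^+ l * (complex.Re (w' q))%:C%C ^+ m).
  have [lt|ge] := ltnP (k + l + e * m) j.
    by apply: bigO_eq (bigO0 FF g _) => q; rewrite ph // !mul0r subrr.
  apply: close_diff; first by apply: (closeM FF (closeM FF (closeM FF (close_cst FF g d (phi k l m))
    (closeX FF k Hz)) (closeX FF l (close_conj FF Hz))) (closeX FF m Hw)).
  by rewrite add0n !muln1 [(m * e)%N]mulnC leq_add2r.
have S : bigO F g (j + d) (fun q => \sum_(k < N.+1) \sum_(l < N.+1)
   \sum_(m < N.+1 | (k + l + m <= N)%N)
    (phi k l m * z q ^+ k * (z q)^*%C ^+ l * (complex.Re (w q))%:C%C ^+ m -
     phi k l m * z' q ^+ k * (z' q)^*%C ^+ l * (complex.Re (w' q))%:C%C ^+ m)).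
  by do 3!(apply: (bigO_sum FF) => ? _); apply: H.
apply: bigO_eq S => q; rewrite -sumrB; apply: eq_bigr => k _.
by rewrite -sumrB; apply: eq_bigr => l _; rewrite -sumrB.
Qed.

Lemma close_leval k d (z z' w w' : T -> R[i]) s : all_weight k s ->
  close F g 1 d z z' -> close F g 2 d w w' ->
  close F g k d (fun q => leval id (z q) (w q) s) (fun q => leval id (z' q) (w' q) s).
Proof.
move=> + Hz Hw; elim: s => [|t s IH].
  move=> _; split; do ?[by apply: bigO_eq (bigO0 FF g _) => q; rewrite /leval big_nil].
  by apply: bigO_eq (bigO0 FF g _) => q; rewrite /leval !big_nil subrr.
move=> /= /andP[/andP[/eqP ht _] hs].
have [h1 h2 h3] := IH hs.
have := closeM FF (closeM FF (close_cst FF g d t.1.1) (closeX FF t.1.2 Hz)) (closeX FF t.2 Hw).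
rewrite add0n muln1 [(t.2 * 2)%N]mulnC ht => -[h1' h2' h3'].
split.
- by apply: bigO_eq (bigOD FF h1' h1) => q; rewrite /leval big_cons.
- by apply: bigO_eq (bigOD FF h2' h2) => q; rewrite /leval big_cons.
- by apply: bigO_eq (bigOD FF h3' h3) => q; rewrite /leval !big_cons opprD addrACA.
Qed.

End CloseSums.

Lemma phi_trunc_real (R : realType) N (phi : nat -> nat -> nat -> R[i]) z u :
  (forall a b m, phi b a m = (phi a b m)^*%C) ->
  (phi_trunc N phi z u)^*%C = phi_trunc N phi z u.
Proof.
move=> herm; rewrite (phi_trunc_box phi z u (leqnn N)) [in RHS]exchange_big /= rmorph_sum.
apply: eq_bigr => k _; rewrite rmorph_sum; apply: eq_bigr => l _.
rewrite rmorph_sum; apply: eq_bigr => m _.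
refine (etrans (conj_mono _ _ _ _ _ _) _); congr (_ * _ * _ * _).
by rewrite [(l + k)%N]addnC; case: ifP => _; [rewrite herm conjcK|rewrite rmorph0].
Qed.

Lemma half_double (K : numFieldType) (x : K) : 2^-1 * (x + x) = x.
Proof. by field. Qed.

(** The terms of the new residual: the old one less its leading part [chi], and
    errors due to replacing [w] by its value on the quadric, to the nonlinearity
    of [F Fb] and to the change of arguments in [phi]. *)
Lemma newton_identity (A : comPzRingType)
  (k G Gb g gb gm gmb F Fb f fb fm fmb z zb chi P P' H H' : A) :
  k * (gm - gmb) - (zb * fm + z * fmb) + chi = H ->
  (G + g - (Gb + gb)) * k - ((F + f) * (Fb + fb) + (P' + H')) =
  ((G - Gb) * k - (F * Fb + P) - chi) + k * ((g - gm) - (gb - gmb))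
   - (fb * (F - z) + f * (Fb - zb) + f * fb) - (zb * (f - fm) + z * (fb - fmb))
   - (P' - P) - (H' - H).
Proof. by move=> <-; ring. Qed.

Section Newton.
Variables (R : realType) (Omega : set 'rV[R]_4) (rho : 'rV[R]_4 -> R) (p : 'rV[R]_4).
Hypotheses (openO : open Omega) (srho : smooth_on Omega rho) (Op : Omega p).
Variable ch : adapted_chart Omega rho p.
Variables a1 a2 b1 b2 kap : R[i].
Hypothesis Ez : forall q, ch_z ch q = a1 * zcoord (q - p) + a2 * wcoord (q - p).
Hypothesis Ew : forall q, ch_w ch q =
  b1 * zcoord (q - p) + b2 * wcoord (q - p) + kap * ch_z ch q ^+ 2.

Notation C := R[i].
Notation P2 := {poly {poly C}}.
Notation M := (zero_locus Omega rho).
Notation FM := (within M (nbhs p)).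
Notation z := (ch_z ch).
Notation w := (ch_w ch).
Notation u := (ucoord w).
Notation del := (gauge z w).
Notation cc := (- 'i%C / 2 : C).

Definition z_pol : P2 := pol2_cst a1 * pol2_x R + pol2_cst a2 * pol2_y R.
Definition w_pol : P2 := pol2_cst b1 * pol2_x R + pol2_cst b2 * pol2_y R + pol2_cst kap * z_pol ^+ 2.
Definition at_pt (q : 'rV[R]_4) (P : P2) : C := pol2_eval (zcoord (q - p)) (wcoord (q - p)) P.

Lemma at_pt_linear q c d :
  at_pt q (pol2_cst c * pol2_x R + pol2_cst d * pol2_y R) = c * zcoord (q - p) + d * wcoord (q - p).
Proof. by rewrite /at_pt pol2_evalD !pol2_evalM !pol2_eval_cst pol2_eval_x pol2_eval_y. Qed.

Lemma at_pt_z q : at_pt q z_pol = z q.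
Proof. by rewrite at_pt_linear Ez. Qed.
Lemma at_pt_w q : at_pt q w_pol = w q.
Proof.
rewrite Ew -at_pt_z -at_pt_linear /at_pt /w_pol; move: z_pol => Z.
by rewrite pol2_evalD (pol2_evalM _ _ _ (Z ^+ 2)) (pol2_evalX _ _ Z 2) pol2_eval_cst.
Qed.

(** The change of coordinates [(F, G)] and the coefficients of the normal form
    except for its term [|z|^2]. *)
Definition state := (P2 * P2 * (nat -> nat -> nat -> C))%type.

Definition residual n (s : state) (q : 'rV[R]_4) : C :=
  let f := at_pt q s.1.1 in let g := at_pt q s.1.2 in
  (g - g^*%C) * cc - (f * f^*%C + phi_trunc n.+3 s.2 f (complex.Re g)).

(** At stage [n] the hypersurface is in normal form up to weight [n + 3]. *)
Record stage n (s : state) : Prop := Stage {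
  st_F : pol2_order 2 (s.1.1 - z_pol);
  st_G : pol2_order 2 (s.1.2 - w_pol);
  st_Fz : bigO FM del 2 (fun q => at_pt q s.1.1 - z q);
  st_Gw : bigO FM del 3 (fun q => at_pt q s.1.2 - w q);
  st_herm : forall a b m, s.2 b a m = (s.2 a b m)^*%C;
  st_wt : forall a b m, (n.+3 <= a + b + 2 * m)%N -> s.2 a b m = 0;
  st_low : forall a b m, (a < 2)%N -> s.2 a b m = 0;
  st_mid : forall a b m, (a < 4)%N -> (b < 4)%N -> s.2 a b m = 0;
  st_res : bigO FM del n.+3 (residual n s) }.

(** A step of weight [n + 3] only involves monomials in [(z, w)] of degree greater
    than [n / 2], so that each coefficient is eventually constant. *)
Definition refines n (s s' : state) :=
  (forall a b, (2 * (a + b) < n.+2)%N ->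
     pol2_coef s'.1.1 a b = pol2_coef s.1.1 a b /\ pol2_coef s'.1.2 a b = pol2_coef s.1.2 a b) /\
  (forall a b m, (a + b + 2 * m)%N != n.+3 -> s'.2 a b m = s.2 a b m).

Let FF : Filter (nbhs p). Proof. exact: nbhs_filter. Qed.
Let FMF : Filter FM. Proof. exact: within_filter. Qed.
Let W01 : \forall q \near FM, 0 <= del q <= 1.
Proof. by apply: cvg_within; apply: near_gauge01. Qed.

Lemma z_pol_order : pol2_order 1 z_pol. Proof. exact: pol2_order1_linear. Qed.
Lemma w_pol_order : pol2_order 1 w_pol.
Proof.
apply: pol2_orderD; first exact: pol2_order1_linear.
by apply: pol2_orderZ; apply: (pol2_order_le (isT : (1 <= 1 * 2)%N)); apply: pol2_orderX z_pol_order.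
Qed.

Lemma weighted_exp k n (f : 'rV[R]_4 -> C) : weighted z w k f -> weighted z w 0 (fun q => f q ^+ n).
Proof.
move=> H; elim: n => [|n IH].
  by apply: weighted_eq (weighted_cst _ _ 1) => q; rewrite expr0.
apply: weighted_le (leq0n (k + 0)) _.
by apply: weighted_eq (weightedM H IH) => q; rewrite exprS.
Qed.

Lemma weighted_at_pt P : weighted z w 0 (fun q => at_pt q P).
Proof.
have [B HB] := pol2_eval_box P.
have Wz : weighted z w 1 (fun q => zcoord (q - p)).
  apply: weighted_eq (weightedD (ch_coord ch 0) (weightedZ 'i%C (ch_coord ch 1))) => q.
  by apply: eqC => /=; ring.
have Ww : weighted z w 1 (fun q => wcoord (q - p)).
  apply: weighted_eq (weightedD (ch_coord ch 2) (weightedZ 'i%C (ch_coord ch 3))) => q.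
  by apply: eqC => /=; ring.
have S : weighted z w 0 (fun q => \sum_(a < B) \sum_(b < B)
    pol2_coef P a b * zcoord (q - p) ^+ a * wcoord (q - p) ^+ b).
  apply: weighted_sum => a _; apply: weighted_sum => b _.
  by apply: (weightedM (k := 0) (l := 0)); [apply: weightedZ|]; apply: weighted_exp; [apply: Wz|apply: Ww].
by apply: weighted_eq S => q; rewrite /at_pt (HB _ (leqnn B)).
Qed.

Lemma weighted_residual n s : weighted z w 0 (residual n s).
Proof.
have HF := weighted_at_pt s.1.1; have HG := weighted_at_pt s.1.2.
have M0 (f g : 'rV[R]_4 -> C) : weighted z w 0 f -> weighted z w 0 g ->
  weighted z w 0 (fun q => f q * g q) by exact: weightedM.
have B0 (f g : 'rV[R]_4 -> C) : weighted z w 0 f -> weighted z w 0 g ->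
  weighted z w 0 (fun q => f q - g q).
  by move=> hf hg; apply: weighted_eq (weightedD hf (weightedZ (-1) hg)) => q; rewrite mulN1r.
have H1 := M0 _ _ (B0 _ _ HG (weighted_conj HG)) (weighted_cst z w cc).
have H2 := M0 _ _ HF (weighted_conj HF).
have HR := weighted_Re HG.
have T k l m : weighted z w 0 (fun q => s.2 k l m * at_pt q s.1.1 ^+ k *
    (at_pt q s.1.1)^*%C ^+ l * (complex.Re (at_pt q s.1.2))%:C%C ^+ m).
  exact: (M0 _ _ (M0 _ _ (M0 _ _ (weighted_cst z w (s.2 k l m)) (weighted_exp k HF))
    (weighted_exp l (weighted_conj HF))) (weighted_exp m HR)).
apply: (B0 _ _ H1 (weightedD H2 _)).
by rewrite /phi_trunc; do 3!(apply: weighted_sum => ? _); apply: T.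
Qed.

Lemma residual_real n s q : (forall a b m, s.2 b a m = (s.2 a b m)^*%C) ->
  (residual n s q)^*%C = residual n s q.
Proof.
move=> herm; rewrite /residual; move: (at_pt q s.1.1) (at_pt q s.1.2) => f g.
rewrite Im_conjE; refine (etrans (rmorphB (@conjc R) _ _) _); congr (_ - _); first exact: conj_R.
refine (etrans (rmorphD (@conjc R) _ _) _); congr (_ + _); last exact: phi_trunc_real.
by refine (etrans (rmorphM (@conjc R) _ _) _); rewrite /= conjcK mulrC.
Qed.

(* on M the weighted coordinate is that of the quadric to higher order *)
Lemma w_model : close FM del 2 1 w (fun q => wmodel (z q) (u q)).
Proof.
have [tau wtau Htau] := ch_eq ch 3.
have A := bigOD FF (bigO_nrm_gauge ch FF (fun A H => H) Htau) (weighted_bigO wtau).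
have A' := bigO_within A.
have e2 : (ch_sign ch)%:C%C * (ch_sign ch)%:C%C = 1 :> C.
  by rewrite -rmorphM -expr2 ch_sign2 rmorph1.
have D : bigO FM del 3 (fun q => w q - wmodel (z q) (u q)).
  apply: (bigO_near FMF _ (bigOZ FMF (- 'i%C * (ch_sign ch)%:C%C) A')).
  apply: (@filterS _ (nbhs p) _ setT) => [q _ Mq|]; last exact: filterT.
  have [_ ->] := Mq.
  have Ew' : w q = (u q)%:C%C + 'i%C * (vcoord w q)%:C%C.
    by rewrite /ucoord /vcoord; case: (w q) => ? ?; apply: eqC => /=; ring.
  rewrite {1}Ew' /wmodel; move: e2 (u q)%:C%C (vcoord w q)%:C%C (tau q) (z q) (z q)^*%C 'i%C.
  move: (ch_sign ch)%:C%C => e ee U V t Z Zb i.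
  rewrite subrK sub0r.
  have -> : - i * e * - (e * (V - Z * Zb)) = i * (e * e) * (V - Z * Zb) by ring.
  rewrite ee; ring.
apply: (close_intro FMF W01) => //.
have Hw : bigO FM del 2 w by exists 1; apply: nearW => q; rewrite mul1r w_le_gauge.
by apply: bigO_eq (bigOB FMF Hw (bigO_le FMF W01 (isT : (2 <= 3)%N) D)) => q; rewrite subKr.
Qed.

Lemma bigO_at_zb k (f : 'rV[R]_4 -> C) : bigO FM del k f ->
  bigO FM del k.+1 (fun q => (z q)^*%C * f q) /\ bigO FM del k.+1 (fun q => z q * f q).
Proof.
have Hz := bigO_within (bigO_gauge_z ch).
move=> H; split; first exact: (bigOM FMF (bigO_conj FMF Hz) H).
exact: (bigOM FMF Hz H).
Qed.

Lemma twice_re_half (x : C) : twice_re (2^-1 * x) = 2^-1 * (x + x^*%C).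
Proof.
have -> : 2^-1 = (2^-1 : R)%:C%C :> C by rewrite fmorphV rmorph_nat.
by case: x => a b; apply: eqC => /=; ring.
Qed.

(* the leading part of the residual is a homogeneous polynomial *)
Lemma residual_lead n s : stage n s -> exists psi, whom n.+3 psi /\
  bigO FM del n.+4 (fun q => residual n s q - twice_re (psi (z q) (u q))).
Proof.
move=> st; have wr := weighted_residual n s.
have [h [s0 [sh ws Hs]]] := smooth_divisible openO Op ch n.+4 (weighted_smooth openO wr).
have Hs' : bigO FM del n.+4 (fun q => residual n s q - s0 (z q) (u q)).
  apply: (bigO_near FMF _ (bigO_within Hs)).
  apply: (@filterS _ (nbhs p) _ setT) => [q _ Mq|]; last exact: filterT.
  by have [_ ->] := Mq; rewrite mulr0 subr0.
have sM : bigO FM del n.+3 (fun q => s0 (z q) (u q)).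
  apply: bigO_eq (bigOB FMF (st_res st) (bigO_le FMF W01 (leqnSn _) Hs')) => q.
  by rewrite subKr.
have [psi [s' [Hp Hs0 E]]] := wpol_peel (wpol_order openO srho Op ws sM).
have D : bigO FM del n.+4 (fun q => residual n s q - psi (z q) (u q)).
  apply: bigO_eq (bigOD FMF Hs' (bigO_within (weighted_bigO (wpol_weighted ch Hs0)))) => q.
  by rewrite E opprD addrA subrK.
exists (fun x t => 2^-1 * psi x t); split.
  have := whomM (whom_mono (2^-1) 0 0 0) Hp; rewrite -[(0 + 0 + 2 * 0 + n.+3)%N]/(n.+3).
  by congr whom; apply/funext => x; apply/funext => t; rewrite !expr0 !mulr1.
have D2 := bigOZ FMF 2^-1 (bigOD FMF D (bigO_conj FMF D)).
apply: bigO_eq D2 => q; rewrite rmorphB /= (residual_real _ _ (st_herm st)).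
rewrite twice_re_half; move: (residual n s q) (psi _ _) (psi _ _)^*%C => r x xb.
rewrite addrACA -opprD mulrBr; congr (_ - _).
exact: half_double.
Qed.

(** The leading part of the residual is removed by solving the linearized
    equation; all other terms gain one order. *)
Lemma newton_step n s : stage n s -> exists s', stage n.+1 s' /\ refines n s s'.
Proof.
move=> st; have [psi [Hpsi Hlead]] := residual_lead st.
have [f [g [eta [wf wg [eherm ewt elow emid] Hlin]]]] := solv_whom (isT : (2 < n.+3)%N) Hpsi.
pose F' := s.1.1 + leval (pol2_cst (R := R)) z_pol w_pol f.
pose G' := s.1.2 + leval (pol2_cst (R := R)) z_pol w_pol g.
pose phi' a b m := s.2 a b m + eta a b m.
pose fv q := leval id (z q) (w q) f; pose gv q := leval id (z q) (w q) g.
pose wm q := wmodel (z q) (u q).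
pose fm q := leval id (z q) (wm q) f; pose gm q := leval id (z q) (wm q) g.
have F'E q : at_pt q F' = at_pt q s.1.1 + fv q.
  by rewrite /at_pt pol2_evalD pol2_eval_leval -!/(at_pt _ _) at_pt_z at_pt_w.
have G'E q : at_pt q G' = at_pt q s.1.2 + gv q.
  by rewrite /at_pt pol2_evalD pol2_eval_leval -!/(at_pt _ _) at_pt_z at_pt_w.
have Hz1 : close FM del 1 1 z z.
  have Hz := bigO_within (bigO_gauge_z ch); split => //.
  by apply: bigO_eq (bigO0 FMF del _) => q; rewrite subrr.
have Cf := close_leval FMF wf Hz1 (w_model); have Cg := close_leval FMF wg Hz1 (w_model).
have Of : bigO FM del n.+2 fv by case: Cf.
have Og : bigO FM del n.+3 gv by case: Cg.
have Hz := bigO_within (bigO_gauge_z ch).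
have CF : close FM del 1 1 (fun q => at_pt q s.1.1) z.
  by apply: (close_intro FMF W01) => //; exact: st_Fz st.
have Hw : bigO FM del 2 w by case: w_model.
have CG : close FM del 2 1 (fun q => at_pt q s.1.2) w.
  by apply: (close_intro FMF W01) => //; exact: st_Gw st.
have OF : bigO FM del 1 (fun q => at_pt q s.1.1) by case: CF.
have OG : bigO FM del 2 (fun q => at_pt q s.1.2) by case: CG.
have st_Fz' : bigO FM del 2 (fun q => at_pt q F' - z q).
  apply: bigO_eq (bigOD FMF (st_Fz st) (bigO_le FMF W01 (isT : (2 <= n.+2)%N) Of)) => q.
  by rewrite F'E addrAC.
have st_Gw' : bigO FM del 3 (fun q => at_pt q G' - w q).
  apply: bigO_eq (bigOD FMF (st_Gw st) (bigO_le FMF W01 (isT : (3 <= n.+3)%N) Og)) => q.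
  by rewrite G'E addrAC.
have deg_f : all (fun x : C * nat * nat => 2 <= x.1.2 + x.2)%N f.
  by apply: sub_all wf => x /andP[].
have deg_g : all (fun x : C * nat * nat => 2 <= x.1.2 + x.2)%N g.
  by apply: sub_all wg => x /andP[].
have CFF : close FM del 1 n.+1 (fun q => at_pt q F') (fun q => at_pt q s.1.1).
  by apply: (close_intro FMF W01) => //; apply: bigO_eq Of => q; rewrite F'E addrAC subrr add0r.
have CGG : close FM del 2 n.+1 (fun q => at_pt q G') (fun q => at_pt q s.1.2).
  by apply: (close_intro FMF W01) => //; apply: bigO_eq Og => q; rewrite G'E addrAC subrr add0r.
have CFz : close FM del 1 1 (fun q => at_pt q F') z by apply: (close_intro FMF W01).
have CGw : close FM del 2 1 (fun q => at_pt q G') w by apply: (close_intro FMF W01).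
(* the weights in phi start at 6, so a change of the arguments of relative order
   n + 1 only matters from the order n + 7 on *)
have low6 a b m : (a + b + 2 * m < 6)%N -> s.2 a b m = 0.
  move=> h; have [al|al] := ltnP a 2; first exact: (st_low st).
  have [bl|bl] := ltnP b 2; first by rewrite (st_herm st) (st_low st) ?rmorph0.
  by apply: (st_mid st); lia.
have lowk a b m : (a + b + 2 * m < n.+3)%N -> eta a b m = 0 by move=> h; apply: ewt; lia.
have T5 := close_phi_trunc FMF W01 n.+3 low6 CFF CGG.
have T6 := close_phi_trunc FMF W01 n.+3 lowk CFz CGw.
have Dg : bigO FM del n.+4 (fun q => gv q - gm q) by apply: (close_diff FMF W01 Cg); rewrite addn1.
have Df : bigO FM del n.+3 (fun q => fv q - fm q) by apply: (close_diff FMF W01 Cf); rewrite addn1.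
have T2 := bigOZ FMF cc (bigOB FMF Dg (bigO_conj FMF Dg)).
have T3a := bigOM FMF (bigO_conj FMF Of) (st_Fz st).
have T3b := bigOM FMF Of (bigO_conj FMF (st_Fz st)).
have T3c := bigO_le FMF W01 (_ : n.+2 + 2 <= n.+2 + n.+2)%N (bigOM FMF Of (bigO_conj FMF Of)).
have {}T3c := T3c (leq_add (leqnn _) (isT : (2 <= n.+2)%N)).
have T3 := bigOD FMF (bigOD FMF T3a T3b) T3c.
have [T4a _] := bigO_at_zb Df; have [_ T4b] := bigO_at_zb (bigO_conj FMF Df).
have e4 : (n.+2 + 2 = n.+4)%N by lia.
have e6 : (n.+3 + 1 = n.+4)%N by lia.
rewrite e4 in T3; rewrite e6 in T6.
have {}T5 := bigO_le FMF W01 (_ : n.+4 <= 6 + n.+1)%N T5.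
have {}T5 := T5 (leq_add (isT : (3 <= 6)%N) (leqnn n.+1)).
have main := bigOB FMF (bigOB FMF (bigOB FMF (bigOB FMF (bigOD FMF Hlead T2) T3)
   (bigOD FMF T4a T4b)) T5) T6.
exists (F', G', phi'); split; last split.
- split => /=.
  + rewrite /F' addrAC; apply: pol2_orderD; first exact: st_F st.
    exact: pol2_order_leval z_pol_order w_pol_order deg_f.
  + rewrite /G' addrAC; apply: pol2_orderD; first exact: st_G st.
    exact: pol2_order_leval z_pol_order w_pol_order deg_g.
  + exact: st_Fz'.
  + exact: st_Gw'.
  + by move=> a b m; rewrite /phi' (st_herm st) eherm rmorphD.
  + by move=> a b m h; rewrite /phi' (st_wt st) ?ewt ?addr0 //; lia.
  + by move=> a b m h; rewrite /phi' (st_low st) ?elow ?addr0.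
  + by move=> a b m h h'; rewrite /phi' (st_mid st) ?emid ?addr0.
  + apply: bigO_eq main => q; rewrite /residual /= F'E G'E.
    rewrite phi_truncD (phi_trunc_le (N := n.+3) _ _ (leqnSn _)); last first.
      by move=> a b m h; apply: (st_wt st); lia.
    rewrite (phi_trunc_le (N := n.+3) _ _ (leqnSn _)); last first.
      by move=> a b m h; apply: ewt; lia.
    rewrite !(rmorphD (@conjc R), rmorphN (@conjc R)) /=.
    apply/esym; apply: newton_identity.
    exact: (Hlin (z q) (u q)).
- move=> a b ab /=; rewrite /F' /G' !pol2_coefD; split.
    rewrite (_ : pol2_coef (leval _ _ _ f) a b = 0) ?addr0 //.
    apply: (pol2_order_leval (n := (a + b).+1) z_pol_order w_pol_order) => //.
    by apply: sub_all wf => x /andP[/eqP h _]; lia.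
  rewrite (_ : pol2_coef (leval _ _ _ g) a b = 0) ?addr0 //.
  apply: (pol2_order_leval (n := (a + b).+1) z_pol_order w_pol_order) => //.
  by apply: sub_all wg => x /andP[/eqP h _]; lia.
- by move=> a b m h /=; rewrite /phi' ewt ?addr0.
Qed.

End Newton.

(** * Existence of normal forms *)

Lemma limit_identity (A : comPzRingType) (k w wb G Gb a b x y : A) :
  (w - wb) * k - y = (G - Gb) * k - (a + b) - k * (G - w - (Gb - wb)) + (a + b - x) + (x - y).
Proof. by ring. Qed.

Section Existence.
Variables (R : realType) (Omega : set 'rV[R]_4) (rho : 'rV[R]_4 -> R) (p : 'rV[R]_4).
Hypotheses (openO : open Omega) (srho : smooth_on Omega rho) (Op : Omega p).
Variable ch : adapted_chart Omega rho p.
Variables a1 a2 b1 b2 kap : R[i].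
Hypothesis Ez : forall q, ch_z ch q = a1 * zcoord (q - p) + a2 * wcoord (q - p).
Hypothesis Ew : forall q, ch_w ch q =
  b1 * zcoord (q - p) + b2 * wcoord (q - p) + kap * ch_z ch q ^+ 2.
Hypothesis J0 : a1 * b2 - a2 * b1 != 0.

Notation C := R[i].
Notation M := (zero_locus Omega rho).
Notation FM := (within M (nbhs p)).
Notation z := (ch_z ch).
Notation w := (ch_w ch).
Notation del := (gauge z w).
Notation nrm := (fun q : 'rV[R]_4 => `|q - p|).
Notation z_pol := (z_pol a1 a2).
Notation w_pol := (w_pol a1 a2 b1 b2 kap).
Notation at_pt := (@at_pt R p).
Notation stage := (stage ch a1 a2 b1 b2 kap).
Notation state := (state R).

Let FMF : Filter FM. Proof. exact: within_filter. Qed.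
Let n01 : \forall q \near FM, 0 <= nrm q <= 1.
Proof. by apply: cvg_within; apply: near_nrm01. Qed.

Lemma stage0 : stage 0 (z_pol, w_pol, fun _ _ _ => 0).
Proof.
split=> //=.
- by rewrite subrr; apply: pol2_order0.
- by rewrite subrr; apply: pol2_order0.
- by apply: bigO_eq (bigO0 FMF _ _) => q; rewrite (at_pt_z Ez) subrr.
- by apply: bigO_eq (bigO0 FMF _ _) => q; rewrite (at_pt_w Ez Ew) subrr.
- by move=> *; exact: (esym (rmorph0 (@conjc R))).
have [_ _ D] := w_model ch.
apply: bigO_eq (bigOZ FMF (- 'i%C) D) => q.
rewrite /residual /= (at_pt_z Ez) (at_pt_w Ez Ew) phi_trunc_zero addr0 Im_conjE /wmodel.
rewrite /ucoord; move: (z q) (w q) => x [s t]; case: x => x y; apply: eqC => /=; ring.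
Qed.

Lemma stages : exists s : nat -> state,
  forall n, stage n (s n) /\ refines n (s n) (s n.+1).
Proof.
have step (ns : nat * state) : exists s', stage ns.1 ns.2 -> stage ns.1.+1 s' /\ refines ns.1 ns.2 s'.
  case: (pselect (stage ns.1 ns.2)) => st; last by exists ns.2.
  by have [s' Hs] := newton_step openO srho Op Ez Ew st; exists s'.
have [nxt Hn] := choice step.
pose s := fix s n : state := if n is m.+1 then nxt (m, s m) else (z_pol, w_pol, fun _ _ _ => 0).
exists s => n.
suff st : stage n (s n) by split=> //; apply: (Hn (n, s n) st).2.
by elim: n => [|n IH]; [exact: stage0|exact: (Hn (n, s n) IH).1].
Qed.

Lemma coord_mono_small a b :
  bigO FM nrm (a + b) (fun q => zcoord (q - p) ^+ a * wcoord (q - p) ^+ b).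
Proof.
have H (i j : 'I_4) : bigO FM nrm 1 (fun q => (q - p) 0 i +i* (q - p) 0 j)%C.
  exists 2; apply: nearW => q; rewrite expr1 mulr2n mulrDl mul1r.
  by apply: le_trans (modulus_le_ReIm _) _; apply: lerD; apply: coord_le_norm.
have := bigOM FMF (bigOX FMF a (H 0 1)) (bigOX FMF b (H 2 3)).
by rewrite !mul1n.
Qed.

Lemma at_pt_trunc N P (H : nat -> nat -> C) :
  (forall a b, (a + b <= N)%N -> pol2_coef P a b = H a b) ->
  bigO FM nrm N.+1 (fun q => at_pt q P - hol_trunc N H (zcoord (q - p)) (wcoord (q - p))).
Proof.
move=> E; have [B HB] := pol2_eval_box P; pose K := maxn B N.+1.
have BK : (B <= K)%N by apply: leq_maxl.
have NK : (N < K)%N by apply: leq_maxr.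
have S : bigO FM nrm N.+1 (fun q => \sum_(a < K) \sum_(b < K)
   (pol2_coef P a b - (if (a + b <= N)%N then H a b else 0)) *
   (zcoord (q - p) ^+ a * wcoord (q - p) ^+ b)).
  do 2!(apply: (bigO_sum FMF) => ? _); case: leqP => ab.
    by apply: bigO_eq (bigO0 FMF _ _) => q; rewrite E // subrr mul0r.
  by apply: (bigOZ FMF); apply: (bigO_le FMF n01 ab); apply: coord_mono_small.
apply: bigO_eq S => q; rewrite /at_pt (HB _ BK) (hol_trunc_box _ _ _ NK) -sumrB.
apply: eq_bigr => a _; rewrite -sumrB; apply: eq_bigr => b _.
by rewrite mulrBl !mulrA.
Qed.

Lemma bigO_phi_tail N K (phi phi' : nat -> nat -> nat -> C) (f g : 'rV[R]_4 -> C) : (N <= K)%N ->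
  (forall a b m, (a + b + m <= N)%N -> phi a b m = phi' a b m) ->
  bigO FM nrm 1 f -> bigO FM nrm 1 g ->
  bigO FM nrm N.+1 (fun q => phi_trunc K phi (f q) (complex.Re (g q)) -
                             phi_trunc N phi' (f q) (complex.Re (g q))).
Proof.
move=> NK E Hf /(bigO_R FMF) Hg.
have S : bigO FM nrm N.+1 (fun q => \sum_(a < K.+1) \sum_(b < K.+1) \sum_(m < K.+1)
   ((if (a + b + m <= K)%N then phi a b m else 0) - (if (a + b + m <= N)%N then phi' a b m else 0)) *
   (f q ^+ a * (f q)^*%C ^+ b * (complex.Re (g q))%:C%C ^+ m)).
  apply: (bigO_sum FMF) => a _; apply: (bigO_sum FMF) => b _; apply: (bigO_sum FMF) => m _.
  have [h|h] := leqP (a + b + m) N.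
    by apply: bigO_eq (bigO0 FMF _ _) => q; rewrite (leq_trans h NK) E // subrr mul0r.
  apply: (bigOZ FMF); apply: (bigO_le FMF n01 h).
  have := bigOM FMF (bigOM FMF (bigOX FMF a Hf) (bigOX FMF b (bigO_conj FMF Hf))) (bigOX FMF m Hg).
  by rewrite !mul1n.
apply: bigO_eq S => q; rewrite (phi_trunc_box phi _ _ (leqnn K)) (phi_trunc_box phi' _ _ NK) -sumrB.
apply: eq_bigr => a _; rewrite -sumrB; apply: eq_bigr => b _; rewrite -sumrB; apply: eq_bigr => m _.
by rewrite mulrBl !mulrA.
Qed.

Lemma pol2_order2_coef (P Q : {poly {poly C}}) a b : pol2_order 2 (P - Q) -> (a + b < 2)%N ->
  pol2_coef P a b = pol2_coef Q a b.
Proof. by move=> H ab; rewrite -[P](subrK Q) pol2_coefD H // add0r. Qed.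

Lemma w_pol_linear : pol2_coef w_pol 1 0 = b1 /\ pol2_coef w_pol 0 1 = b2.
Proof.
have [h1 h2] := pol2_coef_linear b1 b2.
have O : pol2_order 2 (pol2_cst kap * z_pol ^+ 2).
  by apply: pol2_orderZ; apply: (pol2_order_le (isT : (2 <= 1 * 2)%N)); apply: pol2_orderX; apply: z_pol_order.
by split; rewrite /w_pol pol2_coefD ?h1 ?h2 O ?addr0.
Qed.

(** The coefficients of degree [d] are final at stage [2 d].  At stage [2 N + 2] the
    residual has the order [2 N + 2] in the gauge, that is [N + 1] in the distance
    to [p], and the terms cut off have the same order. *)
Theorem normal_form_exists : exists F G phi,
  [/\ formal_coords F G, chern_moser_normal phi & formally_given_by M p F G phi].
Proof.
have [s Hs] := stages.
have st n := (Hs n).1; have rf n := (Hs n).2.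
pose F a b := pol2_coef (s (2 * (a + b))%N).1.1 a b.
pose G a b := pol2_coef (s (2 * (a + b))%N).1.2 a b.
pose psi a b m := (s (a + b + 2 * m)%N).2 a b m.
pose phi a b m := delta_arr 1 1 1 0 a b m + psi a b m.
have FGE n a b : (2 * (a + b) <= n)%N ->
    pol2_coef (s n).1.1 a b = F a b /\ pol2_coef (s n).1.2 a b = G a b.
  elim: n => [|n IH] h.
    by rewrite /F /G; have -> : (2 * (a + b) = 0)%N by lia.
  have [e|ne] := eqVneq (2 * (a + b))%N n.+1; first by rewrite /F /G e.
  have [IH1 IH2] : pol2_coef (s n).1.1 a b = F a b /\ pol2_coef (s n).1.2 a b = G a b.
    by apply: IH; lia.
  have [r _] := rf n; have [-> ->] : pol2_coef (s n.+1).1.1 a b = pol2_coef (s n).1.1 a b /\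
    pol2_coef (s n.+1).1.2 a b = pol2_coef (s n).1.2 a b by apply: r; lia.
  by [].
have psiE n a b m : (a + b + 2 * m <= n)%N -> (s n).2 a b m = psi a b m.
  elim: n => [|n IH] h.
    by rewrite /psi; have -> : (a + b + 2 * m = 0)%N by lia.
  have [e|ne] := eqVneq (a + b + 2 * m)%N n.+1; first by rewrite /psi e.
  have [_ r] := rf n; rewrite r; first by apply: IH; lia.
  by apply/eqP; lia.
exists F, G, phi; split.
- split.
  + rewrite /F (pol2_order2_coef (st_F (st _))) //; exact: z_pol_order.
  + rewrite /G (pol2_order2_coef (st_G (st _))) //; exact: w_pol_order.
  + rewrite /F /G !(pol2_order2_coef (st_F (st _))) // !(pol2_order2_coef (st_G (st _))) //.
    have [-> ->] := w_pol_linear; have [e1 e2] := pol2_coef_linear a1 a2.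
    by rewrite [pol2_coef z_pol 1 0]e1 [pol2_coef z_pol 0 1]e2.
- split; last split; last split; last split.
  + move=> k l m; rewrite /phi rmorphD; congr (_ + _); last first.
      by rewrite /psi [(l + k)%N]addnC; apply: (st_herm (st _)).
    rewrite /delta_arr [X in X && _]andbC; case: ifP => _; rewrite ?rmorph0 //.
    exact: (esym (rmorph1 (@conjc R))).
  + move=> m; rewrite /phi /delta_arr /psi (st_mid (st _)) // addr0.
    by case: (m == 0%N).
  + by move=> k m; rewrite /phi /delta_arr /psi (st_low (st _)) // addr0.
  + move=> t m t2; rewrite /phi /delta_arr /psi (st_low (st _)) // ?addr0.
    by case: t t2 => [|[|t]].
  + by move=> m; split; rewrite /phi /delta_arr /psi (st_mid (st _)) // addr0.
move=> N; pose n := (2 * N).+2; pose K := n.+3.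
have stn := st n.
(* at this stage the coefficients of total degree at most N are final, both of
   (F, G) and of phi, where the exponent of u counts twice *)
have E1 : bigO FM nrm N.+1 (residual p n (s n)).
  apply: (bigO_gauge_nrm FMF) (_ : bigO FM del N.+1.*2 _).
    by move=> A HA; apply: filterS HA => x Ax _.
  by apply: (bigO_le FMF _ _ (st_res stn)); [apply: cvg_within; apply: near_gauge01|rewrite /n; lia].
have A1 := at_pt_trunc (N := N) (P := (s n).1.1) (H := F).
have A2 := at_pt_trunc (N := N) (P := (s n).1.2) (H := G).
pose z' q := hol_trunc N F (zcoord (q - p)) (wcoord (q - p)).
pose w' q := hol_trunc N G (zcoord (q - p)) (wcoord (q - p)).
have D1 : bigO FM nrm N.+1 (fun q => at_pt q (s n).1.1 - z' q).
  by apply: A1 => a b ab; apply: (FGE _ _ _ _).1; rewrite /n; lia.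
have D2 : bigO FM nrm N.+1 (fun q => at_pt q (s n).1.2 - w' q).
  by apply: A2 => a b ab; apply: (FGE _ _ _ _).2; rewrite /n; lia.
have small P : pol2_order 1 P -> bigO FM nrm 1 (fun q => at_pt q P).
  move=> OP; apply: bigO_eq (at_pt_trunc (N := 0) (P := P) (H := fun _ _ => 0) _) => [q|a b ab].
    by rewrite /hol_trunc big1 ?subr0 // => a _; rewrite big1 // => b _; rewrite !mul0r.
  by apply: OP; lia.
have order1 (P Q : {poly {poly C}}) : pol2_order 2 (P - Q) -> pol2_order 1 Q -> pol2_order 1 P.
  move=> h1 h2; rewrite -[P](subrK Q); apply: pol2_orderD h2; exact: (pol2_order_le (isT : (1 <= 2)%N)).
have CF : close FM nrm 1 N (fun q => at_pt q (s n).1.1) z'.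
  split=> //; first by apply: small; apply: order1 (st_F stn) _; apply: z_pol_order.
  apply: bigO_eq (bigOB FMF (small _ (order1 _ _ (st_F stn) (z_pol_order _ _)))
    (bigO_le FMF n01 (isT : (1 <= N.+1)%N) D1)) => q; by rewrite subKr.
have CG : close FM nrm 1 N (fun q => at_pt q (s n).1.2) w'.
  split=> //; first by apply: small; apply: order1 (st_G stn) _; apply: w_pol_order.
  apply: bigO_eq (bigOB FMF (small _ (order1 _ _ (st_G stn) (w_pol_order _ _ _ _ _)))
    (bigO_le FMF n01 (isT : (1 <= N.+1)%N) D2)) => q; by rewrite subKr.
pose Phi a b m := delta_arr 1 1 1 0 a b m + (s n).2 a b m.
have Phi0 a b m : (a + b + 1 * m < 1)%N -> Phi a b m = 0.
  case: a b m => [|a] [|b] [|m] // _; by rewrite /Phi (st_low stn) // addr0.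
have T2 := close_phi_trunc FMF n01 K Phi0 CF CG.
have T3 : bigO FM nrm N.+1 (fun q => phi_trunc K Phi (z' q) (complex.Re (w' q)) -
    phi_trunc N phi (z' q) (complex.Re (w' q))).
  apply: bigO_phi_tail; [by rewrite /K /n; lia| |by case: CF|by case: CG].
  by move=> a b m h; rewrite /Phi /phi psiE // /n; lia.
have T1 := bigOZ FMF (- 'i%C / 2) (bigOB FMF D2 (bigO_conj FMF D2)).
rewrite add1n in T2.
have [K0 HK0] := bigOD FMF (bigOD FMF (bigOB FMF E1 T1) T2) T3.
exists K0; apply: filterS HK0 => q; rewrite le_normcE; apply: le_trans.
rewrite le_eqVlt; apply/orP; left; apply/eqP; congr modulus.
have e11 : phi_trunc K (delta_arr 1 1 1 0) (at_pt q (s n).1.1) (complex.Re (at_pt q (s n).1.2)) =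
    at_pt q (s n).1.1 * (at_pt q (s n).1.1)^*%C.
  by rewrite phi_trunc_delta // !expr1 expr0 mulr1 mul1r.
rewrite /residual /Phi [phi_trunc K _ (at_pt _ _) _]phi_truncD e11 -Im_conjE.
rewrite -/(z' q) -/(w' q) !(rmorphD (@conjc R), rmorphN (@conjc R)) /=.
exact: limit_identity.
Qed.

End Existence.

(** * The set of umbilical points *)

Theorem proposition4p1 (R : realType) (Omega : set 'rV[R]_4)
    (rho : 'rV[R]_4 -> R)
    (Omega_open : open Omega)
    (rho_smooth : smooth_on Omega rho)
    (drho_neq0 : forall p, zero_locus Omega rho p ->
       exists v : 'rV[R]_4, 'd rho p v != 0)
    (levi_nd : levi_nondegenerate (zero_locus Omega rho) rho) :
  umbilical_points (zero_locus Omega rho) =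
  [set p | zero_locus Omega rho p /\ \det (A3 rho p) = 0].
Proof.
apply/seteqP; split=> p [Mp Hp]; split=> //; have [Op rho0] := Mp;
  have [ch [a1 [a2 [b1 [b2 [k [Ez Ew J0]]]]]]] :=
    chart_exists Omega_open rho_smooth Op rho0 (drho_neq0 p Mp) (levi_nd p Mp).
  have [F [G [phi [FG CM given phi24]]]] := Hp.
  by rewrite (det_A3_eq0_iff Omega_open rho_smooth Op rho0 ch FG CM (leqnn 127) given).
have [F [G [phi [FG CM given]]]] := normal_form_exists Omega_open rho_smooth Op Ez Ew J0.
exists F, G, phi; split=> //.
by rewrite -(det_A3_eq0_iff Omega_open rho_smooth Op rho0 ch FG CM (leqnn 127) given).
Qed.
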